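(* Let $(\mathcal G,\underline a)$ be a finite compact oriented metric graph with edge set $\mathcal I$, $|\mathcal I|=n$, edge lengths $a_j>0$, $I_j=(0,a_j)$, and initial/terminal vertices $\partial_-(j),\partial_+(j)$ of each edge $j\in\mathcal I$. For each $j\in\mathcal I$ let $X_j$ be a complex Hilbert space and $A_j$ an operator in $X_j$ with $-A_j$ sectorial of angle $<\pi/2$, let $\mathbb B\in\mathcal L(\mathcal K_A)$ with $\mathcal K_A=\bigoplus_{j\in\mathcal I}[X_j,D(A_j)]_{1/2}$, and consider the time-graph Cauchy problem $$\partial_t\psi_j-A_j\psi_j=f_j\ \text{ on }I_j\ (j\in\mathcal I),\qquad \underline\psi_--\mathbb B\underline\psi_+=\underline g .\tag{CP}$$ Suppose that $(\mathcal G,\underline a)$ contains a directed loop which is reflected by the boundary conditions. (a) Then (CP) is not iteratively solvable as a sequence of initial value problems. (b) If the loop contains more than one edge, then (CP) is not iteratively solvable as a sequence of Cauchy problems on intervals.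
   Context: Directed loop: a sequence of edges $i_1,\dots,i_m$ with $\partial_+(i_m)=\partial_-(i_1)$, $\partial_+(i_1)=\partial_-(i_2)$, …, $\partial_+(i_{m-1})=\partial_-(i_m)$. It is reflected by the boundary conditions if $\mathbb B_{i_ji_{j+1}}\ne0$ for each $j=1,\dots,m$, where $i_{m+1}:=i_1$. Notation: $\mathbb B_{ij}$ is the block of $\mathbb B$ mapping the $j$-th component to the $i$-th component; $\underline\psi_-=\{\psi_j(0)\}_j$, $\underline\psi_+=\{\psi_j(a_j)\}_j$; $[\cdot,\cdot]_{1/2}$ is complex interpolation ($D(A_j)$ with graph norm). Data: $f\in\bigoplus_jL^2(I_j;X_j)$, $\underline g\in\mathcal K_A$; solutions are understood in $\bigoplus_jW^{1,2}(I_j;X_j)\cap\bigoplus_jL^2(I_j;D(A_j))$ (whose elements have boundary values in $\mathcal K_A$). Definition. (CP) is iteratively solvable as a sequence of Cauchy problems on intervals if there exists an ordering of the edges, written $1,\dots,n$ after relabelling, and linear functions $\varphi_j$, $1\le j\le n-1$ (not depending on the data $f$ nor on the particular solution), such that for all data $f,\underline g$ every solution $\psi$ of (CP) satisfies $$\partial_t\psi_n-A_n\psi_n=f_n,\qquad \psi_n(0)-\mathbb B_{nn}\psi_n(a_n)=g_n,$$ and, for every $1\le j\le n-1$, $$\partial_t\psi_j-A_j\psi_j=f_j,\qquad \psi_j(0)-\mathbb B_{jj}\psi_j(a_j)=\varphi_j(\psi_{j+1},\dots,\psi_n,\underline g).$$ If moreover $\mathbb B_{jj}=0$ for all $j$,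 (CP) is called iteratively solvable as a sequence of initial value problems. A closed densely defined operator $B$ is sectorial of angle $\omega\in(0,\pi)$ if $\sigma(B)\subset\overline{\Sigma_\omega}$, $\Sigma_\omega=\{\lambda\in\mathbb C\setminus\{0\}:|\arg\lambda|<\omega\}$, and $\sup\{\|\lambda(\lambda-B)^{-1}\|:\lambda\ne0,\ \nu\le|\arg\lambda|\le\pi\}<\infty$ for all $\nu\in(\omega,\pi)$. *)

(* Defs.v *)
From HB Require Import structures.
From mathcomp Require Import all_boot all_order all_algebra.
From mathcomp Require Import complex.
From mathcomp Require Import all_classical all_reals all_analysis.

Set Implicit Arguments.
Unset Strict Implicit.
Unset Printing Implicit Defensive.

Import Order.TTheory GRing.Theory Num.Theory numFieldNormedType.Exports.

Local Open Scope classical_set_scope.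
Local Open Scope ring_scope.
Local Open Scope complex_scope.

(* The norm of a normed module over R[i] is itself R[i]-valued (with values in
   the nonnegative reals); [nrm] is the same norm with values in R. *)
Definition nrm (R : realType) (X : normedModType R[i]) (x : X) : R :=
  complex.Re `|x|.

Definition hilbert (R : realType) (X : completeNormedModType R[i]) : Prop :=
  exists ip : {dot X for Num.conj}, forall x : X, `|x| ^+ 2 = ip x x.

Section Operators.
Context (R : realType) (X : completeNormedModType R[i]).

(* An unbounded operator is a domain together with a total function, whose
   values outside the domain are irrelevant. *)
Record operator := Operator { dom : set X; app :> X -> X }.

Definition opp_operator (B : operator) : operator :=
  Operator (dom B) (fun x => - B x).

Definition linear_operator (B : operator) : Prop :=
  dom B 0 /\
  forall (c : R[i]) (x y : X), dom B x -> dom B y ->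
    dom B (c *: x + y) /\ B (c *: x + y) = c *: B x + B y.

Definition closed_operator (B : operator) : Prop :=
  closed [set p : X * X | dom B p.1 /\ p.2 = B p.1].

Definition is_resolvent (B : operator) (l : R[i]) (S : X -> X) : Prop :=
  [/\ forall x, dom B (S x) /\ l *: S x - B (S x) = x,
      forall x, dom B x -> S (l *: x - B x) = x
    & exists M : R, forall x, nrm (S x) <= M * nrm x].

Definition spectrum (B : operator) : set R[i]^o :=
  [set l | ~ exists S, is_resolvent B l S].

Definition polar (r theta : R) : R[i] := (r * cos theta) +i* (r * sin theta).

Definition sector (omega : R) : set R[i]^o :=
  [set z | exists r theta, [/\ 0 < r, `|theta| < omega & z = polar r theta]].

Definition sectorial (omega : R) (B : operator) : Prop :=
  [/\ 0 < omega < pi,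
      [/\ linear_operator B, closed_operator B & dense (dom B)],
      spectrum B `<=` closure (sector omega)
    & forall nu : R, omega < nu < pi ->
        exists M : R, forall r theta : R, 0 < r -> nu <= `|theta| <= pi ->
        forall S, is_resolvent B (polar r theta) S ->
        forall x, nrm (polar r theta *: S x) <= M * nrm x].

(* A linear subspace of X with a norm of its own. The norm is only meaningful
   on the subspace. *)
Record normed_subspace :=
  NormedSubspace { carrier :> X -> Prop; snorm : X -> R }.

Definition whole_space : normed_subspace := NormedSubspace setT (@nrm R X).

Definition graph_space (B : operator) : normed_subspace :=
  NormedSubspace (dom B) (fun x => nrm x + nrm (B x)).

(* Calderon's complex method for a couple (X, Y) with Y continuously embedded
   in X, so that X + Y = X. *)
Definition strip : set R[i]^o := [set z | 0 <= complex.Re z <= 1].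

Definition calderon (Y : normed_subspace) (F : R[i]^o -> X) : Prop :=
  [/\ {within strip, continuous F},
      exists M : R, forall z, strip z -> nrm (F z) <= M,
      forall z : R[i]^o, 0 < complex.Re z < 1 -> derivable F z 1,
      forall t : R, Y (F (1 +i* t))
    & (forall t : R,
         snorm Y (F (1 +i* s) - F (1 +i* t)) @[s --> t] --> (0 : R)) /\
      exists M : R, forall t : R, snorm Y (F (1 +i* t)) <= M].

Definition interpolation (theta : R) (Y : normed_subspace) : normed_subspace :=
  NormedSubspace
    [set x | exists2 F, calderon Y F & F theta%:C = x]
    (fun x => inf [set M | exists F,
       [/\ calderon Y F, F theta%:C = x,
           forall t : R, nrm (F (0 +i* t)) <= M
         & forall t : R, snorm Y (F (1 +i* t)) <= M]]).

End Operators.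

Section VectorValuedFunctions.
Context (R : realType) (X : completeNormedModType R[i]).
Local Notation mu := (@lebesgue_measure R).
Implicit Types (Y : normed_subspace X) (a : R).

Definition time_interval a : set R := `]0, a[%classic.

Definition simple_function (s : measurableTypeR R -> X) : Prop :=
  finite_set (range s) /\ forall x, measurable (s @^-1` [set x]).

Definition strongly_measurable Y (D : set R) (f : R -> X) : Prop :=
  exists s : nat -> R -> X,
    (forall n, simple_function (s n) /\ forall t, Y (s n t)) /\
    {ae mu, forall t, D t ->
       snorm Y (s n t - f t) @[n --> \oo] --> (0 : R)}.

(* L^2((0, a); Y), by representatives. *)
Definition L2 Y a (f : R -> X) : Prop :=
  [/\ {ae mu, forall t, time_interval a t -> Y (f t)},
      strongly_measurable Y (time_interval a) f
    & (\int[mu]_(t in time_interval a) ((snorm Y (f t)) ^+ 2)%:E < +oo)%E].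

Definition simple_integral (D : set R) (s : R -> X) : X :=
  \sum_(x \in [set: X]) (fine (mu (D `&` s @^-1` [set x])))%:C *: x.

(* f is Bochner integrable on the set D (of finite measure), with integral y. *)
Definition bochner_integral (D : set R) (f : R -> X) (y : X) : Prop :=
  strongly_measurable (whole_space X) D f /\
  exists s : nat -> R -> X,
    [/\ forall n, simple_function (s n),
        (\int[mu]_(t in D) (nrm (f t - s n t))%:E)%E @[n --> \oo] --> 0%E
      & simple_integral D (s n) @[n --> \oo] --> y].

Definition test_function a (eta : R -> R) : Prop :=
  (forall (n : nat) (t : R), derivable (eta^`(n))%classic t 1) /\
  exists c d : R, [/\ 0 < c, d < a & forall t, t \notin `[c, d] -> eta t = 0].

Definition weak_derivative a (u v : R -> X) : Prop :=
  forall eta, test_function a eta ->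
  exists y,
    bochner_integral (time_interval a)
      (fun t => ((eta^`())%classic t)%:C *: u t) y /\
    bochner_integral (time_interval a) (fun t => (eta t)%:C *: v t) (- y).

(* W^{1,2}((0, a); X). Each class is represented by its representative which
   is continuous on [0, a], so that u 0 and u a are the boundary values;
   values of u outside [0, a] are irrelevant. *)
Definition W12 a (u : R -> X) : Prop :=
  [/\ {within `[0, a], continuous u},
      L2 (whole_space X) a u
    & exists2 v, L2 (whole_space X) a v & weak_derivative a u v].

Definition solution_space (A : operator X) a (u : R -> X) : Prop :=
  W12 a u /\ L2 (graph_space A) a u.

Definition evolution_equation (A : operator X) a (f u : R -> X) : Prop :=
  exists v, [/\ L2 (whole_space X) a v, weak_derivative a u v
    & {ae mu, forall t, time_interval a t -> v t - A (u t) = f t}].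

End VectorValuedFunctions.

Record metric_graph (R : realType) := MetricGraph {
  vertex : finType;
  edge : finType;
  initial_vertex : edge -> vertex;
  terminal_vertex : edge -> vertex;
  edge_length : edge -> R;
  edge_length_gt0 : forall j, 0 < edge_length j }.

Section TimeGraph.
Context (R : realType) (G : metric_graph R).
Context (X : edge G -> completeNormedModType R[i]).
Context (A : forall j, operator (X j)).

Local Notation len := (@edge_length R G).
Local Notation vectors := (forall j : edge G, X j).
Local Notation functions := (forall j : edge G, R -> X j).

Definition half_space (j : edge G) : normed_subspace (X j) :=
  interpolation (2^-1) (graph_space (A j)).

Definition KA (g : vectors) : Prop := forall j, half_space j (g j).

Definition KA_norm (g : vectors) : R :=
  Num.sqrt (\sum_j (snorm (half_space j) (g j)) ^+ 2).

(* B is in L(K_A); as for unbounded operators, B is a total function whose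
   values outside K_A are irrelevant. *)
Definition bounded_on_KA (B : vectors -> vectors) : Prop :=
  [/\ forall g, KA g -> KA (B g),
      forall (c : R[i]) (g h : vectors), KA g -> KA h ->
        forall i, B (fun j => c *: g j + h j) i = c *: B g i + B h i
    & exists M : R, forall g, KA g -> KA_norm (B g) <= M * KA_norm g].

Definition block (B : vectors -> vectors) (i j : edge G) (x : X j) : X i :=
  B (@dfwith _ X (fun=> 0) j x) i.

Definition block_eq0 (B : vectors -> vectors) (i j : edge G) : Prop :=
  forall x, half_space j x -> block B i x = 0.

(* The requirement psi_+ \in K_A is part of the meaning of B psi_+ (and holds
   for every element of the solution space). *)
Definition is_solution (B : vectors -> vectors) (f : functions) (g : vectors)
    (psi : functions) : Prop :=
  [/\ forall j, solution_space (A j) (len j) (psi j),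
      forall j, evolution_equation (A j) (len j) (f j) (psi j),
      KA (fun j => psi j (len j))
    & forall j, psi j 0 - B (fun k => psi k (len k)) j = g j].

(* phi is a linear function of (psi_k)_(k in P) and of g, where psi_k ranges
   over the solution space on the edge k and g over K_A. *)
Definition linear_in (P : set (edge G)) (Z : lmodType R[i])
    (phi : functions -> vectors -> Z) : Prop :=
  let admissible (psi : functions) :=
    forall k, P k -> solution_space (A k) (len k) (psi k) in
  (forall psi psi' g, admissible psi -> admissible psi' -> KA g ->
     (forall k, P k -> {in `[0, len k], psi k =1 psi' k}) ->
     phi psi g = phi psi' g) /\
  (forall (c : R[i]) psi psi' g g', admissible psi -> admissible psi' ->
     KA g -> KA g' ->
     phi (fun k t => c *: psi k t + psi' k t) (fun k => c *: g k + g' k)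
       = c *: phi psi g + phi psi' g').

(* [rank j] is the position (counted from 0) of the edge j in the ordering of
   the edges; an edge is the last one iff (rank j).+1 = #|edge G|. *)
Definition iteratively_solvable_by (B : vectors -> vectors)
    (rank : edge G -> 'I_#|edge G|)
    (phi : forall j, functions -> vectors -> X j) : Prop :=
  [/\ bijective rank,
      forall j, ((rank j).+1 < #|edge G|)%N ->
        linear_in [set k | (rank j < rank k)%N] (phi j)
    & forall (f : functions) (g : vectors),
        (forall j, L2 (whole_space (X j)) (len j) (f j)) -> KA g ->
        forall psi, is_solution B f g psi ->
        forall j,
          evolution_equation (A j) (len j) (f j) (psi j) /\
          psi j 0 - block B j (psi j (len j)) =
            if ((rank j).+1 < #|edge G|)%N then phi j psi g else g j].

Definition iteratively_solvable_cauchy (B : vectors -> vectors) : Prop :=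
  exists rank phi, iteratively_solvable_by B rank phi.

Definition iteratively_solvable_initial (B : vectors -> vectors) : Prop :=
  iteratively_solvable_cauchy B /\ forall j, block_eq0 B j j.

(* For m edges l_0, ..., l_(m-1); [ordS] is the cyclic successor. *)
Definition directed_loop (m : nat) (l : 'I_m -> edge G) : Prop :=
  (0 < m)%N /\
  forall k, terminal_vertex (l k) = initial_vertex (l (ordS k)).

Definition reflected_loop (B : vectors -> vectors) (m : nat)
    (l : 'I_m -> edge G) : Prop :=
  forall k, ~ block_eq0 B (l k) (l (ordS k)).

End TimeGraph.

(* Main.v *)
Require Import Defs.
From HB Require Import structures.
From mathcomp Require Import all_boot all_order all_algebra.
From mathcomp Require Import complex ring lra zify.
From mathcomp Require Import all_classical all_reals all_analysis.
From mathcomp Require Import measurable_realfun.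

Set Implicit Arguments.
Unset Strict Implicit.
Unset Printing Implicit Defensive.

Import Order.TTheory GRing.Theory Num.Theory numFieldNormedType.Exports.

Local Open Scope classical_set_scope.
Local Open Scope ring_scope.

(** If x lies in [X_k, D(A_k)]_{1/2}, some function in the solution space takes the value x at
one end of I_k and 0 at the other end; hence every choice of end values in K_A belongs to a
solution for suitable data. Suppose that (CP) is iteratively solvable and that k precedes j.
Take the solution with value x at the end of the edge k and 0 at all other end points, and the
solution with the same data g and final values 0: by downward induction they agree on the edges
after j, so the equation of the edge j forces B_jk x = 0. Thus B is triangular, and along a
reflected loop the position of the edges is monotone, hence constant.

The function with end values x and 0 comes from a decomposition x = sum e_n such that
sum 2^n |e_n|^2 and sum 2^-n |A e_n|^2 are finite: it is u(t) = sum s_n(t) e_n, with s_n a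
cutoff at distance 2^-n from the end point. The e_n are the differences of
(1 + 4^-n A^*A)^-1 x, and the two sums are bounded by the three lines theorem, applied to
the holomorphic functions of the complex interpolation method. *)

(** * Real analysis *)

(** No evolution equation is ever solved: the data [f] is free, so it is read off as u' - A u from a
    function u with the wanted end values. The two solutions that are compared have different [f],
    which is harmless because [phi] sees only the later edges and [g]. The weights come from the
    geometry of the cutoffs: s_n varies only on a layer of length about 2^-n, with slope about 2^n.
    There u' is s_n' e_n, which contributes about 2^-n 4^n |e_n|^2 to the integral of |u'|^2, while
    A u is essentially a partial sum of the A e_m, controlled by a discrete Hardy inequality. A need
    not be normal and has no functional calculus in X that fits these sums. A^*A has the right one:
    the graph norm of A is that of (A^*A)^(1/2) up to equivalence, and for the resolvents R_n the
    squares of the increments are dominated by differences of <R_n x, x>, or of <A R_n x, A x>,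
    which telescope. The interpolation method provides functions that are merely complex
    differentiable, without continuity of the derivative; hence Goursat's bisection, and a maximum
    principle for vertical means, which gain the missing derivative. *)

Section RealAnalysis.
Context {R : realType}.
Implicit Types (f df : R -> R) (a b C x e : R).

Lemma is_derive_continuous f (df : R) x : is_derive x (1 : R) f df -> {for x, continuous f}.
Proof. by move=> [fx _]; apply/differentiable_continuous/derivable1_diffP. Qed.

Lemma derivable_is_derive f (df : R) x :
  derivable f x 1 -> (f^`())%classic x = df -> is_derive x (1 : R) f df.
Proof. by move=> fx <-; split=> //; rewrite derive1E. Qed.

Lemma continuous_primitive f a : continuous f ->
  exists F : R -> R, forall x, a < x -> is_derive x (1 : R) F (f x).
Proof.
move=> cf; exists (fun x => \int[lebesgue_measure]_(t in `[a, x]) f t)%R => x ax.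
have xu : x < x + 1 by rewrite ltrDl.
have intf : lebesgue_measure.-integrable `[a, x + 1] (EFin \o f).
  apply: continuous_compact_integrable; first exact: segment_compact.
  exact: continuous_subspaceT.
have [Fd F1] := continuous_FTC1_closed xu intf ax (cf x).
exact: derivable_is_derive Fd F1.
Qed.

Lemma dist_le_derive f df a b C : a <= b ->
  (forall x, x \in `[a, b] -> is_derive x (1 : R) f (df x)) ->
  (forall x, x \in `[a, b] -> `|df x| <= C) ->
  `|f b - f a| <= C * (b - a).
Proof.
move=> ab fdf dfC.
have cf : {within `[a, b], continuous f}.
  apply: continuous_in_subspaceT => x; rewrite inE /= => xab.
  exact: is_derive_continuous (fdf x xab).
have sub : {subset `]a, b[ <= `[a, b]} by move=> x; exact: subset_itv_oo_cc.
have fdf' x : x \in `]a, b[ -> is_derive x (1 : R) f (df x) := fun h => fdf x (sub x h).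
have [c cab E] := @MVT_segment R f df a b ab fdf' cf.
rewrite E.
by rewrite normrM (ger0_norm (x := b - a)) ?subr_ge0// ler_wpM2r ?subr_ge0 ?dfC.
Qed.

(** By Fermat [f1 x = 0]. If [f2] were positive, [f1] would be positive just to the right of [x],
    and the mean value theorem would push [f] above its maximum. *)
Lemma second_derive_max_le0 f (f1 : R -> R) (f2 : R) x e : 0 < e ->
  (forall y, `|y - x| < e -> is_derive y (1 : R) f (f1 y)) ->
  is_derive x (1 : R) f1 f2 ->
  (forall y, `|y - x| < e -> f y <= f x) -> f2 <= 0.
Proof.
move=> e0 ff1 f1f2 fmax; rewrite leNgt; apply/negP => f2_gt0.
have f1x : f1 x = 0.
  have xI : x \in `](x - e), (x + e)[ by rewrite in_itv /= ltrBlDr !ltrDl e0.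
  have le : x - e <= x + e by lra.
  have near_x (t : R) : t \in `](x - e), (x + e)[ -> `|t - x| < e.
    by rewrite in_itv /= ltr_distl.
  have fd t : t \in `](x - e), (x + e)[ -> derivable f t 1.
    by move=> /near_x /ff1 [].
  have fm t : t \in `](x - e), (x + e)[ -> f t <= f x by move=> /near_x /fmax.
  have [_ d2] := derive1_at_max le fd xI fm.
  have xx : `|x - x| < e by rewrite subrr normr0.
  by have [_ d3] := ff1 x xx; rewrite -d3 d2.
have [d1 d2] := f1f2.
have /cvgrPdist_lt/(_ f2 f2_gt0) : h^-1 *: (f1 (h + x) - f1 x) @[h --> 0^'] --> f2.
  by rewrite -d2; have := d1; rewrite /derivable /derive /= => h; under eq_fun do rewrite -[X in f1 (X + x)]mulr1; exact: h.
rewrite near_withinE => /nbhs_ballP[d /= d0 hd].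
have [h [h0 hd' he]] : exists h : R, [/\ 0 < h, h < d & h < e].
  exists (Num.min d e / 2); have m0 : 0 < Num.min d e by rewrite lt_min d0 e0.
  have md : Num.min d e <= d by rewrite ge_min lexx.
  have me : Num.min d e <= e by rewrite ge_min lexx orbT.
  by split; lra.
have f1pos k : 0 < k -> k <= h -> 0 < f1 (x + k).
  move=> k0 kh; have := hd k; rewrite /ball /= sub0r normrN gtr0_norm//.
  move=> /(_ (le_lt_trans kh hd')); rewrite gt_eqF// => /(_ isT).
  rewrite f1x subr0 [k + x]addrC ltr_distlC subrr => /andP[+ _].
  by rewrite /GRing.scale /= pmulr_rgt0 // invr_gt0.
have hh : x <= x + h by rewrite lerDl ltW.
have near_x y : y \in `[x, (x + h)] -> `|y - x| < e.
  by rewrite in_itv /= ltr_distl => /andP[xy yh]; apply/andP; split; lra.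
have ff y : y \in `]x, (x + h)[ -> is_derive y (1 : R) f (f1 y).
  by move=> yI; apply: ff1; apply: near_x; apply: subset_itv_oo_cc yI.
have cf : {within `[x, (x + h)], continuous f}.
  apply: continuous_in_subspaceT => y; rewrite inE /= => yI.
  exact: is_derive_continuous (ff1 y (near_x y yI)).
have xh : x < x + h by rewrite ltrDl.
have [c] := MVT xh ff cf; rewrite in_itv /= => /andP[xc ch] E.
have := fmax (x + h); rewrite addrAC subrr add0r gtr0_norm// => /(_ he).
rewrite -subr_le0 E addrAC subrr add0r.
have := f1pos (c - x); rewrite subr_gt0 addrCA subrr addr0 => /(_ xc) f1c.
have /f1c f1c0 : c - x <= h by lra.
by rewrite leNgt mulr_gt0.
Qed.

End RealAnalysis.

(** * Goursat's lemma and the three lines theorem *)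

Section Goursat.
Context {R : realType}.
Implicit Types (f df : R -> R) (a b c d x y K e : R) (u v V H : R -> R -> R).

Lemma dist_le_derive_affine f df a b c d x K : a <= b ->
  (forall t, t \in `[a, b] -> is_derive t (1 : R) f (df t)) ->
  (forall t, t \in `[a, b] -> `|df t - (c + d * (t - x))| <= K) ->
  `|f b - f a - (c * (b - a) + d / 2 * ((b - x) ^+ 2 - (a - x) ^+ 2))|
    <= K * (b - a).
Proof.
move=> ab fdf dfK.
pose p t := c * (t - x) + d / 2 * (t - x) ^+ 2.
have dp t : is_derive t (1 : R) p (c + d * (t - x)).
  rewrite /p; apply: is_derive_eq; rewrite /GRing.scale /=.
  by field.
have dg t : t \in `[a, b] ->
    is_derive t (1 : R) (f \- p) (df t - (c + d * (t - x))).
  by move=> tab; apply: is_deriveB; exact: fdf.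
have := dist_le_derive ab dg dfK; rewrite /p /=; congr (`| _ | <= _).
by field.
Qed.

(** If [V] is a primitive of [u] in the second variable, this is the integral of [u] along the right
    side of a rectangle minus that along the left side. With the variables exchanged and [H] a
    horizontal primitive of [v] it is top minus bottom, so [goursat] says that the imaginary part of
    the contour integral of u + iv vanishes. *)
Definition increment V (x0 x1 y0 y1 : R) : R := V x1 y1 - V x1 y0 - (V x0 y1 - V x0 y0).

(** Complex differentiability of u + iv at a single point, with derivative a + ib. *)
Definition cauchy_riemann u v x y := exists a b : R, forall e, 0 < e ->
  exists2 d, 0 < d & forall s t, `|s| < d -> `|t| < d ->
    `|u (x + s) (y + t) - u x y - (a * s - b * t)| <= e * (`|s| + `|t|) /\
    `|v (x + s) (y + t) - v x y - (b * s + a * t)| <= e * (`|s| + `|t|).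

(** The affine parts have Cauchy-Riemann coefficients, so they contribute equally to both
    increments; each of the four sides adds an error of at most [K] times its length. *)
Lemma increment_sub_le u v V H x0 x1 y0 y1 x y (u0 v0 : R) a b K :
  x0 <= x1 -> y0 <= y1 ->
  (forall s t, s \in `[x0, x1] -> t \in `[y0, y1] ->
     is_derive t (1 : R) (V s) (u s t) /\
     is_derive s (1 : R) (H^~ t) (v s t)) ->
  (forall s t, s \in `[x0, x1] -> t \in `[y0, y1] ->
     `|u s t - u0 - (a * (s - x) - b * (t - y))| <= K /\
     `|v s t - v0 - (b * (s - x) + a * (t - y))| <= K) ->
  `|increment V x0 x1 y0 y1 - (increment (fun x y => H y x) y0 y1 x0 x1)|
    <= 2 * K * ((x1 - x0) + (y1 - y0)).
Proof.
move=> x01 y01 dVH uvK.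
have VP s : s \in `[x0, x1] -> `|V s y1 - V s y0 - ((u0 + a * (s - x)) * (y1 - y0)
    + - b / 2 * ((y1 - y) ^+ 2 - (y0 - y) ^+ 2))| <= K * (y1 - y0).
  move=> sI; apply: (@dist_le_derive_affine (V s) (u s)) => // t tI.
    exact: (dVH s t sI tI).1.
  have := (uvK s t sI tI).1; congr (`| _ | <= _); ring.
have HP t : t \in `[y0, y1] -> `|H x1 t - H x0 t - ((v0 + a * (t - y)) * (x1 - x0)
    + b / 2 * ((x1 - x) ^+ 2 - (x0 - x) ^+ 2))| <= K * (x1 - x0).
  move=> tI; apply: (@dist_le_derive_affine (H^~ t) (v^~ t)) => // s sI.
    exact: (dVH s t sI tI).2.
  have := (uvK s t sI tI).2; congr (`| _ | <= _); ring.
have := VP x0; have := VP x1; have := HP y0; have := HP y1.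
rewrite !in_itv /= !lexx x01 y01 => /(_ isT) + /(_ isT) + /(_ isT) + /(_ isT).
rewrite !ler_norml /increment => /andP[? ?] /andP[? ?] /andP[? ?] /andP[? ?].
apply/andP; split; lra.
Qed.

Lemma nested_intervals (l r : nat -> R) :
  (forall n, l n <= l n.+1) -> (forall n, r n.+1 <= r n) -> (forall n, l n <= r n) ->
  exists x, forall n, l n <= x <= r n.
Proof.
move=> /nondecreasing_seqP lS /nonincreasing_seqP rS lr.
have lmrn m n : l m <= r n.
  by rewrite (le_trans (lS _ _ (leq_maxl m n)))// (le_trans (lr _))// rS// leq_maxr.
exists (sup (range l)) => n; apply/andP; split.
  apply: ub_le_sup; last by exists n.
  by exists (r 0) => _ [m _ <-].
by apply: ge_sup; [exists (l 0); exists 0 | move=> _ [m _ <-]].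
Qed.

Lemma exists_lt_exp2 x : exists n, x < 2 ^+ n.
Proof.
have [x0|x0] := ltP x 0; first by exists 0; rewrite expr0 (lt_trans x0).
exists (Num.bound x); rewrite (lt_trans (archi_boundP x0))// -natrX ltr_nat.
exact: ltn_expl.
Qed.

Lemma dist_itv_le x y a d : a <= y <= a + d -> x \in `[a, (a + d)] -> `|x - y| <= d.
Proof. by rewrite in_itv ler_norml /= => /andP[? ?] /andP[? ?]; apply/andP; split; lra. Qed.

Lemma norm_sum4_lt a b c d (k j : R) : 0 < k ->
  `|d| * (k * 4) < j -> `|c| * (k * 4) < j -> `|b| * (k * 4) < j ->
  `|a| * (k * 4) < j -> `|a + b + c + d| * k < j.
Proof.
move=> k0 hd hc hb ha; have : `|a + b + c + d| * k <= (`|a| + `|b| + `|c| + `|d|) * k.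
  by rewrite ler_pM2r // !(le_trans (ler_normD _ _))// !lerD2r !(le_trans (ler_normD _ _))// lerD2r ler_normD.
lra.
Qed.

(** Bisection: one quarter of a rectangle carries at least a fourth of its defect, so nested
    rectangles keep a defect of at least |j| / 4^n. At their common point, differentiability makes
    the defect of smaller order than 4^-n. *)
Lemma goursat u v V H x0 x1 y0 y1 : x0 <= x1 -> y0 <= y1 ->
  (forall s t, s \in `[x0, x1] -> t \in `[y0, y1] ->
     [/\ is_derive t (1 : R) (V s) (u s t), is_derive s (1 : R) (H^~ t) (v s t)
       & cauchy_riemann u v s t]) ->
  increment V x0 x1 y0 y1 = increment (fun x y => H y x) y0 y1 x0 x1.
Proof.
move=> x01 y01 hyp; apply/eqP; rewrite -subr_eq0; apply/negPn/negP => J0.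
pose J x y n := increment V x (x + (x1 - x0) / 2 ^+ n) y (y + (y1 - y0) / 2 ^+ n)
  - increment (fun x y => H y x) y (y + (y1 - y0) / 2 ^+ n) x (x + (x1 - x0) / 2 ^+ n).
set j := increment V x0 x1 y0 y1 - _ in J0.
have jE : j = J x0 y0 0 by rewrite /J expr0 !divr1 ![_ + (_ - _)]addrC !subrK.
pose good n (p : R * R) := `|j| <= `|J p.1 p.2 n| * 4 ^+ n.
have half (z : R) n : z / 2 ^+ n.+1 = z / 2 ^+ n / 2 by rewrite exprSr invfM mulrA.
have step n p : exists q : R * R, [/\ good n p -> good n.+1 q,
    p.1 <= q.1 /\ q.1 + (x1 - x0) / 2 ^+ n.+1 <= p.1 + (x1 - x0) / 2 ^+ n
  & p.2 <= q.2 /\ q.2 + (y1 - y0) / 2 ^+ n.+1 <= p.2 + (y1 - y0) / 2 ^+ n].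
  have w0 : 0 <= (x1 - x0) / 2 ^+ n by rewrite divr_ge0 ?subr_ge0 ?exprn_ge0.
  have h0 : 0 <= (y1 - y0) / 2 ^+ n by rewrite divr_ge0 ?subr_ge0 ?exprn_ge0.
  set w := (x1 - x0) / 2 ^+ n.+1; set h := (y1 - y0) / 2 ^+ n.+1.
  have wE : (x1 - x0) / 2 ^+ n = w + w by rewrite /w half; lra.
  have hE : (y1 - y0) / 2 ^+ n = h + h by rewrite /h half; lra.
  have [Q|] := pselect (exists q : R * R, [/\ good n.+1 q,
      q.1 = p.1 \/ q.1 = p.1 + w & q.2 = p.2 \/ q.2 = p.2 + h]).
    case: Q => q [gq q1 q2]; exists q; rewrite wE hE in w0 h0 *.
    by split=> //; [case: q1 => -> | case: q2 => ->]; split; lra.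
  move=> nq; exists p; rewrite wE hE in w0 h0 *; split; [|split; lra..].
  move=> gp; exfalso; apply: nq.
  apply: contrapT => nq.
  have small a b : (a = p.1 \/ a = p.1 + w) -> (b = p.2 \/ b = p.2 + h) ->
      `|J a b n.+1| * 4 ^+ n.+1 < `|j|.
    by move=> ha hb; rewrite ltNge; apply/negP => g; apply: nq; exists (a, b).
  have := small _ _ (or_introl erefl) (or_introl erefl).
  have := small _ _ (or_intror erefl) (or_introl erefl).
  have := small _ _ (or_introl erefl) (or_intror erefl).
  have := small _ _ (or_intror erefl) (or_intror erefl).
  move=> h1 h2 h3 h4; move: gp h1 h2 h3 h4; rewrite /good.
  have -> : J p.1 p.2 n = J p.1 p.2 n.+1 + J (p.1 + w) p.2 n.+1 +
      J p.1 (p.2 + h) n.+1 + J (p.1 + w) (p.2 + h) n.+1.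
    rewrite /J -/w -/h wE hE /increment !addrA; ring.
  rewrite exprSr leNgt => /negP gp h1 h2 h3 h4; apply: gp.
  by apply: norm_sum4_lt; rewrite ?exprn_gt0.
have /choice[f fP] (n : nat) : exists g : R * R -> R * R, forall p,
    [/\ good n p -> good n.+1 (g p),
    p.1 <= (g p).1 /\ (g p).1 + (x1 - x0) / 2 ^+ n.+1 <= p.1 + (x1 - x0) / 2 ^+ n
  & p.2 <= (g p).2 /\ (g p).2 + (y1 - y0) / 2 ^+ n.+1 <= p.2 + (y1 - y0) / 2 ^+ n].
  by have /choice[g gP] := step n; exists g.
pose P := fix P n := if n is m.+1 then f m (P m) else (x0, y0).
have Pg n : good n (P n) -> good n.+1 (P n.+1) by have [] := fP n (P n).
have Px n : (P n).1 <= (P n.+1).1 by have [_ []] := fP n (P n).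
have Py n : (P n).2 <= (P n.+1).2 by have [_ _ []] := fP n (P n).
have Px' n : (P n.+1).1 + (x1 - x0) / 2 ^+ n.+1 <= (P n).1 + (x1 - x0) / 2 ^+ n.
  by have [_ []] := fP n (P n).
have Py' n : (P n.+1).2 + (y1 - y0) / 2 ^+ n.+1 <= (P n).2 + (y1 - y0) / 2 ^+ n.
  by have [_ _ []] := fP n (P n).
have gP n : good n (P n).
  by elim: n => [|n /Pg //]; rewrite /good /= expr0 mulr1 -jE.
have xS n : x0 <= (P n).1 by elim: n => // n /le_trans; apply.
have yS n : y0 <= (P n).2 by elim: n => // n /le_trans; apply.
have xE n : (P n).1 + (x1 - x0) / 2 ^+ n <= x1.
  elim: n => [|n h]; first by rewrite /= expr0; lra.
  exact: le_trans (Px' n) h.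
have yE n : (P n).2 + (y1 - y0) / 2 ^+ n <= y1.
  elim: n => [|n h]; first by rewrite /= expr0; lra.
  exact: le_trans (Py' n) h.
have w0 n : 0 <= (x1 - x0) / 2 ^+ n by rewrite divr_ge0 ?subr_ge0 ?exprn_ge0.
have h0 n : 0 <= (y1 - y0) / 2 ^+ n by rewrite divr_ge0 ?subr_ge0 ?exprn_ge0.
have [x xP] : exists x, forall n, (P n).1 <= x <= (P n).1 + (x1 - x0) / 2 ^+ n.
  by apply: nested_intervals => n; [exact: Px|exact: Px'|rewrite lerDl].
have [y yP] : exists y, forall n, (P n).2 <= y <= (P n).2 + (y1 - y0) / 2 ^+ n.
  by apply: nested_intervals => n; [exact: Py|exact: Py'|rewrite lerDl].
have [||_ _ [a [b ab]]] := hyp x y.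
- by have := xP 0; rewrite /= expr0 in_itv /= divr1 addrCA subrr addr0.
- by have := yP 0; rewrite /= expr0 in_itv /= divr1 addrCA subrr addr0.
pose D := (x1 - x0) + (y1 - y0).
have D0 : 0 <= D by rewrite addr_ge0 ?subr_ge0.
have j0 : 0 < `|j| by rewrite normr_gt0.
have DD : 0 < 2 * D ^+ 2 + 1 by rewrite ltr_wpDl // mulr_ge0 ?sqr_ge0.
(* The defect of the n-th rectangle is at most 2 e (D / 2^n)^2, where [D] is half the perimeter of
   the first one; this [e] makes 2 e D^2 < |j|, and the summand 1 keeps the inequality strict and
   the denominator nonzero. *)
pose e := `|j| / (2 * D ^+ 2 + 1); have e0 : 0 < e by rewrite divr_gt0.
have [d d0 abd] := ab e e0.
have [n nP] := exists_lt_exp2 (D / d).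
have Dd : D / 2 ^+ n < d by rewrite ltr_pdivrMr ?exprn_gt0// mulrC -ltr_pdivrMr.
have DE : D / 2 ^+ n = (x1 - x0) / 2 ^+ n + (y1 - y0) / 2 ^+ n by rewrite -mulrDl.
have near_x s : s \in `[(P n).1, (P n).1 + (x1 - x0) / 2 ^+ n] -> `|s - x| <= (x1 - x0) / 2 ^+ n.
  exact: dist_itv_le (xP n).
have near_y t : t \in `[(P n).2, (P n).2 + (y1 - y0) / 2 ^+ n] -> `|t - y| <= (y1 - y0) / 2 ^+ n.
  exact: dist_itv_le (yP n).
have Pw : (P n).1 <= (P n).1 + (x1 - x0) / 2 ^+ n by rewrite lerDl.
have Ph : (P n).2 <= (P n).2 + (y1 - y0) / 2 ^+ n by rewrite lerDl.
have dVH s t : s \in `[(P n).1, (P n).1 + (x1 - x0) / 2 ^+ n] ->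
    t \in `[(P n).2, (P n).2 + (y1 - y0) / 2 ^+ n] ->
    is_derive t 1 (V s) (u s t) /\ is_derive s 1 (H^~ t) (v s t).
  move=> sI tI; have [||d1 d2 _] := hyp s t; last by split.
  + move: sI; rewrite !in_itv /= => /andP[s1 s2].
    by rewrite (le_trans (xS n))// (le_trans s2).
  + move: tI; rewrite !in_itv /= => /andP[t1 t2].
    by rewrite (le_trans (yS n))// (le_trans t2).
have uvK s t : s \in `[(P n).1, (P n).1 + (x1 - x0) / 2 ^+ n] ->
    t \in `[(P n).2, (P n).2 + (y1 - y0) / 2 ^+ n] ->
    `|u s t - u x y - (a * (s - x) - b * (t - y))| <= e * (D / 2 ^+ n) /\
    `|v s t - v x y - (b * (s - x) + a * (t - y))| <= e * (D / 2 ^+ n).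
  move=> /near_x sx /near_y ty.
  have sd : `|s - x| < d by rewrite (le_lt_trans sx)// (le_lt_trans _ Dd)// DE lerDl.
  have td : `|t - y| < d by rewrite (le_lt_trans ty)// (le_lt_trans _ Dd)// DE lerDr.
  have := abd _ _ sd td; rewrite [x + _]addrC [y + _]addrC !subrK => -[h1 h2].
  have h3 : e * (`|s - x| + `|t - y|) <= e * (D / 2 ^+ n) by rewrite ler_pM2l// DE lerD.
  by split; [exact: le_trans h1 h3|exact: le_trans h2 h3].
have := increment_sub_le Pw Ph dVH uvK.
rewrite -/(J _ _ _) => Jle; have := gP n; rewrite /good leNgt => /negP; apply.
have c0 : 0 < 4 ^+ n :> R by rewrite exprn_gt0.
have -> : `|j| = e * (2 * D ^+ 2 + 1) by rewrite /e divfK // gt_eqF.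
apply: (@le_lt_trans _ _ (2 * (e * (D / 2 ^+ n)) * (D / 2 ^+ n) * 4 ^+ n)).
  rewrite ler_pM2r //; apply: le_trans Jle _; rewrite DE le_eqVlt; apply/orP; left; apply/eqP.
  by congr (_ * _); ring.
have -> : 4 ^+ n = 2 ^+ n * 2 ^+ n :> R by rewrite -exprMn; congr (_ ^+ _); ring.
have t0 : 2 ^+ n != 0 :> R by rewrite expf_neq0.
have -> : 2 * (e * (D / 2 ^+ n)) * (D / 2 ^+ n) * (2 ^+ n * 2 ^+ n) = e * (2 * D ^+ 2) by field.
by rewrite ltr_pM2l // ltrDl.
Qed.

End Goursat.

(** * The maximum principle on the unbounded strip *)

Section StripMaximum.
Context {R : realType}.
Implicit Types (f : R -> R) (u v V H : R -> R -> R) (a b h x y l e M K T : R).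

Lemma is_derive_little_o f x l :
  (forall e, 0 < e -> exists2 d, 0 < d & forall t, `|t| < d ->
     `|f (x + t) - f x - l * t| <= e * `|t|) ->
  is_derive x (1 : R) f l.
Proof.
move=> fl.
have cf : h^-1 *: ((f \o shift x) (h *: (1 : R)) - f x) @[h --> 0^'] --> l.
  apply/cvgrPdist_le => e e0; have [d d0 hd] := fl e e0.
  apply/nbhs_ballP; exists d => //= t; rewrite /ball /= sub0r normrN => td t0.
  have := hd t td; rewrite [x + t]addrC /GRing.scale /= mulr1.
  rewrite -ler_pdivrMr ?normr_gt0// -normfV -normrM distrC; congr (`| _ | <= _).
  by field; rewrite t0.
by split; [apply/cvg_ex; exists l|apply/cvg_lim].
Qed.

(** These two partial derivatives become the second derivatives of the vertical mean of [u], where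
    they cancel in the Laplacian. *)
Lemma cauchy_riemann_derive u v x y : cauchy_riemann u v x y ->
  exists b, is_derive y (1 : R) (u x) (- b) /\ is_derive x (1 : R) (v^~ y) b.
Proof.
move=> [a [b ab]]; exists b; split; apply: is_derive_little_o => e e0;
    have [d d0 hd] := ab e e0; exists d => // t td.
- have := (hd 0 t); rewrite normr0 => /(_ d0 td)[+ _].
  by rewrite add0r addr0 mulr0 sub0r mulNr.
- have := (hd t 0); rewrite normr0 => /(_ td d0)[_ +].
  by rewrite !addr0 mulr0 addr0.
Qed.

(** For fixed [x] this is continuity of the primitive; when [x] moves, [u] converges uniformly on a
    compact vertical segment, and the mean value theorem over the length [h] turns e / 2 / h into e
    / 2. *)
Lemma increment_continuous u V a h x y : continuous (fun p : R * R => u p.1 p.2) ->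
  (forall s t, a < t -> is_derive t (1 : R) (V s) (u s t)) -> 0 < h -> a < y ->
  {for (x, y), continuous (fun p : R * R => V p.1 (p.2 + h) - V p.1 p.2)}.
Proof.
move=> cu dV h0 ay; apply/cvgrPdist_le => e e0.
have e2 : 0 < e / 2 by rewrite divr_gt0.
have e'0 : 0 < e / 2 / h by rewrite divr_gt0.
have unif : \forall s \near x, forall t, `[a, (y + 1 + h)]%classic t ->
    `|u s t - u x t| <= e / 2 / h.
  have := @segment_compact _ a (y + 1 + h).
  move/compact_near_coveringP => /(_ _ (nbhs x) (fun s t => `|u s t - u x t| <= e / 2 / h)).
  apply=> t _; have e4 : 0 < e / 2 / h / 2 by rewrite divr_gt0.
  have /cvgrPdist_le/(_ _ e4) := cu (x, t).
  case=> -[/= A B] [Ax Bt] AB; exists (B, A) => //= -[t' s] /= [Bt' As].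
  have /= h1 := AB (s, t') (conj As Bt').
  have /= h2 := AB (x, t') (conj (nbhs_singleton Ax) Bt').
  rewrite -[u s t'](subrK (u x t)) -addrA (le_trans (ler_normD _ _))// distrC.
  by rewrite [leRHS]splitr lerD.
have vc : \forall t \near y, `|(V x (y + h) - V x y) - (V x (t + h) - V x t)| <= e / 2.
  have c1 : (fun t => V x (t + h)) t @[t --> y] --> V x (y + h).
    apply: (cvg_comp (fun t => t + h)); first by apply: cvgD; [exact: cvg_id|exact: cvg_cst].
    by apply: is_derive_continuous; apply: dV; rewrite (lt_trans ay)// ltrDl.
  have c2 : V x t @[t --> y] --> V x y by apply: is_derive_continuous; apply: dV.
  have c3 : V x (t + h) - V x t @[t --> y] --> V x (y + h) - V x y by apply: cvgB.
  by move/cvgrPdist_le : c3; apply.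
have yI : \forall t \near y, t \in `]a, (y + 1)[.
  by apply: near_in_itvoo; rewrite in_itv /= ay ltrDl ltr01.
exists ([set s | forall t, `[a, (y + 1 + h)]%classic t -> `|u s t - u x t| <= e / 2 / h],
  [set t | `|V x (y + h) - V x y - (V x (t + h) - V x t)| <= e / 2 /\ a < t < y + 1]).
  split=> //=; near=> t; split; first by near: t.
  suff : t \in `]a, (y + 1)[ by rewrite in_itv.
  by near: t.
move=> [s t] [/= us [vt /andP[a_t ty]]].
have tI r : r \in `[t, (t + h)] -> a < r /\ r \in `[a, (y + 1 + h)].
  by rewrite !in_itv /= => /andP[tr rt]; split; [lra|apply/andP; split; lra].
have dd r : r \in `[t, (t + h)] -> is_derive r (1 : R) (V s \- V x) (u s r - u x r).
  by move=> /tI[ar _]; apply: is_deriveB; exact: dV.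
have db r : r \in `[t, (t + h)] -> `|u s r - u x r| <= e / 2 / h.
  by move=> /tI[_ ar]; exact: us.
have := dist_le_derive (ltW _) dd db; rewrite ltrDl => /(_ h0).
rewrite /= (_ : e / 2 / h * (t + h - t) = e / 2) => [st|]; last first.
  by field; rewrite gt_eqF.
have -> : V x (y + h) - V x y - (V s (t + h) - V s t) =
  (V x (y + h) - V x y - (V x (t + h) - V x t)) -
  (V s (t + h) - V x (t + h) - (V s t - V x t)) by ring.
by rewrite [leRHS]splitr (le_trans (ler_normB _ _))// lerD.
Unshelve. all: by end_near. Qed.

Lemma is_derive_shift f h x l :
  is_derive (x + h) (1 : R) f l -> is_derive x (1 : R) (fun t => f (t + h)) l.
Proof.
move=> fl; have dshift : is_derive x (1 : R) (fun t : R => t + h) 1.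
  by apply: is_derive_eq; rewrite addr0.
by have := @is_derive1_comp _ f (fun t : R => t + h) x l 1 fl dshift; rewrite mulr1.
Qed.

(* The vertical mean W / h of u over [y, y + h] is twice differentiable and
   harmonic, by Goursat's lemma, although u is only once differentiable. The
   comparison function 2 + y^2 - 2x^2 is strictly superharmonic, nonnegative on
   the strip and unbounded in y. *)
Lemma strip_mean_le u v M K h e x0 y0 :
  continuous (fun p : R * R => u p.1 p.2) -> (forall y, continuous (v^~ y)) ->
  (forall x y, 0 < x < 1 -> cauchy_riemann u v x y) ->
  (forall y, u 0 y <= M /\ u 1 y <= M) ->
  (forall x y, 0 <= x <= 1 -> u x y <= K) ->
  0 < h -> 0 < e -> 0 <= x0 <= 1 ->
  exists2 y, y \in `[y0, (y0 + h)] & u x0 y <= M + e * (2 + y0 ^+ 2 - 2 * x0 ^+ 2).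
Proof.
move=> cu cv cr uM uK h0 e0 x0I.
have cux x : continuous (u x).
  by move=> y; exact: (cvg_comp2 (cvg_cst x) cvg_id (cu (x, y))).
(* At height [T] the comparison function is at least T^2 >= (K - M) / e, which brings [phi] down to
   [M] on the horizontal sides. The primitives start at -T - 1 and at -1, outside the rectangle, so
   that they are differentiable on all of it. *)
pose T := 1 + `|(K - M) / e| + `|y0|.
pose a := - T - 1.
have /choice[V VP] (x : R) := continuous_primitive a (cux x).
have /choice[Ht HP] (y : R) := continuous_primitive (-1) (cv y).
pose H x y := Ht y x.
have dV (s t : R) : a < t -> is_derive t (1 : R) (V s) (u s t) by exact: VP.
have dH (s t : R) : -1 < s -> is_derive s (1 : R) (H^~ t) (v s t) by exact: HP.
pose W x y := V x (y + h) - V x y.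
have aT y : - T <= y -> a < y by rewrite /a; lra.
have WE x y : - T <= y -> exists2 z, z \in `[y, (y + h)] & W x y = u x z * h.
  move=> Ty; have yh : y <= y + h by rewrite lerDl ltW.
  have dd z : z \in `]y, (y + h)[ -> is_derive z (1 : R) (V x) (u x z).
    by rewrite in_itv /= => /andP[yz _]; apply: dV; apply: aT; lra.
  have cV : {within `[y, (y + h)], continuous (V x)}.
    apply: continuous_in_subspaceT => z; rewrite inE /= in_itv /= => /andP[yz _].
    by apply: is_derive_continuous (dV _ _ _); apply: aT; lra.
  have [z zI E] := MVT_segment yh dd cV; exists z => //.
  by rewrite /W E; congr (_ * _); ring.
have T0 : 0 < T by rewrite /T -addrA ltr_pwDl// addr_ge0.
pose psi x y := 2 + y ^+ 2 - 2 * x ^+ 2 : R.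
pose phi x y := W x y / h - e * psi x y.
have [Wle|Wgt] := leP (phi x0 y0) M.
  have y0T : - T <= y0.
    by have := ler_norm (- y0); rewrite normrN /T; have := normr_ge0 ((K - M) / e); lra.
  have [y yI E] := WE x0 y0 y0T; exists y => //; move: Wle.
  by rewrite /phi E mulfK ?gt_eqF// lerBlDr.
(* A value of [phi] above [M] forces the maximum over the rectangle into the interior, where the
   second-order conditions in [x] and [y] contradict each other. *)
exfalso.
pose D := `[0, 1]%classic `*` `[- T, T]%classic : set (R * R).
have D0 : D (x0, y0).
  split; rewrite /= in_itv //= -ler_norml /T.
  by rewrite lerDr addr_ge0.
have cD : compact D by apply: compact_setX; exact: segment_compact.
have cphi : {within D, continuous (fun p : R * R => phi p.1 p.2)}.
  apply: continuous_in_subspaceT => -[x y]; rewrite inE => -[_ /=]; rewrite in_itv /= => /andP[/aT ay _].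
  have c1 : {for (x, y), continuous (fun p : R * R => W p.1 p.2)} by exact: increment_continuous cu dV h0 ay.
  have f1 : fst p @[p --> (x, y)] --> x by exact: cvg_fst.
  have f2 : snd p @[p --> (x, y)] --> y by exact: cvg_snd.
  apply: cvgB; first by apply: cvgM; [exact: c1|exact: cvg_cst].
  apply: cvgM; first exact: cvg_cst.
  apply: cvgB; first by apply: cvgD; [exact: cvg_cst|apply: cvgM; exact: f2].
  by apply: cvgM; [exact: cvg_cst|apply: cvgM; exact: f1].
have [x [y [/andP[x_0 x_1] /andP[y_0 y_1] phimax]]] : exists x y : R,
    [/\ 0 <= x <= 1, - T <= y <= T &
      forall s t : R, 0 <= s <= 1 -> - T <= t <= T -> phi s t <= phi x y].
  have [[x y]] := compact_EVT_max (ex_intro _ _ D0) cD cphi.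
  rewrite inE => -[/=]; rewrite !in_itv /= => xI yI xymax; exists x, y; split=> // s t sI tI.
  by apply: (xymax (s, t)); rewrite inE; split; rewrite /= in_itv.
have xyM : M < phi x y.
  by rewrite (lt_le_trans Wgt)//; apply: phimax; case: D0; rewrite /= !in_itv.
have x2 : x ^+ 2 <= 1 by rewrite expr_le1.
have psi_ge0 : 0 <= psi x y.
  by rewrite /psi; have := sqr_ge0 y; lra.
have epsi : 0 <= e * psi x y by rewrite mulr_ge0 // ltW.
have x_n0 : x != 0.
  apply: contraTneq xyM => xE; rewrite -leNgt /phi.
  have [z _ ->] := WE x y y_0; rewrite mulfK ?gt_eqF// xE.
  by have := (uM z).1; move: epsi; rewrite xE; lra.
have x_n1 : x != 1.
  apply: contraTneq xyM => xE; rewrite -leNgt /phi.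
  have [z _ ->] := WE x y y_0; rewrite mulfK ?gt_eqF// xE.
  by have := (uM z).2; move: epsi; rewrite xE; lra.
have yT : y ^+ 2 != T ^+ 2.
  apply: contraTneq xyM => yE; rewrite -leNgt /phi.
  have [z _ ->] := WE x y y_0; rewrite mulfK ?gt_eqF// /psi yE.
  have uz := uK x z; rewrite x_0 x_1 in uz; have {}uz := uz isT.
  have : (K - M) / e <= T ^+ 2.
    have T1 : 1 <= T by rewrite /T -addrA lerDl addr_ge0.
    have KT : (K - M) / e <= T.
      by rewrite /T; have := ler_norm ((K - M) / e); have := normr_ge0 y0; lra.
    by apply: le_trans KT _; rewrite expr2 ler_peMl // ltW.
  rewrite ler_pdivrMr // => KM.
  have : 0 <= e * (2 - 2 * x ^+ 2) by apply: mulr_ge0; [exact: ltW|lra].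
  lra.
have x0_ : 0 < x by rewrite lt_neqAle eq_sym x_n0.
have x1_ : x < 1 by rewrite lt_neqAle x_n1.
have y0_ : - T < y by rewrite lt_neqAle y_0 andbT; apply: contraNneq yT => <-; rewrite sqrrN.
have y1_ : y < T by rewrite lt_neqAle y_1 andbT; apply: contraNneq yT => ->.
(* By Goursat, horizontal differences of [W] are differences of [H]. Thus the derivative of [W] in
   its first variable is v(s, y + h) - v(s, y), which can be differentiated once more. *)
have cross s1 s2 : 0 < s1 -> s1 <= s2 -> s2 < 1 ->
    W s2 y - W s1 y = (H s2 (y + h) - H s2 y) - (H s1 (y + h) - H s1 y).
  move=> s10 s12 s21; have yh : y <= y + h by rewrite lerDl ltW.
  have := @goursat _ u v V H _ _ _ _ s12 yh; rewrite /increment /W => -> ; first by ring.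
  move=> s t; rewrite !in_itv /= => /andP[s1s ss2] /andP[yt tyh]; split.
  - by apply: dV; apply: aT; lra.
  - by apply: dH; lra.
  - by apply: cr; apply/andP; split; lra.
have cross_x s : 0 < s < 1 ->
    W s y - W x y = (H s (y + h) - H s y) - (H x (y + h) - H x y).
  move=> /andP[s0 s1]; have [sx|/ltW xs] := leP s x; last exact: cross.
  by have := cross s x s0 sx x1_; lra.
have xI : 0 < x < 1 by rewrite x0_.
have [b0 [uy0 vx0]] := cauchy_riemann_derive (cr x y xI).
have [b1 [uy1 vx1]] := cauchy_riemann_derive (cr x (y + h) xI).
(* The comparison function contributes 4e here and -2e in [d_y]; the terms in [b0] and [b1] are
   opposite, so adding the two conditions leaves 2e <= 0. *)
have d_x : (b1 - b0) / h + 4 * e <= 0.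
  pose f s := h^-1 * (H s (y + h) - H s y) + 2 * e * s ^+ 2.
  pose f1 s := h^-1 * (v s (y + h) - v s y) + 4 * e * s.
  have [r [r0 rx r1]] : exists r, [/\ 0 < r, r <= x & r <= 1 - x].
    exists (Num.min x (1 - x)); rewrite !ge_min !lexx orbT lt_min x0_.
    by split=> //; lra.
  have sI s : `|s - x| < r -> 0 < s < 1.
    by rewrite ltr_distl => /andP[? ?]; apply/andP; split; lra.
  have := @second_derive_max_le0 R f f1 ((b1 - b0) / h + 4 * e) x r r0; apply.
  - move=> s /sI /andP[s0 s1]; have sN : -1 < s by lra.
    have hs1 := dH s (y + h) sN; have hs2 := dH s y sN.
    rewrite /f /f1; apply: is_derive_eq; rewrite /GRing.scale /=.
    by ring.
  - rewrite /f1; apply: is_derive_eq; rewrite /GRing.scale /=.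
    by field; rewrite gt_eqF.
  - move=> s /sI sI'; rewrite -subr_le0.
    have := phimax s y; rewrite y_0 y_1; case/andP: (sI') => s0 s1.
    rewrite (ltW s0) (ltW s1) => /(_ isT isT); rewrite -subr_le0; congr (_ <= 0).
    have : H s (y + h) - H s y = W s y - W x y + (H x (y + h) - H x y).
      by rewrite (cross_x s sI'); ring.
    by rewrite /f /phi /psi => ->; field; rewrite gt_eqF.
have d_y : (- b1 + b0) / h - 2 * e <= 0.
  pose f1 t := h^-1 * (u x (t + h) - u x t) - 2 * e * t.
  have [r [r0 ry r1]] : exists r, [/\ 0 < r, r <= y + T & r <= T - y].
    exists (Num.min (y + T) (T - y)); rewrite !ge_min !lexx orbT lt_min.
    by split=> //; apply/andP; split; lra.
  have tI t : `|t - y| < r -> - T <= t <= T.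
    by rewrite ltr_distl => /andP[? ?]; apply/andP; split; lra.
  have := @second_derive_max_le0 R (phi x) f1 ((- b1 + b0) / h - 2 * e) y r r0; apply.
  - move=> t /tI /andP[tT _].
    have hs1 := dV x t (aT t tT).
    have ath : a < t + h by apply: aT; lra.
    have hs2 := is_derive_shift (dV x (t + h) ath).
    rewrite /phi /W /psi /f1; apply: is_derive_eq; rewrite /GRing.scale /=.
    by field; rewrite gt_eqF.
  - have hs := is_derive_shift uy1.
    rewrite /f1; apply: is_derive_eq; rewrite /GRing.scale /=.
    by field; rewrite gt_eqF.
  - by move=> t /tI tI'; apply: phimax; rewrite ?x_0.
have : (- b1 + b0) / h = - ((b1 - b0) / h) by field; rewrite gt_eqF.
lra.
Qed.

(** For each [e], [K] only determines how high a rectangle must be; when the averaging height and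
    [e] tend to zero, the boundary value [M] is all that remains. *)
Lemma strip_max u v M K x y :
  continuous (fun p : R * R => u p.1 p.2) -> (forall y, continuous (v^~ y)) ->
  (forall x y, 0 < x < 1 -> cauchy_riemann u v x y) ->
  (forall y, u 0 y <= M /\ u 1 y <= M) ->
  (forall x y, 0 <= x <= 1 -> u x y <= K) ->
  0 <= x <= 1 -> u x y <= M.
Proof.
move=> cu cv cr uM uK xI; apply/ler_addgt0Pr => e e0.
have cux : {for y, continuous (u x)}.
  exact: (cvg_comp2 (cvg_cst x) cvg_id (cu (x, y))).
have e2 : 0 < e / 2 by rewrite divr_gt0.
have /cvgrPdist_le/(_ _ e2)/nbhs_ballP[d /= d0 hd] := cux.
have psi0 : 0 < 3 + y ^+ 2 by rewrite ltr_pwDl ?sqr_ge0.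
have d2 : 0 < d / 2 by rewrite divr_gt0.
have e3 : 0 < e / 2 / (3 + y ^+ 2) by rewrite divr_gt0.
have [z] := strip_mean_le y cu cv cr uM uK d2 e3 xI.
rewrite in_itv /= => /andP[yz zy] uz.
have : `|u x y - u x z| <= e / 2.
  by apply: hd; rewrite /ball /= ltr_distlC; apply/andP; split; lra.
rewrite ler_distl => /andP[_ h2].
suff : e / 2 / (3 + y ^+ 2) * (2 + y ^+ 2 - 2 * x ^+ 2) <= e / 2 by lra.
rewrite mulrAC ler_pdivrMr // ler_pM2l //.
by have := sqr_ge0 x; lra.
Qed.

End StripMaximum.

(** * Real-valued norms over the complex scalars, and the three lines theorem *)

Section ComplexNorm.
Context {R : realType}.
Implicit Types (X : completeNormedModType R[i]) (z w : R[i]).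

Lemma nrmE (X : normedModType R[i]) (x : X) : `|x| = (nrm x)%:C%C.
Proof. by rewrite /nrm RRe_real// ger0_real. Qed.

Lemma nrm_ge0 (X : normedModType R[i]) (x : X) : 0 <= nrm x.
Proof. by have := normr_ge0 x; rewrite nrmE lecR. Qed.

Lemma nrm0 (X : normedModType R[i]) : nrm (0 : X) = 0.
Proof. by rewrite /nrm normr0. Qed.

Lemma nrm_eq0 (X : normedModType R[i]) (x : X) : nrm x = 0 -> x = 0.
Proof. by move=> x0; apply/eqP; rewrite -normr_eq0 nrmE x0. Qed.

Lemma nrmD (X : normedModType R[i]) (x y : X) : nrm (x + y) <= nrm x + nrm y.
Proof. by have := ler_normD x y; rewrite !nrmE -rmorphD lecR. Qed.

Lemma nrmN (X : normedModType R[i]) (x : X) : nrm (- x) = nrm x.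
Proof. by rewrite /nrm normrN. Qed.

Lemma nrmB (X : normedModType R[i]) (x y : X) : nrm (x - y) <= nrm x + nrm y.
Proof. by rewrite -[nrm y]nrmN nrmD. Qed.

Lemma nrm_distC (X : normedModType R[i]) (x y : X) : nrm (x - y) = nrm (y - x).
Proof. by rewrite -nrmN opprB. Qed.

Lemma nrm_complexE (z : R[i]^o) : nrm z = Num.sqrt (complex.Re z ^+ 2 + complex.Im z ^+ 2).
Proof. by rewrite /nrm normc_def. Qed.

Lemma nrm_complexM (z w : R[i]^o) : nrm (z * w : R[i]^o) = nrm z * nrm w.
Proof.
apply: (@complexI R); rewrite -nrmE normrM rmorphM.
by congr (_ * _); exact: nrmE.
Qed.

Lemma nrmZ (X : normedModType R[i]) z (x : X) : nrm (z *: x) = nrm (z : R[i]^o) * nrm x.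
Proof.
apply: (@complexI R); rewrite -nrmE normrZ rmorphM [`|x|]nrmE.
by congr (_ * _); exact: (nrmE (z : R[i]^o)).
Qed.

Lemma nrm_real (r : R) : nrm (r%:C%C : R[i]^o) = `|r|.
Proof. by rewrite nrm_complexE /= expr0n addr0 sqrtr_sqr. Qed.

Lemma nrmZr (X : normedModType R[i]) (r : R) (x : X) : nrm (r%:C%C *: x) = `|r| * nrm x.
Proof. by rewrite nrmZ nrm_real. Qed.

Lemma normr_Re_le (z : R[i]^o) : `|complex.Re z| <= nrm z.
Proof. by have := normc_ge_Re z; rewrite [leRHS](nrmE (z : R[i]^o)) lecR. Qed.

Lemma normr_Im_le (z : R[i]^o) : `|complex.Im z| <= nrm z.
Proof. by rewrite nrm_complexE -sqrtr_sqr ler_wsqrtr// lerDr sqr_ge0. Qed.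

Lemma nrm_le_ReIm (z : R[i]^o) : nrm z <= `|complex.Re z| + `|complex.Im z|.
Proof.
rewrite nrm_complexE -[leRHS]ger0_norm ?addr_ge0// -sqrtr_sqr ler_wsqrtr//.
rewrite -(real_normK (num_real (complex.Re z))) -(real_normK (num_real (complex.Im z))).
have := normr_ge0 (complex.Re z); have := normr_ge0 (complex.Im z).
by move: `|_| `|_| => a b a0 b0; rewrite sqrrD lerD2r lerDl mulrn_wge0 ?mulr_ge0.
Qed.

Lemma nrm_sum (X : normedModType R[i]) I (r : seq I) (P : pred I) (F : I -> X) :
  nrm (\sum_(i <- r | P i) F i) <= \sum_(i <- r | P i) nrm (F i).
Proof.
elim/big_rec2 : _ => [|i y x _ h]; first by rewrite nrm0.
by rewrite (le_trans (nrmD _ _))// lerD2l.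
Qed.

Lemma cvg_nrmP (X : normedModType R[i]) T (F : set_system T) (FF : Filter F) (f : T -> X) l :
  f @ F --> l <-> forall e : R, 0 < e -> \forall t \near F, nrm (l - f t) < e.
Proof.
split=> [/cvgrPdist_lt h e e0|h].
  have e0' : 0 < e%:C%C :> R[i] by rewrite ltcR.
  by apply: filterS (h _ e0') => t; rewrite nrmE ltcR.
apply/cvgrPdist_lt => e; rewrite ltcE /= => /andP[/eqP Ie e0].
by apply: filterS (h _ e0) => t; rewrite nrmE ltcE /= Ie eqxx.
Qed.

Lemma within_continuous_nrm (X : normedModType R[i]) (A : set R[i]^o) (F : R[i]^o -> X) z :
  {within A, continuous F} -> A z -> forall e : R, 0 < e ->
  exists2 d : R, 0 < d & forall w, A w -> nrm (w - z : R[i]^o) < d -> nrm (F w - F z) < e.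
Proof.
move=> /subspace_continuousP/(_ z) cF Az e e0.
have /cvg_nrmP/(_ e e0) := cF Az.
rewrite near_withinE => /nbhs_ballP[d /=]; rewrite ltcE /= => /andP[/eqP Id d0] hd.
exists (complex.Re d) => // w Aw wz; rewrite nrm_distC; apply: hd => //.
rewrite /ball /= distrC [X in X < _](nrmE (w - z : R[i]^o)).
by rewrite ltcE /= Id eqxx.
Qed.

Lemma derivable_nrm (X : normedModType R[i]) (F : R[i]^o -> X) (z : R[i]^o) :
  derivable F z 1 -> exists l : X, forall e : R, 0 < e ->
  exists2 d : R, 0 < d & forall h : R[i]^o, nrm h < d ->
    nrm (F (z + h) - F z - h *: l) <= e * nrm h.
Proof.
move=> /cvg_ex[l /cvg_nrmP hl]; exists l => e e0; have := hl e e0.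
rewrite near_withinE => /nbhs_ballP[d /=]; rewrite ltcE /= => /andP[/eqP Id d0] hd.
exists (complex.Re d) => // h hd'; have [->|h0] := eqVneq h 0.
  by rewrite addr0 subrr scale0r subr0 !nrm0 mulr0.
have : nrm (l - h^-1 *: (F (h *: (1 : R[i]^o) + z) - F z)) < e.
  apply: hd => //; rewrite /ball /= sub0r normrN [X in X < _](nrmE (h : R[i]^o)).
  by rewrite ltcE /= Id eqxx.
rewrite /GRing.scale /= mulr1 -/(GRing.scale _ _) [h + z]addrC nrm_distC => /ltW le.
have -> : F (z + h) - F z - h *: l = h *: (h^-1 *: (F (z + h) - F z) - l).
  by rewrite scalerBr scalerA mulfV // scale1r.
by rewrite nrmZ mulrC ler_wpM2r // nrm_ge0.
Qed.

Lemma derivable_cauchy_riemann (g : R[i]^o -> R[i]^o) x y :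
  derivable g (x +i* y)%C 1 ->
  cauchy_riemann (fun x y => complex.Re (g (x +i* y)%C))
    (fun x y => complex.Im (g (x +i* y)%C)) x y.
Proof.
move=> /derivable_nrm[[a b] hl]; exists a, b => e e0; have [d d0 hd] := hl e e0.
exists (d / 2); first by rewrite divr_gt0.
move=> s t sd td; have st : nrm ((s +i* t)%C : R[i]^o) <= `|s| + `|t| by exact: nrm_le_ReIm.
have {hd} := hd (s +i* t)%C (le_lt_trans st _); rewrite (splitr d) ltrD// => /(_ isT) hd.
have {}hd : nrm (g ((x +i* y)%C + (s +i* t)%C) - g (x +i* y)%C - (s +i* t)%C *: (a +i* b)%C : R[i]^o)
    <= e * (`|s| + `|t|) by rewrite (le_trans hd) // ler_pM2l.
have := le_trans (normr_Re_le _) hd; have := le_trans (normr_Im_le _) hd.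
rewrite (_ : (x +i* y)%C + (s +i* t)%C = ((x + s) +i* (y + t))%C)//.
move: (g _) (g _) => [p q] [p' q']; rewrite /GRing.scale /= => h1 h2.
by split; [move: h2|move: h1]; congr (`| _ | <= _); ring.
Qed.

Lemma clamp_dist (x y : R) :
  `|Num.max 0 (Num.min 1 x) - Num.max 0 (Num.min 1 y)| <= `|x - y|.
Proof.
have E (z : R) : Num.max 0 (Num.min 1 z) = if z <= 0 then 0 else if 1 <= z then 1 else z.
  have [z0|z0] := leP z 0.
    by rewrite max_l // ge_min z0 orbT.
  have [z1|z1] := leP 1 z; first by rewrite max_r // ler01.
  by rewrite max_r // ltW.
rewrite !E; case: (leP x 0) => x0; case: (leP y 0) => y0;
  try case: (leP 1 x) => x1; try case: (leP 1 y) => y1;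
  rewrite ?subrr ?normr0 ?normr_ge0 //; case: ger0P => h1; case: ger0P => h2; lra.
Qed.

Lemma three_lines_Re (g : R[i]^o -> R[i]^o) (M K x : R) :
  {within @strip R, continuous g} ->
  (forall z : R[i]^o, 0 < complex.Re z < 1 -> derivable g z 1) ->
  (forall z, strip z -> nrm (g z) <= K) ->
  (forall t : R, complex.Re (g (0 +i* t)%C) <= M /\ complex.Re (g (1 +i* t)%C) <= M) ->
  0 <= x <= 1 -> complex.Re (g x%:C%C) <= M.
Proof.
move=> cg dg gK gM xI.
(* [strip_max] asks for continuity in the whole plane, while [g] is continuous only within the
   strip: the real part is retracted to [0, 1] by a map that does not increase distances. *)
pose cl x : R := Num.max 0 (Num.min 1 x).
have clI y : 0 <= cl y <= 1 by rewrite /cl le_max lexx ge_max ler01 ge_min lexx.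
have clE y : 0 <= y <= 1 -> cl y = y by move=> /andP[y0 y1]; rewrite /cl min_r ?max_r.
pose c x y : R[i]^o := (cl x +i* y)%C.
have cont p q e : 0 < e -> exists2 d : R, 0 < d & forall s t,
    `|s - p| < d -> `|t - q| < d -> nrm (g (c s t) - g (c p q)) < e.
  move=> e0; have [d d0 hd] := within_continuous_nrm cg (clI p : strip (c p q)) e0.
  exists (d / 2); first by rewrite divr_gt0.
  move=> s t sx ty; apply: hd; first exact: clI.
  rewrite (le_lt_trans (nrm_le_ReIm _))//= (splitr d) ltrD//.
  by rewrite (le_lt_trans (clamp_dist _ _)).
rewrite (_ : x%:C%C = c x 0); last by rewrite /c clE.
apply: (@strip_max R (fun x y => complex.Re (g (c x y)))
  (fun x y => complex.Im (g (c x y))) M K x 0) => //.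
- move=> -[s t]; apply/cvgrPdist_lt => e e0; have [d d0 hd] := cont s t e e0.
  exists (ball s d, ball t d); first by split; exact: nbhsx_ballx.
  move=> -[s' t'] [/=]; rewrite /ball /= => ss' tt'; rewrite distrC -raddfB.
  by rewrite (le_lt_trans (normr_Re_le _))// hd// distrC.
- move=> t s; apply/cvgrPdist_lt => e e0; have [d d0 hd] := cont s t e e0.
  apply/nbhs_ballP; exists d => //= s'.
  rewrite /ball /= => ss'; rewrite distrC -raddfB.
  by rewrite (le_lt_trans (normr_Im_le _))// hd ?subrr ?normr0// distrC.
- move=> s t sI; have [a [b ab]] := derivable_cauchy_riemann (dg (s +i* t)%C sI).
  exists a, b => e /ab[d d0 hd]; have [s0 s1] := andP sI.
  exists (Num.min d (Num.min s (1 - s))); first by rewrite !lt_min d0 s0 subr_gt0.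
  move=> p q; rewrite !lt_min => /and3P[pd ps ps'] /andP[qd _].
  have cE : c s t = (s +i* t)%C by rewrite /c clE// !ltW.
  have cE' : c (s + p) (t + q) = ((s + p) +i* (t + q))%C.
    rewrite /c clE//; move: ps ps'; rewrite !ltr_norml => /andP[? ?] /andP[? ?].
    by apply/andP; split; lra.
  by rewrite cE cE'; exact: hd.
- by move=> t; rewrite /c !clE ?lexx ?ler01.
- move=> s t sI; rewrite (le_trans (ler_norm _))// (le_trans (normr_Re_le _))// gK //.
  exact: clI.
Qed.

End ComplexNorm.

(** * The resolvents of A^*A *)

Section InnerProduct.
Context {R : realType} (X : completeNormedModType R[i]) (ip : {dot X for Num.conj}).
Hypothesis ipE : forall x : X, `|x| ^+ 2 = ip x x.
Implicit Types (x y z u v w : X) (r t : R).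

Definition rip x y : R := complex.Re (ip x y).

Lemma ripC x y : rip x y = rip y x.
Proof.
have conjE (z : R[i]) : complex.Re (Num.conj z) = complex.Re z by case: z.
by rewrite /rip hermC expr0 mul1r; exact: conjE.
Qed.

Lemma ripDl x y z : rip (x + y) z = rip x z + rip y z.
Proof. by rewrite /rip linearDl raddfD. Qed.

Lemma ripZ (c : R[i]) x y : rip (c *: x) y = complex.Re (c * ip x y).
Proof. by rewrite /rip linearZl_LR. Qed.

Lemma ripZl r x y : rip (r%:C%C *: x) y = r * rip x y.
Proof. by rewrite ripZ /rip; case: (ip x y) => a b /=; rewrite mul0r subr0. Qed.

Lemma ripNl x y : rip (- x) y = - rip x y.
Proof. by rewrite -scaleN1r -[-1](rmorphN1 (real_complex R)) ripZl mulN1r. Qed.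

Lemma ripBl x y z : rip (x - y) z = rip x z - rip y z.
Proof. by rewrite ripDl ripNl. Qed.

Lemma ripDr x y z : rip x (y + z) = rip x y + rip x z.
Proof. by rewrite ripC ripDl ![rip _ x]ripC. Qed.

Lemma ripZr r x y : rip x (r%:C%C *: y) = r * rip x y.
Proof. by rewrite ripC ripZl ripC. Qed.

Lemma ripNr x y : rip x (- y) = - rip x y.
Proof. by rewrite ripC ripNl ripC. Qed.

Lemma ripBr x y z : rip x (y - z) = rip x y - rip x z.
Proof. by rewrite ripDr ripNr. Qed.

Lemma rip_nrm x : rip x x = nrm x ^+ 2.
Proof. by rewrite /rip -ipE nrmE -rmorphXn. Qed.

Lemma nrm_sqrB x y : nrm (x - y) ^+ 2 = nrm x ^+ 2 - 2 * rip x y + nrm y ^+ 2.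
Proof. by rewrite -!rip_nrm ripBl !ripBr [rip y x]ripC; ring. Qed.

Lemma nrm_sqrD x y : nrm (x + y) ^+ 2 = nrm x ^+ 2 + 2 * rip x y + nrm y ^+ 2.
Proof. by rewrite -!rip_nrm ripDl !ripDr [rip y x]ripC; ring. Qed.

Lemma rip_le_nrm x y : rip x y <= nrm x * nrm y.
Proof.
have [x0|x0] := eqVneq (nrm x) 0.
  by rewrite x0 (nrm_eq0 x0) mul0r /rip linear0l.
have xp : 0 < nrm x by rewrite lt_neqAle eq_sym x0 nrm_ge0.
have := sqr_ge0 (nrm ((nrm y)%:C%C *: x - (nrm x)%:C%C *: y)).
rewrite nrm_sqrB ripZl ripZr !nrmZr !ger0_norm ?nrm_ge0//.
have [y0|y0] := eqVneq (nrm y) 0.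
  by rewrite y0 mulr0 (nrm_eq0 y0) /rip linear0r.
have yp : 0 < nrm y by rewrite lt_neqAle eq_sym y0 nrm_ge0.
have xy : 0 < 2 * nrm x * nrm y by rewrite !mulr_gt0.
move=> h; rewrite -subr_ge0 -(pmulr_rge0 _ xy); apply: le_trans h _.
by rewrite le_eqVlt; apply/orP; left; apply/eqP; ring.
Qed.

(** Multiplying [x] by the conjugate of [ip x y] makes the product real and reduces the complex
    inequality to [rip_le_nrm]. *)
Lemma ip_le_nrm x y : nrm (ip x y : R[i]^o) <= nrm x * nrm y.
Proof.
have [z0|z0] := eqVneq (nrm (ip x y : R[i]^o)) 0.
  by rewrite z0 mulr_ge0 ?nrm_ge0.
have zp : 0 < nrm (ip x y : R[i]^o) by rewrite lt_neqAle eq_sym z0 nrm_ge0.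
have := rip_le_nrm ((ip x y)^* *: x) y.
rewrite ripZ nrmZ.
have -> : nrm ((ip x y)^* : R[i]^o) = nrm (ip x y : R[i]^o).
  by rewrite !nrm_complexE; case: (ip x y) => a b /=; rewrite sqrrN.
have -> : complex.Re ((ip x y)^* * ip x y) = nrm (ip x y : R[i]^o) ^+ 2.
  rewrite nrm_complexE sqr_sqrtr ?addr_ge0 ?sqr_ge0//.
  by case: (ip x y) => a b /=; ring.
by rewrite -mulrA expr2 ler_pM2l.
Qed.

End InnerProduct.

Section LinearOperator.
Context {R : realType} (X : completeNormedModType R[i]) (A : operator X).
Hypothesis A_lin : linear_operator A.
Implicit Types (u v : X) (c : R[i]).

Lemma dom0 : dom A 0. Proof. by case: A_lin. Qed.

Lemma domZD c u v : dom A u -> dom A v -> dom A (c *: u + v).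
Proof. by move=> du dv; have [_ /(_ c u v du dv)[]] := A_lin. Qed.

Lemma appZD c u v : dom A u -> dom A v -> A (c *: u + v) = c *: A u + A v.
Proof. by move=> du dv; have [_ /(_ c u v du dv)[]] := A_lin. Qed.

Lemma app0 : A 0 = 0.
Proof. by have := appZD (- 1) dom0 dom0; rewrite scaler0 addr0 scaleN1r addNr. Qed.

Lemma domZ c u : dom A u -> dom A (c *: u).
Proof. by move=> du; rewrite -[_ *: _]addr0; exact: domZD dom0. Qed.

Lemma appZ c u : dom A u -> A (c *: u) = c *: A u.
Proof. by move=> du; rewrite -[_ *: _]addr0 (appZD _ _ dom0)// app0 addr0. Qed.

Lemma domD u v : dom A u -> dom A v -> dom A (u + v).
Proof. by move=> du dv; rewrite -[u]scale1r; exact: domZD. Qed.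

Lemma appD u v : dom A u -> dom A v -> A (u + v) = A u + A v.
Proof. by move=> du dv; rewrite -[u in LHS]scale1r appZD// scale1r. Qed.

Lemma domB u v : dom A u -> dom A v -> dom A (u - v).
Proof. by move=> du dv; apply: domD => //; rewrite -scaleN1r; exact: domZ. Qed.

Lemma appB u v : dom A u -> dom A v -> A (u - v) = A u - A v.
Proof.
by move=> du dv; rewrite appD// -scaleN1r ?appZ//; [rewrite scaleN1r|exact: domZ].
Qed.

Lemma dom_sum I (r : seq I) (P : pred I) (F : I -> X) :
  (forall i, dom A (F i)) -> dom A (\sum_(i <- r | P i) F i).
Proof. by move=> dF; elim/big_ind : _ => //; [exact: dom0|exact: domD]. Qed.

Lemma app_sum I (r : seq I) (P : pred I) (F : I -> X) :
  (forall i, dom A (F i)) -> A (\sum_(i <- r | P i) F i) = \sum_(i <- r | P i) A (F i).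
Proof.
move=> dF; elim: r => [|i r ih]; first by rewrite !big_nil app0.
by rewrite !big_cons; case: (P i) => //; rewrite appD ?ih//; exact: dom_sum.
Qed.

End LinearOperator.

Section NormedSequences.
Context {R : realType} (X : completeNormedModType R[i]).
Implicit Types (w : nat -> X) (l : X).

Lemma cauchy_nrm_cvg w :
  (forall e : R, 0 < e -> exists N, forall n, (N <= n)%N -> nrm (w N - w n) < e) ->
  exists l, w n @[n --> \oo] --> l.
Proof.
move=> wc; apply/cvg_ex; apply: cauchy_cvg; apply: cauchy_exP => e.
rewrite ltcE /= => /andP[/eqP Ie e0]; have [N NP] := wc _ e0.
exists (w N); exists N => // n /= /NP; rewrite -ball_normE /= nrmE ltcE /= Ie eqxx; apply.
Qed.

Lemma cvg_nrm w l : w n @[n --> \oo] --> l -> nrm (w n) @[n --> \oo] --> nrm l.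
Proof.
move=> /cvg_nrmP wl; apply/cvgrPdist_lt => e e0.
apply: filterS (wl e e0) => n; apply: le_lt_trans.
rewrite ler_norml; apply/andP; split; last first.
  by rewrite lerBlDr -{1}[l](subrK (w n)) nrmD.
by rewrite lerNl opprB lerBlDr nrm_distC -{1}[w n](subrK l) nrmD.
Qed.

End NormedSequences.

Lemma quadratic_ge0_eq0 (R : realType) (b c : R) :
  (forall t : R, 0 <= b * t + c * t ^+ 2) -> b = 0.
Proof.
move=> h; apply/eqP; apply: contraT => b0.
have c0 : 0 < 2 * (`|c| + 1) by have := normr_ge0 c; lra.
(* A step against the sign of [b], short enough for the linear term to dominate the quadratic
   one. *)
have := h (- b / (2 * (`|c| + 1))).
have -> : b * (- b / (2 * (`|c| + 1))) + c * (- b / (2 * (`|c| + 1))) ^+ 2 =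
  b ^+ 2 * (c - 2 * (`|c| + 1)) / (2 * (`|c| + 1)) ^+ 2.
  by field; have := normr_ge0 c; rewrite gt_eqF //; lra.
rewrite pmulr_lge0 ?invr_gt0 ?exprn_gt0// pmulr_rge0 ?lt_neqAle ?sqr_ge0 ?andbT ?(eq_sym 0) ?sqrf_eq0//.
by have := ler_norm c; have := normr_ge0 c; lra.
Qed.

(* For a closed operator A, R t := (1 + t A^*A)^-1 is obtained by minimizing
   |x - u|^2 + t |A u|^2, i.e., by projecting (x, 0) on the graph of A. *)
Section SquareResolvent.
Context {R : realType} (X : completeNormedModType R[i]) (ip : {dot X for Num.conj}).
Hypothesis ipE : forall x : X, `|x| ^+ 2 = ip x x.
Variable A : operator X.
Hypothesis A_lin : linear_operator A.
Hypothesis A_closed : closed_operator A.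
Implicit Types (x y u v w p : X) (t : R).
Local Notation "[< x , y >]" := (rip ip x y) (at level 0, x, y at level 99).

(** Weak form of u + t A^*A u = x, in which no adjoint operator has to be constructed. Real parts
    suffice, as [v] may be replaced by iv. *)
Definition is_sqresolvent t x u :=
  dom A u /\ forall v, dom A v -> [<x - u, v>] = t * [<A u, A v>].

Let energy t x u := nrm (x - u) ^+ 2 + t * nrm (A u) ^+ 2.

Let energy_midpoint t x u v : dom A u -> dom A v ->
  energy t x (2^-1%:C%C *: (u + v)) =
  2^-1 * (energy t x u + energy t x v)
  - 4^-1 * (nrm (u - v) ^+ 2 + t * nrm (A u - A v) ^+ 2).
Proof.
move=> du dv; rewrite /energy appZ ?appD//; last exact: domD.
rewrite nrmZr exprMn.
rewrite !(nrm_sqrB ipE) nrmZr exprMn !(nrm_sqrD ipE) ripZr ripDr.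
rewrite ger0_norm ?invr_ge0 ?ler0n//; by field.
Qed.

(** By the midpoint identity a minimizing sequence is Cauchy in the graph norm; closedness of [A]
    puts its limit in the domain, and the first variation of the energy there is the weak
    equation. *)
Lemma sqresolvent_exists t x : 0 < t -> exists u, is_sqresolvent t x u.
Proof.
move=> t0; pose S := [set r | exists2 u, dom A u & r = energy t x u].
have S_ge0 u : 0 <= energy t x u by rewrite addr_ge0 ?sqr_ge0// mulr_ge0 ?sqr_ge0// ltW.
have S0 : has_inf S.
  split; first by exists (energy t x 0), 0 => //; exact: dom0.
  by exists 0 => _ [u _ ->].
have m_le u : dom A u -> inf S <= energy t x u.
  by move=> du; apply: ge_inf; [case: S0|exists u].
have /choice[w wP] (n : nat) : exists w, dom A w /\ energy t x w < inf S + n.+1%:R^-1.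
  by have [|_ [w dw ->] h] := @inf_adherent _ S n.+1%:R^-1 _ S0; [rewrite invr_gt0|exists w].
have diff m n : nrm (w m - w n) ^+ 2 + t * nrm (A (w m) - A (w n)) ^+ 2 <=
    2 * (m.+1%:R^-1 + n.+1%:R^-1).
  have [dm em] := wP m; have [dn en] := wP n.
  have := m_le _ (domZ A_lin (2^-1%:C%C) (domD A_lin dm dn)).
  rewrite energy_midpoint//; move: em en; move: m.+1%:R^-1 n.+1%:R^-1 => a b; lra.
have small e : 0 < e -> exists N, forall n, (N <= n)%N -> 4 * n.+1%:R^-1 < e :> R.
  move=> e0; have [N NP] := @ltr_add_invr R 0 (e / 4) (divr_gt0 e0 (ltr0n _ 4)).
  exists N => n Nn; rewrite -ltr_pdivlMl // mulrC; apply: le_lt_trans NP.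
  by rewrite add0r lef_pV2 ?posrE// ler_nat ltnS.
(* One constant for both uses: [diff] bounds the squared differences of [w] with factor 1 and those
   of [A w] with factor 1/t. *)
have cvgw (F : X -> X) : (forall m n, nrm (F (w m) - F (w n)) ^+ 2 <=
      Num.max 1 t^-1 * (2 * (m.+1%:R^-1 + n.+1%:R^-1))) ->
    exists l : X, F (w n) @[n --> \oo] --> l.
  move=> hF; apply: cauchy_nrm_cvg => e e0.
  have c0 : 0 < Num.max 1 t^-1 by rewrite lt_max ltr01.
  have [N NP] := small (e ^+ 2 / Num.max 1 t^-1) (divr_gt0 (exprn_gt0 2 e0) c0).
  exists N => n Nn; rewrite -(@ltr_pXn2r _ 2) ?nnegrE ?nrm_ge0 ?ltW//.
  apply: le_lt_trans (hF N n) _; rewrite mulrC -ltr_pdivlMr//.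
  have := NP N (leqnn N); have := NP n Nn.
  by move: N.+1%:R^-1 n.+1%:R^-1 (_ / Num.max _ _) => a b c; lra.
have [u wu] : exists u : X, w n @[n --> \oo] --> u.
  apply: (cvgw id) => m n; apply: (@le_trans _ _ (2 * (m.+1%:R^-1 + n.+1%:R^-1))).
    by apply: le_trans (diff m n); rewrite lerDl mulr_ge0 ?sqr_ge0// ltW.
  by rewrite ler_peMl ?mulr_ge0 ?addr_ge0 ?invr_ge0// le_max lexx.
have [z wz] : exists z : X, A (w n) @[n --> \oo] --> z.
  apply: (cvgw A) => m n; apply: (@le_trans _ _ (t^-1 * (2 * (m.+1%:R^-1 + n.+1%:R^-1)))).
    by rewrite ler_pdivlMl //; apply: le_trans (diff m n); rewrite lerDr sqr_ge0.
  by rewrite ler_wpM2r ?mulr_ge0 ?addr_ge0 ?invr_ge0// le_max lexx orbT.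
have [du zE] : dom A u /\ z = A u.
  have := A_closed; move/(@closed_cvg _ _ \oo _ (fun n => (w n, A (w n)))) => /(_ _ (u, z)) /=.
  by apply; [apply: nearW => n; split=> //; exact: (wP n).1|exact: cvg_pair wu wz].
have Eu : energy t x u <= inf S.
  apply/ler_addgt0Pr => e e0.
  have cE : energy t x (w n) @[n --> \oo] --> energy t x u.
    have c1 : nrm (x - w n) @[n --> \oo] --> nrm (x - u).
      by apply: cvg_nrm; apply: cvgB => //; exact: cvg_cst.
    have c2 : nrm (A (w n)) @[n --> \oo] --> nrm (A u) by rewrite -zE; exact: cvg_nrm.
    apply: cvgD; first by apply: cvgM; exact: c1.
    by apply: cvgM; [exact: cvg_cst|apply: cvgM; exact: c2].
  apply: cvgr_to_le cE _; near=> n.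
  have /ltW/le_trans := (wP n).2; apply; rewrite lerD2l; near: n.
  have [N NP] := small e e0; exists N => // n /= /NP.
  have : 0 <= n.+1%:R^-1 :> R by [].
  by move: n.+1%:R^-1 => a; lra.
exists u; split=> // v dv.
have := @quadratic_ge0_eq0 R (2 * (t * [<A u, A v>] - [<x - u, v>]))
  (nrm v ^+ 2 + t * nrm (A v) ^+ 2).
(* The energy at u + s v minus the energy at [u] is this quadratic polynomial in [s]. *)
suff /[swap]/[apply] : forall s, 0 <= 2 * (t * [<A u, A v>] - [<x - u, v>]) * s +
  (nrm v ^+ 2 + t * nrm (A v) ^+ 2) * s ^+ 2 by lra.
move=> s; have := le_trans Eu (m_le _ (domZD A_lin s%:C%C dv du)).
rewrite -subr_ge0 /energy appZD// opprD addrCA addrC.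
rewrite (nrm_sqrB ipE (x - u)) (nrm_sqrD ipE (_ *: A v)) !nrmZr !exprMn ripZl ripZr [[<A v, A u>]]ripC.
rewrite !real_normK ?num_real// => /le_trans; apply.
by rewrite le_eqVlt; apply/orP; left; apply/eqP; ring.
Unshelve. all: by end_near. Qed.

Lemma sqresolvent_unique t x u v : 0 <= t ->
  is_sqresolvent t x u -> is_sqresolvent t x v -> u = v.
Proof.
move=> t0 [du uP] [dv vP]; apply/eqP; rewrite -subr_eq0; apply/eqP/nrm_eq0.
have dd := domB A_lin du dv.
have := uP _ dd; have := vP _ dd; rewrite appB// !ripBl !ripBr.
rewrite -[nrm _]ger0_norm ?nrm_ge0// => h1 h2; apply/eqP; rewrite normr_eq0 -sqrf_eq0.
rewrite -(rip_nrm ipE) !ripBl !ripBr eq_le; apply/andP; split.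
  have := sqr_ge0 (nrm (A u - A v)); rewrite -(rip_nrm ipE) !ripBl !ripBr.
  by move=> /(mulr_ge0 t0); lra.
by have := sqr_ge0 (nrm (u - v)); rewrite -(rip_nrm ipE) !ripBl !ripBr.
Qed.

(** Moving a complex scalar to the test vector is what makes the resolvent complex linear although
    its equation involves real parts only. *)
Lemma ripZ_adjoint (c : R[i]) x y : [<c *: x, y>] = [<x, c^* *: y>].
Proof.
rewrite /rip linearZl_LR linearZr_LR; congr complex.Re; congr (_ * _).
exact/esym/conjCK.
Qed.

Lemma is_sqresolventZD t c x y u v : is_sqresolvent t x u -> is_sqresolvent t y v ->
  is_sqresolvent t (c *: x + y) (c *: u + v).
Proof.
move=> [du uP] [dv vP]; split; first exact: domZD.
move=> p dp; rewrite appZD// opprD addrACA -scalerBr ripDl [[<_ + A v, _>]]ripDl !ripZ_adjoint mulrDr.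
by rewrite vP// uP ?appZ//; exact: domZ.
Qed.

Lemma sqresolvent_choice : exists F : R -> X -> X,
  forall t x, 0 < t -> is_sqresolvent t x (F t x).
Proof.
have /choice[F FP] (tx : R * X) : exists u, 0 < tx.1 -> is_sqresolvent tx.1 tx.2 u.
  have [t0|_] := ltP 0 tx.1; last by exists 0.
  by have [u uP] := sqresolvent_exists tx.2 t0; exists u.
by exists (fun t x => F (t, x)) => t x; exact: (FP (t, x)).
Qed.

Section Increment.
Variables (t : R) (x u w d : X).
Hypotheses (t0 : 0 < t) (uP : is_sqresolvent (4 * t) x u) (wP : is_sqresolvent t x w).
Hypothesis dE : d = w - u.
Let du : dom A u. Proof. exact: uP.1. Qed.
Let dw : dom A w. Proof. exact: wP.1. Qed.
Let dd : dom A d. Proof. by rewrite dE; exact: domB. Qed.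
Let wE : w = u + d. Proof. by rewrite dE addrC subrK. Qed.
Let AwE : A w = A u + A d. Proof. by rewrite wE appD. Qed.
Let rip_ge0 y : 0 <= [<y, y>]. Proof. by rewrite (rip_nrm ipE) sqr_ge0. Qed.
Let trip_ge0 y : 0 <= t * [<y, y>]. Proof. by rewrite mulr_ge0// ltW. Qed.

(** The right-hand side exceeds the left-hand side by exactly 3t |A u|^2, as testing both equations
    with [u] shows. For parameters in geometric progression of ratio 1/4 the bounds telescope. *)
Lemma sqresolvent_increment_le :
  nrm d ^+ 2 + t * nrm (A d) ^+ 2 <= [<w, x>] - [<u, x>].
Proof.
have e1 := uP.2 _ du; have e2 := wP.2 _ du; have e3 := wP.2 _ dd.
rewrite -!(rip_nrm ipE); move: e1 e2 e3; rewrite !ripBl AwE wE !ripDl.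
rewrite [[<u, x>]]ripC [[<d, x>]]ripC [[<d, u>]]ripC [[<A d, A u>]]ripC => e1 e2 e3.
have := trip_ge0 (A u); lra.
Qed.

(** With p = x - w the two equations combine into <d, v> + 4t <A d, A v> = 3 <p, v>. Used with v =
    p, it shows that 4t times the right-hand side equals |d|^2 + 4t |A d|^2 + 3 |p|^2. *)
Lemma sqresolvent_increment_dom_le : dom A x ->
  nrm d ^+ 2 / (4 * t) + nrm (A d) ^+ 2 <= [<A w, A x>] - [<A u, A x>].
Proof.
move=> dx; have [p pE] : exists p, p = x - w by exists (x - w).
have dp : dom A p by rewrite pE; exact: domB.
have xE : x = p + d + u by rewrite pE dE addrA subrK subrK.
have AxE : A x = A p + A d + A u by rewrite xE !appD//; exact: domD.
have eq v : dom A v -> [<d, v>] + 4 * t * [<A d, A v>] = 3 * [<p, v>].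
  move=> dv; have := uP.2 _ dv; have := wP.2 _ dv.
  by rewrite AwE {1}xE wE !ripBl !ripDl xE !ripDl; lra.
have pd := eq _ dd; have := eq _ dp; have := uP.2 _ dd.
rewrite xE addrK [[<d, p>]]ripC ripDl [[<A d, A p>]]ripC => e1 pp.
have d2 := rip_ge0 d; have Ad2 := trip_ge0 (A d).
have := rip_ge0 (3%:C%C *: p - d).
rewrite ripBl !ripBr !ripZl !ripZr [[<d, p>]]ripC => h.
have t4 : 0 < 4 * t by rewrite mulr_gt0.
rewrite -!(rip_nrm ipE) -(ler_pM2l t4) mulrDr mulrC divfK ?gt_eqF//.
rewrite -xE; have -> : [<A w, A x>] - [<A u, A x>] = [<A d, A x>] by rewrite AwE ripDl; ring.
by rewrite AxE !ripDr [[<A d, A p>]]ripC [[<A d, A u>]]ripC; lra.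
Qed.

End Increment.
End SquareResolvent.

(** * Complex interpolation *)

Section ComplexDerivative.
Context {R : realType}.
Implicit Types (X Y : normedModType R[i]) (z h : R[i]^o).

Lemma nrm_derivable X (F : R[i]^o -> X) z (l : X) :
  (forall e : R, 0 < e -> exists2 d : R, 0 < d & forall h, nrm h < d ->
    nrm (F (z + h) - F z - h *: l) <= e * nrm h) -> derivable F z 1.
Proof.
move=> hF; apply/cvg_ex; exists l; apply/cvg_nrmP => e e0.
have e2 : 0 < e / 2 by rewrite divr_gt0.
have [d d0 hd] := hF _ e2.
have dC : 0 < d%:C%C by rewrite ltcR.
rewrite near_withinE; apply/nbhs_ballP; exists d%:C%C => //= h.
rewrite /ball /= sub0r normrN [X in X < _](nrmE (h : R[i]^o)) ltcR => /hd + h0.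
rewrite (_ : h *: (1 : R[i]^o) = h); last exact: mulr1.
rewrite [z + h]addrC => hh.
have hp : 0 < nrm (h : R[i]^o).
  by rewrite lt_neqAle nrm_ge0 andbT eq_sym; apply: contra h0 => /eqP/nrm_eq0 ->.
have -> : l - h^-1 *: (F (h + z) - F z) = - h^-1 *: (F (h + z) - F z - h *: l).
  by rewrite [RHS]scalerBr scalerA mulNr mulVf// !scaleNr scale1r opprK addrC.
rewrite nrmZ; have -> : nrm (- h^-1 : R[i]^o) = (nrm (h : R[i]^o))^-1.
  apply: (mulfI (lt0r_neq0 hp)); rewrite -nrm_complexM mulfV ?lt0r_neq0//.
  by rewrite mulrN mulfV// nrmN -[1](rmorph1 (real_complex R)) nrm_real normr1.
rewrite mulrC ltr_pdivrMr//; apply: le_lt_trans hh _.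
by rewrite ltr_pM2r//; lra.
Qed.

Lemma is_derive_dist (f : R -> R) (x l e : R) : is_derive x (1 : R) f l -> 0 < e ->
  exists2 d : R, 0 < d & forall t, `|t| < d -> `|f (x + t) - f x - l * t| <= e * `|t|.
Proof.
move=> [fx fl] e0.
have /cvgrPdist_lt/(_ e e0) : t^-1 *: (f (t + x) - f x) @[t --> 0^'] --> l.
  by rewrite -fl; under eq_fun do rewrite -[X in f (X + x)]mulr1; exact: fx.
rewrite near_withinE => /nbhs_ballP[d /= d0 hd]; exists d => // t td.
have [->|t0] := eqVneq t 0; first by rewrite addr0 subrr mulr0 subr0 !normr0 mulr0.
have tb : ball 0 d t by rewrite /ball /= sub0r normrN.
have := ltW (hd t tb t0).
rewrite -(ler_pM2r (x := `|t|)) ?normr_gt0// -normrM distrC addrC.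
by congr (`| _ | <= _); rewrite /GRing.scale /= [t + x]addrC; field.
Qed.

Lemma bounded_linear_continuous X Y (T : X -> Y) (C : R) (A : set R[i]^o) (F : R[i]^o -> X) :
  (forall c x y, T (c *: x + y) = c *: T x + T y) -> (forall x, nrm (T x) <= C * nrm x) ->
  {within A, continuous F} -> {within A, continuous (T \o F)}.
Proof.
move=> Tl TC /subspace_continuousP cF; apply/subspace_continuousP => z Az.
have C0 : 0 < `|C| + 1 by have := normr_ge0 C; lra.
have TB x y : T x - T y = T (x - y) by rewrite addrC -scaleN1r -Tl scaleN1r addrC.
apply/cvg_nrmP => e e0; have /cvg_nrmP := cF z Az => /(_ _ (divr_gt0 e0 C0)).
apply: filterS => w; rewrite ltr_pdivlMr//=; apply: le_lt_trans.
rewrite TB (le_trans (TC _))// mulrC ler_wpM2l ?nrm_ge0//.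
by have := ler_norm C; lra.
Qed.

Lemma bounded_linear_derivable X Y (T : X -> Y) (C : R) (F : R[i]^o -> X) z :
  (forall c x y, T (c *: x + y) = c *: T x + T y) -> (forall x, nrm (T x) <= C * nrm x) ->
  derivable F z 1 -> derivable (T \o F) z 1.
Proof.
move=> Tl TC /derivable_nrm[l hl]; apply: (@nrm_derivable _ _ _ (T l)) => e e0.
have C0 : 0 < `|C| + 1 by have := normr_ge0 C; lra.
have [d d0 hd] := hl _ (divr_gt0 e0 C0); exists d => // h /hd.
have T0 : T 0 = 0 by have := Tl (- 1) 0 0; rewrite scaler0 addr0 scaleN1r addNr.
have TZ c x : T (c *: x) = c *: T x by have := Tl c x 0; rewrite !addr0 T0 addr0.
have TB x y : T (x - y) = T x - T y by rewrite addrC -scaleN1r Tl scaleN1r addrC.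
rewrite mulrAC ler_pdivlMr// => hF /=; rewrite -!TZ -!TB (le_trans (TC _))//.
rewrite (le_trans _ hF)// mulrC ler_wpM2l ?nrm_ge0//.
by have := ler_norm C; lra.
Qed.

(** The function 2^z, whose modulus is 1 and 2 on the two sides of the strip. *)
Definition cexp2 z : R[i]^o := (expR (complex.Re z * ln 2))%:C%C *
  (cos (complex.Im z * ln 2) +i* sin (complex.Im z * ln 2))%C.

Lemma nrm_cexp2 z : nrm (cexp2 z) = expR (complex.Re z * ln 2).
Proof.
rewrite /cexp2 nrm_complexM nrm_real gtr0_norm ?expR_gt0//.
by rewrite nrm_complexE /= cos2Dsin2 sqrtr1 mulr1.
Qed.

Lemma cexp2D z h : cexp2 (z + h) = cexp2 z * cexp2 h.
Proof.
rewrite /cexp2 !raddfD !mulrDl expRD cosD sinD rmorphM /=.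
rewrite mulrACA; congr (_ * _); apply/eqP; rewrite eq_complex /=.
by rewrite eqxx addrC eqxx.
Qed.

Lemma exp_cos_sin_dist (e : R) : 0 < e -> exists2 d : R, 0 < d & forall a b : R,
  `|a| < d -> `|b| < d ->
  `|expR a * cos b - 1 - a| <= 3 * e * (`|a| + `|b|) /\
  `|expR a * sin b - b| <= 3 * e * (`|a| + `|b|).
Proof.
move=> e0; have m0 : 0 < Num.min e 1 by rewrite lt_min e0 ltr01.
have de : is_derive (0 : R) (1 : R) expR 1 by apply: is_derive_eq; rewrite expR0.
have dc : is_derive (0 : R) (1 : R) cos 0 by apply: is_derive_eq; rewrite sin0 oppr0.
have ds : is_derive (0 : R) (1 : R) sin 1 by apply: is_derive_eq; rewrite cos0.
have [d1 d10 h1] := is_derive_dist de e0.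
have [d2 d20 h2] := is_derive_dist dc e0.
have [d3 d30 h3] := is_derive_dist ds e0.
have [d4 d40 h4] := is_derive_dist de (@ltr01 R).
exists (Num.min (Num.min d1 d2) (Num.min (Num.min d3 d4) (Num.min e 1 / 2))).
  by rewrite !lt_min d10 d20 d30 d40 divr_gt0.
move=> a b; rewrite !lt_min => /and3P[/andP[a1 a2] /andP[a3 a4] a5] /and3P[/andP[b1 b2] /andP[b3 b4] b5].
have := h1 a a1; have := h2 b b2; have := h3 b b3; have := h4 a a4.
rewrite !add0r expR0 cos0 sin0 subr0 !mul1r mul0r subr0 => k4 k3 k2 k1.
have ea : `|expR a - 1| <= Num.min e 1.
  have -> : expR a - 1 = (expR a - 1 - a) + a by ring.
  rewrite (le_trans (ler_normD _ _))// (le_trans (lerD k4 (lexx _)))//; lra.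
have ea1 : `|expR a - 1| <= e by rewrite (le_trans ea)// ge_min lexx.
have ea2 : expR a <= 2.
  have : `|expR a - 1| <= 1 by rewrite (le_trans ea)// ge_min lexx orbT.
  by rewrite ler_norml => /andP[_]; lra.
have abs_mul (x y u v : R) : `|x| <= u -> `|y| <= v -> `|x * y| <= u * v.
  by move=> xu yv; rewrite normrM ler_pM.
have ea3 : `|expR a| <= 2 by rewrite ger0_norm// expR_ge0.
have a0 := normr_ge0 a; have b0 := normr_ge0 b.
have ea0 : 0 <= e * `|a| by rewrite mulr_ge0// ltW.
have eb0 : 0 <= e * `|b| by rewrite mulr_ge0// ltW.
split.
  have -> : expR a * cos b - 1 - a = expR a * (cos b - 1) + (expR a - 1 - a) by ring.
  rewrite (le_trans (ler_normD _ _))//.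
  by have := abs_mul _ _ _ _ ea3 k2; lra.
have -> : expR a * sin b - b = expR a * (sin b - b) + (expR a - 1) * b by ring.
rewrite (le_trans (ler_normD _ _))//.
by have := abs_mul _ _ _ _ ea3 k3; have := abs_mul _ _ _ _ ea1 (lexx `|b|); lra.
Qed.

(** The functional equation [cexp2D] reduces the claim to the origin, i.e. to the first-order
    expansions of exp, cos and sin. *)
Lemma cexp2_derivable z : derivable cexp2 z 1.
Proof.
apply: (@nrm_derivable (R[i]^o)%type cexp2 z ((ln 2)%:C%C * cexp2 z)) => e e0.
have N0 : 0 < nrm (cexp2 z) by rewrite nrm_cexp2 expR_gt0.
have L0 : 0 < ln 2 :> R by rewrite ln_gt0// ltr1n.
(* 12 = 2 * 3 * 2: real and imaginary part, the factor 3 of [exp_cos_sin_dist], and |a| + |b| <= 2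
   |h| ln 2. *)
have K0 : 0 < 12 * ln 2 * nrm (cexp2 z) by rewrite !mulr_gt0.
have [d d0 hd] := exp_cos_sin_dist (divr_gt0 e0 K0).
exists (d / ln 2); first by rewrite divr_gt0.
move=> h; rewrite ltr_pdivlMr// => hd'.
pose a := complex.Re h * ln 2; pose b := complex.Im h * ln 2.
have aE : `|a| <= nrm h * ln 2 by rewrite normrM (gtr0_norm L0) ler_pM2r// normr_Re_le.
have bE : `|b| <= nrm h * ln 2 by rewrite normrM (gtr0_norm L0) ler_pM2r// normr_Im_le.
have [h1 h2] := hd a b (le_lt_trans aE hd') (le_lt_trans bE hd').
have -> : cexp2 (z + h) - cexp2 z - h *: ((ln 2)%:C%C * cexp2 z) =
    cexp2 z * (cexp2 h - 1 - (ln 2)%:C%C * h) :> R[i]^o.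
  by rewrite cexp2D /GRing.scale /=; ring.
have wE : cexp2 h - 1 - (ln 2)%:C%C * h =
    ((expR a * cos b - 1 - a) +i* (expR a * sin b - b))%C.
  rewrite /cexp2 -/a -/b /a /b; case: h {hd' aE bE h1 h2 a b} => p q /=.
  by apply/eqP; rewrite eq_complex /=; apply/andP; split; apply/eqP; ring.
rewrite wE nrm_complexM.
have := nrm_le_ReIm ((expR a * cos b - 1 - a) +i* (expR a * sin b - b))%C.
rewrite /= => hh; rewrite -ler_pdivlMl//; apply: le_trans hh _.
have e'0 : 0 < e / (12 * ln 2 * nrm (cexp2 z)) by rewrite divr_gt0.
have -> : (nrm (cexp2 z))^-1 * (e * nrm h) =
    6 * (e / (12 * ln 2 * nrm (cexp2 z)) * (2 * (nrm h * ln 2))).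
  by field; rewrite !gt_eqF.
have := ler_wpM2l (ltW e'0) (lerD aE bE); move: h1 h2.
by move: (e / _) `|_ - a| `|_ - b| => e' p q; lra.
Qed.

End ComplexDerivative.

(** * Square sums on the interpolation space from square sums on its two end spaces *)

Section Interpolation.
Context {R : realType} (X : completeNormedModType R[i]) (ip : {dot X for Num.conj}).
Hypothesis ipE : forall x : X, `|x| ^+ 2 = ip x x.
Implicit Types (x y : X) (Y : normed_subspace X).

Lemma within_continuous_sum (A : set R[i]^o) N (g : 'I_N -> R[i]^o -> R[i]^o) :
  (forall i, {within A, continuous (g i)}) ->
  {within A, continuous (fun z => \sum_(i < N) g i z)}.
Proof.
elim: N g => [|N ih] g cg z.
  by under eq_fun do rewrite big_ord0; exact: cvg_cst.
by under eq_fun do rewrite big_ord_recr; apply: cvgD; [exact: ih|exact: cg].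
Qed.

Lemma derivable_sum_ord N (g : 'I_N -> R[i]^o -> R[i]^o) z :
  (forall i, derivable (g i) z 1) -> derivable (fun z => \sum_(i < N) g i z) z 1.
Proof.
elim: N g => [|N ih] g dg.
  by under eq_fun do rewrite big_ord0; exact: derivable_cst.
by under eq_fun do rewrite big_ord_recr; apply: derivableD; [exact: ih|exact: dg].
Qed.

Lemma derivable_mulc (f g : R[i]^o -> R[i]^o) z : derivable f z 1 -> derivable g z 1 ->
  derivable (fun w => f w * g w : R[i]^o) z 1.
Proof. by move=> df dg; exact: (@derivableM _ _ f g z 1 df dg). Qed.

Lemma cexp2X_derivable n z : derivable (fun w : R[i]^o => cexp2 w ^+ n : R[i]^o) z 1.
Proof.
elim: n => [|n ih].
  by under eq_fun do rewrite expr0; exact: derivable_cst.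
under eq_fun do rewrite exprS.
exact: derivable_mulc (@cexp2_derivable R z) ih.
Qed.

Lemma mul_le_half_sqr (a b c : R) : a * b * c <= 2^-1 * ((a * b) ^+ 2 + c ^+ 2).
Proof. by have := sqr_ge0 (a * b - c); rewrite sqrrB; lra. Qed.

(** With y_n = 2^(n/2) T_n x, the function g(z) = sum 2^(nz) <T_n F(z), y_n> is holomorphic and
    takes at 1/2 the value [S] of the wanted sum. On the sides of the strip 2^(nz) has modulus 1 and
    2^n, so Young's inequality and the two hypotheses bound Re g by (K + S) / 2; the three lines
    theorem then gives S <= K, uniformly in [N]. *)
Lemma interpolation_sum_le Y (T : nat -> X -> X) (C : R) x :
  0 <= C -> (forall x, 0 <= snorm Y x) ->
  (forall n c x y, T n (c *: x + y) = c *: T n x + T n y) ->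
  (forall x N, \sum_(n < N) nrm (T n x) ^+ 2 <= C * nrm x ^+ 2) ->
  (forall x N, Y x -> \sum_(n < N) (2 ^+ n * nrm (T n x)) ^+ 2 <= C * snorm Y x ^+ 2) ->
  interpolation (2^-1) Y x ->
  exists K, forall N, \sum_(n < N) 2 ^+ n * nrm (T n x) ^+ 2 <= K.
Proof.
move=> C0 Y0 Tl TC TY [F [cF [M0 FM0] dF YF [_ [M1 FM1]]] Fx].
have L0 : 0 < ln 2 :> R by rewrite ln_gt0// ltr1n.
exists (C * (M0 ^+ 2 + M1 ^+ 2)) => N.
set S := \sum_(n < N) 2 ^+ n * _; set K := C * _.
have Tb n z : nrm (T n z) <= (C + 1) * nrm z.
  rewrite -(@ler_pXn2r _ 2) ?nnegrE ?nrm_ge0// ?mulr_ge0 ?nrm_ge0 ?addr_ge0//.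
  have := TC z n.+1; rewrite big_ord_recr /= => h.
  have : nrm (T n z) ^+ 2 <= C * nrm z ^+ 2.
    by apply: le_trans h; rewrite lerDr sumr_ge0// => i _; rewrite sqr_ge0.
  move=> /le_trans; apply; rewrite exprMn ler_wpM2r ?sqr_ge0//.
  by have := mulr_ge0 C0 C0; rewrite sqrrD; lra.
pose r : R := expR (2^-1 * ln 2).
have r2 : r ^+ 2 = 2.
  by rewrite -expRM_natl -[2 in RHS]lnK ?posrE//; congr expR; rewrite mulrA divff// mul1r.
have r0 : 0 <= r by rewrite expR_ge0.
pose y n := (r ^+ n)%:C%C *: T n x.
have yE n : nrm (y n) ^+ 2 = 2 ^+ n * nrm (T n x) ^+ 2.
  by rewrite nrmZr exprMn real_normK ?num_real// -exprM mulnC exprM r2.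
pose l n z : R[i]^o := ip (T n z) (y n).
have ll n c u v : l n (c *: u + v) = c *: l n u + l n v.
  by rewrite /l Tl linearDl linearZl_LR.
have lb n z : nrm (l n z) <= ((C + 1) * nrm (y n)) * nrm z.
  rewrite (le_trans (ip_le_nrm ipE _ _))// mulrAC ler_wpM2r ?nrm_ge0//.
pose g z : R[i]^o := \sum_(n < N) (cexp2 z ^+ n * l n (F z) : R[i]^o).
have cX i : continuous (fun w : R[i]^o => cexp2 w ^+ i : R[i]^o).
  by move=> z; apply: differentiable_continuous; apply/derivable1_diffP; exact: cexp2X_derivable.
have gc : {within @strip R, continuous g}.
  apply: within_continuous_sum => i z; apply: cvgM.
    exact: (continuous_subspaceT (cX i)).
  exact: (bounded_linear_continuous (ll i) (lb i) cF).
have gd (z : R[i]^o) : 0 < complex.Re z < 1 -> derivable g z 1.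
  move=> zI; apply: derivable_sum_ord => i.
  apply: derivable_mulc (@cexp2X_derivable i z) _.
  exact: (bounded_linear_derivable (ll i) (lb i) (dF z zI)).
have nrmX (z : R[i]^o) n : nrm (z ^+ n : R[i]^o) = nrm z ^+ n.
  elim: n => [|n ih]; last by rewrite !exprS nrm_complexM ih.
  by rewrite !expr0 -[1](rmorph1 (real_complex R)) nrm_real normr1.
have c01 t : 0 <= t <= 1 -> expR (t * ln 2) <= 2 :> R.
  move=> /andP[t0 t1]; rewrite -[leRHS]lnK ?posrE// ler_expR -[leRHS]mul1r.
  by rewrite ler_pM2r.
(* This bound depends on [N], but it only serves as the a priori boundedness in the three lines
   theorem and does not enter its conclusion. *)
pose H := \sum_(n < N) 2 ^+ n * ((C + 1) * nrm (y n) * M0).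
have gK z : strip z -> nrm (g z) <= H.
  move=> zS; rewrite (le_trans (nrm_sum _ _ _))// ler_sum// => i _.
  rewrite nrm_complexM nrmX nrm_cexp2 ler_pM ?exprn_ge0 ?expR_ge0 ?nrm_ge0//.
    by rewrite lerXn2r ?nnegrE ?expR_ge0// c01.
  rewrite (le_trans (lb _ _))// ler_wpM2l ?mulr_ge0 ?addr_ge0 ?nrm_ge0//; exact: FM0.
have line (t : R) (a : R) : expR (t * ln 2) = a ->
    (forall s, \sum_(n < N) (a ^+ n * nrm (T n (F (t +i* s)%C))) ^+ 2 <= K) ->
    forall s, complex.Re (g (t +i* s)%C) <= 2^-1 * (K + S).
  move=> ta hs s; rewrite (le_trans (ler_norm _))// (le_trans (normr_Re_le _))//.
  rewrite (le_trans (nrm_sum _ _ _))//.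
  apply: (@le_trans _ _ (\sum_(n < N) 2^-1 *
      ((a ^+ n * nrm (T n (F (t +i* s)%C))) ^+ 2 + nrm (y n) ^+ 2))).
    apply: ler_sum => i _; rewrite nrm_complexM nrmX nrm_cexp2 /= ta.
    apply: le_trans (mul_le_half_sqr _ _ _); rewrite -mulrA.
    rewrite ler_wpM2l ?exprn_ge0 -?ta ?expR_ge0//; exact: ip_le_nrm ipE _ _.
  rewrite -mulr_sumr ler_pM2l// big_split /= lerD//.
  by rewrite /S ler_sum// => i _; rewrite yE.
have g12 : complex.Re (g (2^-1)%:C%C) = S.
  rewrite /g raddf_sum; apply: eq_bigr => n _.
  have -> : cexp2 (2^-1)%:C%C = r%:C%C :> R[i].
    by rewrite /cexp2 /= mul0r cos0 sin0 mulr1.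
  have ReM (a : R) (w : R[i]) : complex.Re (a%:C%C * w) = a * complex.Re w.
    by case: w => p q /=; rewrite mul0r subr0.
  rewrite -rmorphXn; apply: etrans; first exact: ReM.
  rewrite /l Fx -/(rip ip _ _) ripZr (rip_nrm ipE) mulrA -expr2.
  by rewrite -exprM mulnC exprM r2.
(* [S] is a finite sum, so half of it can be absorbed. *)
suff : S <= 2^-1 * (K + S) by lra.
rewrite -{1}g12; apply: (three_lines_Re gc gd gK _); last by apply/andP; split; lra.
have KE : K = C * M0 ^+ 2 + C * M1 ^+ 2 by rewrite /K mulrDr.
move=> s; split.
  apply: (line 0 1); first by rewrite mul0r expR0.
  move=> s'; apply: (@le_trans _ _ (C * M0 ^+ 2)); last by rewrite KE lerDl mulr_ge0 ?sqr_ge0.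
  under eq_bigr do rewrite expr1n mul1r.
  rewrite (le_trans (TC _ _))// ler_wpM2l// lerXn2r ?nnegrE ?nrm_ge0//.
    by rewrite (le_trans (nrm_ge0 (F 0)))// FM0// /strip /= lexx ler01.
  by rewrite FM0// /strip /= lexx ler01.
apply: (line 1 2); first by rewrite mul1r lnK// posrE.
move=> s'; apply: (@le_trans _ _ (C * M1 ^+ 2)); last by rewrite KE lerDr mulr_ge0 ?sqr_ge0.
rewrite (le_trans (TY _ _ (YF _)))// ler_wpM2l// lerXn2r ?nnegrE ?Y0//.
by rewrite (le_trans (Y0 (F (1 +i* 0)%C))).
Qed.

End Interpolation.

(** * The decomposition of an element of the interpolation space into elements of the domain *)

Section Approximation.
Context {R : realType} (X : completeNormedModType R[i]) (ip : {dot X for Num.conj}).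
Hypothesis ipE : forall x : X, `|x| ^+ 2 = ip x x.
Variable A : operator X.
Hypothesis A_lin : linear_operator A.
Hypothesis A_closed : closed_operator A.
Hypothesis A_dense : dense (dom A).
Implicit Types (x y u v w : X) (t : R).

(** Expanding the energy of [w] around [u], the mixed terms cancel by the weak equation and all
    other terms are nonnegative. *)
Lemma sqresolvent_min t x u w : 0 <= t -> is_sqresolvent ip A t x u -> dom A w ->
  nrm (x - u) ^+ 2 <= nrm (x - w) ^+ 2 + t * nrm (A w) ^+ 2.
Proof.
move=> t0 [du uP] dw; have [v vE] : exists v, v = w - u by exists (w - u).
have dv : dom A v by rewrite vE; exact: domB.
have wE : w = u + v by rewrite vE addrC subrK.
rewrite wE (appD A_lin du dv) opprD addrA (nrm_sqrB ipE (x - u)) (nrm_sqrD ipE (A u)).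
have := mulr_ge0 t0 (sqr_ge0 (nrm (A u))); have := mulr_ge0 t0 (sqr_ge0 (nrm (A v))).
by have := sqr_ge0 (nrm v); have := uP v dv; lra.
Qed.

(** Controls the end terms of the telescoping sum over [sqresolvent_increment_le]; the next lemma
    does the same for elements of the domain. *)
Lemma sqresolvent_rip_le t x u : 0 <= t -> is_sqresolvent ip A t x u ->
  0 <= rip ip u x <= nrm x ^+ 2.
Proof.
move=> t0 [du uP]; have := uP u du; rewrite ripBl !(rip_nrm ipE) ripC => e.
have := mulr_ge0 t0 (sqr_ge0 (nrm (A u))) => h; have := sqr_ge0 (nrm u) => h1.
have := sqr_ge0 (nrm (u - x)); rewrite (nrm_sqrB ipE) => h2.
by apply/andP; split; lra.
Qed.

Lemma sqresolvent_rip_dom_le t x u : 0 < t -> is_sqresolvent ip A t x u -> dom A x ->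
  0 <= rip ip (A u) (A x) <= nrm (A x) ^+ 2.
Proof.
move=> t0 [du uP] dx; have := uP u du; have := uP x dx; rewrite !(rip_nrm ipE) => ex eu.
have h : 0 <= t * (rip ip (A u) (A x) - nrm (A u) ^+ 2).
  rewrite mulrBr -ex -eu !ripBl (ripC ip u x).
  by have := sqr_ge0 (nrm (x - u)); rewrite (nrm_sqrB ipE) -!(rip_nrm ipE); lra.
have {}h : nrm (A u) ^+ 2 <= rip ip (A u) (A x) by move: h; rewrite pmulr_rge0// subr_ge0.
have := sqr_ge0 (nrm (A u)) => h1.
have := sqr_ge0 (nrm (A u - A x)); rewrite (nrm_sqrB ipE) => h2.
by apply/andP; split; lra.
Qed.

(** Minimality compares [u n] with a fixed [w] of the dense domain close to [x], whose energy
    exceeds |x - w|^2 by 4^-n |A w|^2 only. *)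
Lemma cvg_sqresolvent x (u : nat -> X) :
  (forall n, is_sqresolvent ip A (4 ^- n) x (u n)) -> u n @[n --> \oo] --> x.
Proof.
move=> uP; apply/cvg_nrmP => e e0.
have e2 : 0 < (e / 2)%:C%C :> R[i] by rewrite ltcR divr_gt0.
have [||w [/= xw dw]] := A_dense (O := ball x (e / 2)%:C%C).
- by exists x; exact: ballxx.
- exact: ball_open.
have {}xw : nrm (x - w) < e / 2 by move: xw; rewrite -ball_normE /= nrmE ltcR.
have [N NP] := exists_lt_exp2 (4 * nrm (A w) ^+ 2 / e ^+ 2).
have ee : 0 < e ^+ 2 by rewrite exprn_gt0.
exists N => // n /= Nn.
rewrite -(@ltr_pXn2r _ 2) ?nnegrE ?nrm_ge0 ?ltW//.
have t0 : 0 <= 4 ^- n :> R by rewrite invr_ge0 exprn_ge0.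
apply: le_lt_trans (sqresolvent_min t0 (uP n) dw) _.
have h1 : nrm (x - w) ^+ 2 < (e / 2) ^+ 2.
  by rewrite ltr_pXn2r ?nnegrE ?nrm_ge0// divr_ge0// ltW.
have h2 : 4 ^- n * nrm (A w) ^+ 2 <= e ^+ 2 / 4.
  rewrite mulrC ler_pdivrMr ?exprn_gt0//.
  move: NP; rewrite ltr_pdivrMr// => /ltW NP.
  have h4 : 2 ^+ N <= 4 ^+ n :> R.
    rewrite (@le_trans _ _ (2 ^+ n))// ?ler_weXn2l// ?ler1n//.
    by rewrite lerXn2r ?nnegrE// ler_nat.
  by have := ler_wpM2r (ltW ee) h4; lra.
lra.
Qed.

Lemma half_space_approx x : interpolation (2^-1) (graph_space A) x ->
  exists e : nat -> X, exists K : R, [/\ forall n, dom A (e n),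
    forall N, \sum_(n < N) 2 ^+ n * nrm (e n) ^+ 2 <= K,
    forall N, \sum_(n < N) 2 ^- n * nrm (A (e n)) ^+ 2 <= K
  & \sum_(i < n) e i @[n --> \oo] --> x].
Proof.
move=> xI; have [F FP] := sqresolvent_choice ipE A_lin A_closed.
have t0 n : 0 < 4 ^- n :> R by rewrite invr_gt0 exprn_gt0.
(* The increments require parameters in the ratio 4; with t = 4^-(n+1) the factor 1 / (4t) is 4^n,
   the square of the weight 2^n. *)
have tS n : 4 * 4 ^- n.+1 = 4 ^- n :> R by rewrite exprS invfM mulrA mulfV// mul1r.
pose u n z := F (4 ^- n) z; pose d n z := u n.+1 z - u n z.
have uP n z : is_sqresolvent ip A (4 ^- n) z (u n z) by exact: FP.
have du n z : dom A (u n z) by case: (uP n z).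
have dd n z : dom A (d n z) by exact: domB.
have ul n c y z : u n (c *: y + z) = c *: u n y + u n z.
  apply: (sqresolvent_unique ipE A_lin (ltW (t0 n)) (uP n _)).
  by apply: is_sqresolventZD => //; exact: uP.
have dl n c y z : d n (c *: y + z) = c *: d n y + d n z.
  by rewrite /d !ul scalerBr opprD addrACA.
have uP4 n z : is_sqresolvent ip A (4 * 4 ^- n.+1) z (u n z) by rewrite tS.
have I1 n z : nrm (d n z) ^+ 2 + 4 ^- n.+1 * nrm (A (d n z)) ^+ 2 <=
    rip ip (u n.+1 z) z - rip ip (u n z) z.
  exact: (sqresolvent_increment_le ipE A_lin (t0 n.+1) (uP4 n z) (uP n.+1 z)).
have I2 n z : dom A z -> (2 ^+ n * nrm (d n z)) ^+ 2 + nrm (A (d n z)) ^+ 2 <=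
    rip ip (A (u n.+1 z)) (A z) - rip ip (A (u n z)) (A z).
  move=> dz; have := sqresolvent_increment_dom_le ipE A_lin (t0 n.+1) (uP4 n z) (uP n.+1 z) erefl dz.
  rewrite tS invrK exprMn -exprM mulnC exprM mulrC; congr (_ * _ + _ <= _).
  by congr (_ ^+ _); ring.
have telescope (f : nat -> R) N : \sum_(n < N) (f n.+1 - f n) = f N - f 0.
  by rewrite -(big_mkord xpredT (fun n => f n.+1 - f n)) telescope_sumr.
have S1 z N : \sum_(n < N) (nrm (d n z) ^+ 2 + 4 ^- n.+1 * nrm (A (d n z)) ^+ 2) <= nrm z ^+ 2.
  rewrite (le_trans (ler_sum _ (fun (n : 'I_N) _ => I1 n z)))// (telescope (fun n => rip ip (u n z) z)).
  have /andP[_ h] := sqresolvent_rip_le (ltW (t0 N)) (uP N z).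
  by have /andP[h' _] := sqresolvent_rip_le (ltW (t0 0)) (uP 0 z); lra.
have S2 z N : dom A z ->
    \sum_(n < N) ((2 ^+ n * nrm (d n z)) ^+ 2 + nrm (A (d n z)) ^+ 2) <= nrm (A z) ^+ 2.
  move=> dz; rewrite (le_trans (ler_sum _ (fun (n : 'I_N) _ => I2 n z dz)))//.
  rewrite (telescope (fun n => rip ip (A (u n z)) (A z))).
  have /andP[_ h] := sqresolvent_rip_dom_le (t0 N) (uP N z) dz.
  by have /andP[h' _] := sqresolvent_rip_dom_le (t0 0) (uP 0 z) dz; lra.
have g0 z : 0 <= snorm (graph_space A) z by rewrite addr_ge0 ?nrm_ge0.
have gA z : nrm (A z) ^+ 2 <= snorm (graph_space A) z ^+ 2.
  by rewrite lerXn2r ?nnegrE ?g0 ?nrm_ge0// lerDr nrm_ge0.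
have tn (n : nat) (r : R) : 0 <= 4 ^- n.+1 * r ^+ 2 by rewrite mulr_ge0 ?sqr_ge0// ltW.
have [K1 K1P] : exists K, forall N, \sum_(n < N) 2 ^+ n * nrm (d n x) ^+ 2 <= K.
  apply: (interpolation_sum_le ipE (C := 1) _ g0 dl _ _ xI) => // z N.
    rewrite mul1r (le_trans _ (S1 z N))// ler_sum// => n _.
    by rewrite lerDl tn.
  move=> dz; rewrite mul1r (le_trans _ (gA z))// (le_trans _ (S2 z N dz))// ler_sum// => n _.
  by rewrite lerDl sqr_ge0.
(* This scaling puts A d_n between the same two end weights as d_n: the square sum of the T_n z is
   at most 4 |z|^2, and that of the 2^n T_n z at most |A z|^2. At 1/2 the weight becomes 2^n 4^-n =
   2^-n. *)
pose T n z := (2 ^- n)%:C%C *: A (d n z).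
have Tl n c y z : T n (c *: y + z) = c *: T n y + T n z.
  by rewrite /T dl (appZD A_lin)// scalerDr !scalerA mulrC.
have T2 n z : nrm (T n z) ^+ 2 = 4 * (4 ^- n.+1 * nrm (A (d n z)) ^+ 2).
  rewrite nrmZr exprMn mulrA tS real_normK ?num_real//; congr (_ * _).
  by rewrite exprVn -exprM mulnC exprM; congr (_ ^-1); congr (_ ^+ _); ring.
have [K2 K2P] : exists K, forall N, \sum_(n < N) 2 ^+ n * nrm (T n x) ^+ 2 <= K.
  apply: (interpolation_sum_le ipE (C := 4) _ g0 Tl _ _ xI) => // z N.
    rewrite (eq_bigr _ (fun (n : 'I_N) _ => T2 n z)) -mulr_sumr ler_pM2l//.
    by rewrite (le_trans _ (S1 z N))// ler_sum// => n _; rewrite lerDr sqr_ge0.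
  move=> dz; apply: (@le_trans _ _ (snorm (graph_space A) z ^+ 2)); last first.
    by have := sqr_ge0 (snorm (graph_space A) z); lra.
  rewrite (le_trans _ (gA z))// (le_trans _ (S2 z N dz))// ler_sum// => n _.
  rewrite /T nrmZr ger0_norm ?invr_ge0 ?exprn_ge0// mulrA mulfV ?mul1r ?expf_neq0//.
  by rewrite lerDr sqr_ge0.
(* The term [u 0 x] makes the partial sums equal to the resolvents; shifting the index by one costs
   the factor 2 in front of [K1]. *)
pose e n := if n is m.+1 then d m x else u 0 x.
exists e, (nrm (u 0 x) ^+ 2 + nrm (A (u 0 x)) ^+ 2 + 2 * `|K1| + `|K2|).
have n0 := sqr_ge0 (nrm (u 0 x)); have n1 := sqr_ge0 (nrm (A (u 0 x))).
have k1 := ler_norm K1; have k2 := ler_norm K2.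
have k1' := normr_ge0 K1; have k2' := normr_ge0 K2.
split.
- by case => [|n] /=.
- case=> [|N]; first by rewrite big_ord0; lra.
  rewrite big_ord_recl /= expr0 mul1r.
  rewrite (eq_bigr (fun i : 'I_N => 2 * (2 ^+ i * nrm (d i x) ^+ 2))) => [|i _].
    by rewrite -mulr_sumr; have := K1P N; lra.
  by rewrite /bump leq0n add1n add0n exprS mulrA.
- case=> [|N]; first by rewrite big_ord0; lra.
  rewrite big_ord_recl /= expr0 invr1 mul1r.
  rewrite (eq_bigr (fun i : 'I_N => 2 ^- i.+1 * nrm (A (d i x)) ^+ 2)) => [|i _]; last first.
    by rewrite /bump leq0n add1n add0n.
  have : \sum_(i < N) 2 ^- i.+1 * nrm (A (d i x)) ^+ 2 <= \sum_(i < N) 2 ^+ i * nrm (T i x) ^+ 2.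
    apply: ler_sum => i _; rewrite /T nrmZr exprMn real_normK ?num_real// [leRHS]mulrA.
    rewrite ler_wpM2r ?sqr_ge0// expr2 mulrA mulfV ?mul1r ?expf_neq0//.
    by rewrite lef_pV2 ?posrE ?exprn_gt0// ler_weXn2l// ler1n.
  by have := K2P N; lra.
- have uE n : \sum_(i < n.+1) e i = u n x.
    elim: n => [|n ih]; first by rewrite big_ord_recl big_ord0 addr0.
    by rewrite big_ord_recr /= ih /d addrC subrK.
  rewrite -cvg_shiftS /=; under eq_fun do rewrite uE.
  exact: cvg_sqresolvent.
Qed.

End Approximation.

(** * Bochner integrals *)

Section SimpleFunctions.
Context {R : realType}.
Implicit Types (T U : Type).

(** [simple_function] with values in an arbitrary type, so that sums and multiples of simple
    functions are images of pairs of them. *)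
Definition finite_fibred T (p : measurableTypeR R -> T) :=
  finite_set (range p) /\ forall y, measurable (p @^-1` [set y]).

Lemma finite_fibred_comp T U (p : measurableTypeR R -> T) (h : T -> U) :
  finite_fibred p -> finite_fibred (h \o p).
Proof.
move=> [fp mp]; split; first by rewrite -(image_comp p h); exact: finite_image fp.
move=> y; have -> : (h \o p) @^-1` [set y] =
    \bigcup_(x in range p `&` h @^-1` [set y]) (p @^-1` [set x]).
  rewrite eqEsubset; split=> t /=; first by move=> ht; exists (p t).
  by move=> [x [_ hx] /= ->].
apply: fin_bigcup_measurable => [|x _]; last exact: mp.
by apply: sub_finite_set fp; exact: subIsetl.
Qed.

Lemma finite_fibred_pair T U (p : measurableTypeR R -> T) (q : measurableTypeR R -> U) :
  finite_fibred p -> finite_fibred q -> finite_fibred (fun t => (p t, q t)).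
Proof.
move=> [fp mp] [fq mq]; split.
  apply: (@sub_finite_set _ _ (range p `*` range q)); last exact: finite_setX.
  by move=> _ [t _ <-]; split; exists t.
move=> [x y]; have -> : (fun t => (p t, q t)) @^-1` [set (x, y)] =
    p @^-1` [set x] `&` q @^-1` [set y].
  by rewrite eqEsubset; split=> t /= [-> ->].
exact: measurableI.
Qed.

(** Rounding down to the grid of mesh 1 / (n + 1), not a power of two. It fixes 0, so rounding does
    not enlarge supports. *)
Definition dyadic_floor (n : nat) (r : R) : R := (Num.floor (n.+1%:R * r))%:~R / n.+1%:R.

Lemma dyadic_floor0 n : dyadic_floor n 0 = 0.
Proof. by rewrite /dyadic_floor mulr0 floor0 mul0r. Qed.

Lemma dist_dyadic_floor n r : `|dyadic_floor n r - r| <= n.+1%:R^-1.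
Proof.
have n0 : 0 < n.+1%:R :> R by rewrite ltr0n.
have /andP[h1 h2] := floor_itv (n.+1%:R * r).
have -> : dyadic_floor n r - r = ((Num.floor (n.+1%:R * r))%:~R - n.+1%:R * r) / n.+1%:R.
  by rewrite /dyadic_floor; field; rewrite gt_eqF.
rewrite normrM [`|_^-1|]gtr0_norm ?invr_gt0// -[leRHS]mul1r ler_pM2r ?invr_gt0//.
by rewrite ler_norml; move: h2; rewrite intrD; lra.
Qed.

Lemma finite_fibred_dyadic_floor (f : R -> R) (M : R) n :
  measurable_fun setT (f : measurableTypeR R -> R) -> (forall t, `|f t| <= M) ->
  finite_fibred (fun t => dyadic_floor n (f t)).
Proof.
move=> mf fM; have n0 : 0 < n.+1%:R :> R by rewrite ltr0n.
apply: (@finite_fibred_comp _ _ (fun t => Num.floor (n.+1%:R * f t)) (fun k : int => k%:~R / n.+1%:R)).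
split.
  have [B BP] : exists B : nat, n.+1%:R * M < B%:R.
    by exists (Num.bound (n.+1%:R * M)); apply: archi_boundP; rewrite mulr_ge0// (le_trans _ (fM 0)).
  apply: (@sub_finite_set _ _ ((fun k : nat => k%:Z - B.+1%:Z) @` `I_(B.+1 + B.+1))).
    move=> _ [t _ <-] /=; set k := Num.floor _.
    have /andP[h1 h2] := floor_itv (n.+1%:R * f t); rewrite -/k in h1 h2.
    have : `|n.+1%:R * f t| <= n.+1%:R * M by rewrite normrM ger0_norm// ler_pM2l.
    rewrite ler_norml => /andP[h3 h4].
    have k1 : - B.+1%:Z <= k.
      rewrite -ltzD1 -(ltr_int R) (le_lt_trans _ h2)// intrN -pmulrn -natr1; lra.
    have k2 : k < B.+1%:Z by rewrite -(ltr_int R) (le_lt_trans h1)// -pmulrn -natr1; lra.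
    by exists (absz (k + B.+1%:Z)); lia.
  by apply: finite_image; exact: finite_II.
move=> k; rewrite (_ : _ @^-1` _ = f @^-1` `[k%:~R / n.+1%:R, (k + 1)%:~R / n.+1%:R[%classic).
  by rewrite -[X in measurable X]setTI; apply: mf => //; exact: measurable_itv.
rewrite eqEsubset; split=> t /=; rewrite in_itv /= ler_pdivrMr// ltr_pdivlMr// mulrC.
  by move=> <-; exact: floor_itv.
by move=> /floor_def.
Qed.

End SimpleFunctions.

Section BochnerIntegral.
Context {R : realType} (X : completeNormedModType R[i]) (ip : {dot X for Num.conj}).
Hypothesis ipE : forall x : X, `|x| ^+ 2 = ip x x.
Local Notation mu := (@lebesgue_measure R).
Variable D : set R.
Hypothesis mD : measurable (D : set (measurableTypeR R)).
Hypothesis D_fin : (mu D < +oo)%E.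

(** The integral of a nonnegative function is a supremum over the simple functions below it, hence
    monotone even for functions such as [nrm (f t - s n t)] whose measurability has not been
    established. *)
Lemma ge0_integral_le (f g : R -> \bar R) :
  (forall t, D t -> (0 <= f t <= g t)%E) ->
  (\int[mu]_(t in D) f t <= \int[mu]_(t in D) g t)%E.
Proof.
move=> fg; rewrite !ge0_integralE; last 2 first.
- by move=> t /fg /andP[/le_trans]; exact.
- by move=> t /fg /andP[].
apply: le_ereal_sup => _ [h /= hf <-]; exists h => //= t.
apply: le_trans (hf t) _; rewrite /patch; case: ifPn => //.
by rewrite inE => /fg /andP[].
Qed.

Lemma bounded_integrable (f : R -> R) (M : R) :
  measurable_fun setT (f : measurableTypeR R -> R) -> (forall t, `|f t| <= M) ->
  mu.-integrable D (EFin \o f).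
Proof.
move=> mf fM; apply: measurable_bounded_integrable => //.
  exact: measurable_funTS.
exists M; split; first exact: num_real.
by move=> M' MM' t _; apply: le_trans (fM t) (ltW MM').
Qed.

Lemma Rintegral_sum_indic (I : eqType) (r : seq I) (c : I -> R) (E : I -> set R) :
  (forall i, measurable (E i : set (measurableTypeR R))) ->
  mu.-integrable D (EFin \o (fun t => \sum_(i <- r) c i * \1_(E i) t)) /\
  (\int[mu]_(t in D) (\sum_(i <- r) c i * \1_(E i) t))%R =
    \sum_(i <- r) c i * fine (mu (D `&` E i)).
Proof.
move=> mE; elim: r => [|i r [ih1 ih2]].
  rewrite big_nil; under eq_fun do rewrite big_nil.
  by split; [exact: integrable0|rewrite Rintegral_cst// mul0r].
have i1 : mu.-integrable D (EFin \o \1_(E i)).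
  apply: (@bounded_integrable _ 1); first exact: measurable_indic.
  by move=> t; rewrite indicE; case: (_ \in _); rewrite ?normr1 ?normr0.
have i2 : mu.-integrable D (EFin \o (fun t => c i * \1_(E i) t)).
  by have := integrableZl mD (c i) i1; apply: eq_integrable.
rewrite big_cons; under [X in EFin \o X]eq_fun do rewrite big_cons.
under [X in Rintegral _ _ X]eq_fun do rewrite big_cons.
split; first by have := integrableD mD i2 ih1; apply: eq_integrable.
rewrite RintegralD// ih2 RintegralZl//; congr (_ * _ + _).
by rewrite /Rintegral integral_indic// setIC.
Qed.

Lemma rip_sum (I : Type) (r : seq I) (F : I -> X) w :
  rip ip (\sum_(i <- r) F i) w = \sum_(i <- r) rip ip (F i) w.
Proof.
elim: r => [|i r ih]; first by rewrite !big_nil /rip linear0l.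
by rewrite !big_cons ripDl ih.
Qed.

Lemma rip_simple_integral (s : R -> X) w : simple_function s ->
  mu.-integrable D (EFin \o (fun t => rip ip (s t) w)) /\
  rip ip (simple_integral D s) w = (\int[mu]_(t in D) rip ip (s t) w)%R.
Proof.
move=> [fs ms]; have [r ur rE] : exists2 r : seq X, uniq r & range s = [set` r].
  have /finite_seqP[r rE] := fs; exists (undup r); first exact: undup_uniq.
  by rewrite rE; apply/seteqP; split=> x /=; rewrite mem_undup.
have sE t : rip ip (s t) w = \sum_(x <- r) rip ip x w * \1_(s @^-1` [set x]) t.
  have sr : s t \in r by have : range s (s t) by [exists t]; rewrite rE.
  rewrite (bigD1_seq (s t))//= indicE mem_set// mulr1 big1 ?addr0// => x xs.
  by rewrite indicE memNset ?mulr0//= => /esym/eqP; apply/negP.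
have [i1 i2] := @Rintegral_sum_indic _ r (fun x => rip ip x w) (fun x => s @^-1` [set x]) ms.
split; first by apply: eq_integrable i1 => // t _ /=; rewrite sE.
under eq_fun do rewrite sE.
rewrite i2 /simple_integral (@fsbigE _ _ _ _ _ r)//= => [|x _ xr].
  under eq_bigl do rewrite in_setT.
  by rewrite rip_sum; apply: eq_bigr => x _; rewrite ripZl mulrC.
rewrite (_ : s @^-1` [set x] = set0); first by rewrite setI0 measure0 scale0r.
rewrite -subset0 => t /= sx; have : range s x by exists t.
by rewrite rE /= => xr'; move: xr; rewrite xr'.
Qed.

Lemma cvg_divn (C : R) : C / n.+1%:R @[n --> \oo] --> (0 : R).
Proof. by rewrite -(mulr0 C); apply: cvgMr; exact: cvg_harmonic. Qed.

(** Uniform approximation by simple functions gives convergence of their integrals once the limit is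
    identified, and scalar products with arbitrary [w] identify it. *)
Lemma bochner_integral_uniform (f : R -> X) (Y : X) (s : nat -> R -> X) (C : R) :
  (forall n, simple_function (s n)) ->
  (forall n t, nrm (f t - s n t) <= C / n.+1%:R) ->
  (forall w, mu.-integrable D (EFin \o (fun t => rip ip (f t) w)) /\
    (\int[mu]_(t in D) rip ip (f t) w)%R = rip ip Y w) ->
  bochner_integral D f Y.
Proof.
move=> ss fs fY; have C0 : 0 <= C.
  by have := le_trans (nrm_ge0 _) (fs 0 0); rewrite divr1.
have Dm : 0 <= fine (mu D) by rewrite fine_ge0.
split.
  exists s; split; first by move=> n; split.
  apply: aeW => t _; apply: (@squeeze_cvgr _ _ _ _ (fun=> 0) (fun n => C / n.+1%:R)).
  - by apply: nearW => n /=; rewrite nrm_ge0 nrm_distC fs.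
  - exact: cvg_cst.
  - exact: cvg_divn.
exists s; split => //.
- apply: (@squeeze_cvge _ _ _ _ (fun=> 0%E) _ (fun n => ((C * fine (mu D)) / n.+1%:R)%:E)).
  + apply: nearW => n; apply/andP; split.
      by apply: integral_ge0 => t _; rewrite lee_fin nrm_ge0.
    apply: (@le_trans _ _ (\int[mu]_(t in D) (C / n.+1%:R)%:E)%E).
      by apply: ge0_integral_le => t _; rewrite !lee_fin nrm_ge0 fs.
    have /fineK muD : mu D \is a fin_num by rewrite ge0_fin_numE.
    rewrite integral_cst//= (_ : C * _ / _ = C / n.+1%:R * fine (mu D)); last by ring.
    suff -> : (C / n.+1%:R * fine (mu D))%:E = ((C / n.+1%:R)%:E * mu D)%E by [].
    by rewrite -{2}muD.
  + exact: cvg_cst.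
  + by apply: cvg_EFin; [exact: nearW|exact: cvg_divn].
- apply/cvg_nrmP => e e0; have := cvg_divn (C * fine (mu D)).
  move=> /cvgrPdist_lt/(_ e e0); apply: filterS => n; rewrite sub0r normrN.
  move=> /(le_lt_trans (ler_norm _)); apply: le_lt_trans.
  (* Testing with the error [w] itself: |w|^2 is the integral of <f - s_n, w>, at most C / (n + 1)
     times the measure of [D] times |w|. *)
  set w := Y - _; have [w0|w0] := eqVneq (nrm w) 0.
    by rewrite w0 divr_ge0// mulr_ge0.
  have wp : 0 < nrm w by rewrite lt_neqAle eq_sym w0 nrm_ge0.
  rewrite -(ler_pM2r wp) -expr2 -(rip_nrm ipE) {1}/w ripBl.
  have [i1 <-] := fY w; have [i2 ->] := rip_simple_integral w (ss n).
  rewrite -RintegralB// (le_trans (ler_norm _))//.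
  have i3 : mu.-integrable D (EFin \o (fun t => rip ip (f t) w - rip ip (s n t) w)).
    by have := integrableB mD i1 i2; apply: eq_integrable.
  rewrite (le_trans (le_normr_Rintegral mD i3))//.
  have -> : C * fine (mu D) / n.+1%:R * nrm w = (\int[mu]_(t in D) (C / n.+1%:R * nrm w))%R.
    by rewrite Rintegral_cst//; ring.
  apply: le_Rintegral => //.
  + by have := integrable_norm i3; apply: eq_integrable.
  + exact: (@bounded_integrable _ `|C / n.+1%:R * nrm w|).
  move=> t _; rewrite -ripBl; apply: (@le_trans _ _ (nrm (f t - s n t) * nrm w)).
    rewrite ler_norml (rip_le_nrm ipE) andbT lerNl -ripNl -[nrm (f t - _)]nrmN.
    exact: (rip_le_nrm ipE).
  by rewrite ler_pM2r.
Qed.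

Lemma finite_fibred_sum (N : nat) (s : nat -> R -> X) :
  (forall i, finite_fibred (s i)) -> finite_fibred (fun t => \sum_(i < N) s i t).
Proof.
move=> fs; elim: N => [|N ih].
  under eq_fun do rewrite big_ord0; split.
    by apply: (@sub_finite_set _ _ [set 0]) => // _ [t _ <-].
  move=> y; have [->|y0] := eqVneq y 0.
    by rewrite (_ : _ @^-1` _ = setT)//; apply/seteqP; split.
  rewrite (_ : _ @^-1` _ = set0)//; rewrite -subset0 => t /= yE.
  by move: y0; rewrite -yE eqxx.
under eq_fun do rewrite big_ord_recr.
exact: (finite_fibred_comp (fun p => p.1 + p.2) (finite_fibred_pair ih (fs N))).
Qed.

Lemma bochner_integral_sum (N : nat) (phi : nat -> R -> R) (M : nat -> R) (d : nat -> X) :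
  (forall i, measurable_fun setT (phi i : measurableTypeR R -> R)) ->
  (forall i t, `|phi i t| <= M i) ->
  bochner_integral D (fun t => \sum_(i < N) (phi i t)%:C%C *: d i)
    (\sum_(i < N) (\int[mu]_(t in D) phi i t)%R%:C%C *: d i).
Proof.
move=> mphi phiM.
apply: (@bochner_integral_uniform _ _
  (fun n t => \sum_(i < N) (dyadic_floor n (phi i t))%:C%C *: d i)
  (\sum_(i < N) nrm (d i))).
- move=> n; apply: (@finite_fibred_sum N (fun i t => (dyadic_floor n (phi i t))%:C%C *: d i)) => i.
  exact: (finite_fibred_comp (fun r : R => r%:C%C *: d i) (finite_fibred_dyadic_floor n (mphi i) (phiM i))).
- move=> n t; rewrite -sumrB (le_trans (nrm_sum _ _ _))// mulr_suml ler_sum// => i _.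
  rewrite -scalerBl -rmorphB nrmZr mulrC ler_wpM2l ?nrm_ge0// distrC.
  exact: dist_dyadic_floor.
- move=> w; elim: N => [|N [i1 i2]].
    rewrite big_ord0; under eq_fun do rewrite big_ord0 /rip linear0l.
    split; first exact: integrable0.
    by rewrite /rip linear0l Rintegral_cst// mul0r.
  have rS t : rip ip (\sum_(i < N.+1) (phi i t)%:C%C *: d i) w =
      rip ip (\sum_(i < N) (phi i t)%:C%C *: d i) w + rip ip (d N) w * phi N t.
    by rewrite big_ord_recr /= ripDl ripZl [_ * phi _ _]mulrC.
  have j1 : mu.-integrable D (EFin \o phi N) by exact: bounded_integrable (mphi N) (phiM N).
  have j2 : mu.-integrable D (EFin \o (fun t => rip ip (d N) w * phi N t)).
    by have := integrableZl mD (rip ip (d N) w) j1; apply: eq_integrable.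
  split.
    by have := integrableD mD i1 j2; apply: eq_integrable => // t _ /=; rewrite rS.
  under eq_fun do rewrite rS.
  by rewrite RintegralD// i2 RintegralZl// big_ord_recr /= ripDl ripZl mulrC.
Qed.

End BochnerIntegral.

(** * Functions with a prescribed trace *)

Section Smoothstep.
Context {R : realType}.
Implicit Types (r t : R).

Local Notation pos r := (Num.max 0 (r : R)).

(** The quadratic spline that is 0 up to 0, 2 r^2 up to 1/2, 1 - 2 (1 - r)^2 up to 1, and 1 from
    there on. It is continuously differentiable, as the integration by parts demands. *)
Definition smoothstep r : R :=
  2 * pos r ^+ 2 - 4 * pos (r - 2^-1) ^+ 2 + 2 * pos (r - 1) ^+ 2.

Definition smoothstep_derive r : R := 4 * pos r - 8 * pos (r - 2^-1) + 4 * pos (r - 1).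

Lemma posP r : (r <= 0 /\ pos r = 0) \/ (0 <= r /\ pos r = r).
Proof.
by case: (leP 0 r) => r0; [right|left; split=> //; exact: ltW].
Qed.

Lemma smoothstep_le0 r : r <= 0 -> smoothstep r = 0 /\ smoothstep_derive r = 0.
Proof.
rewrite /smoothstep /smoothstep_derive.
by case: (posP r) (posP (r - 2^-1)) (posP (r - 1)) => -[? ->] [] [? ->] [] [? ->] ?; split; nra.
Qed.

Lemma smoothstep_ge1 r : 1 <= r -> smoothstep r = 1 /\ smoothstep_derive r = 0.
Proof.
rewrite /smoothstep /smoothstep_derive.
by case: (posP r) (posP (r - 2^-1)) (posP (r - 1)) => -[? ->] [] [? ->] [] [? ->] ?; split; nra.
Qed.

Lemma normr_smoothstep r : `|smoothstep r| <= 1.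
Proof.
rewrite /smoothstep ler_norml; apply/andP.
by case: (posP r) (posP (r - 2^-1)) (posP (r - 1)) => -[? ->] [] [? ->] [] [? ->]; split; nra.
Qed.

Lemma normr_smoothstep_derive r : `|smoothstep_derive r| <= 2.
Proof.
rewrite /smoothstep_derive ler_norml; apply/andP.
by case: (posP r) (posP (r - 2^-1)) (posP (r - 1)) => -[? ->] [] [? ->] [] [? ->]; split; lra.
Qed.

Lemma pos_sqr_increment r t : `|pos (r + t) ^+ 2 - pos r ^+ 2 - 2 * pos r * t| <= t ^+ 2.
Proof.
rewrite ler_norml; apply/andP.
by case: (posP (r + t)) (posP r) => -[? ->] [] [? ->]; split; nra.
Qed.

Lemma is_derive_smoothstep r : is_derive r (1 : R) smoothstep (smoothstep_derive r).
Proof.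
(* 8 = 2 + 4 + 2, the coefficients of the three squares, each with an error of at most t^2. *)
apply: is_derive_little_o => e e0; exists (e / 8); first by rewrite divr_gt0.
move=> t te; rewrite /smoothstep /smoothstep_derive.
have := pos_sqr_increment r t; have := pos_sqr_increment (r - 2^-1) t.
have := pos_sqr_increment (r - 1) t; rewrite !(addrAC r _ t).
move: (pos (r + t)) (pos r) (pos (r + t - 2^-1)) (pos (r - 2^-1)) (pos (r + t - 1)) (pos (r - 1)).
move=> p0 q0 p1 q1 p2 q2; rewrite !ler_norml => /andP[? ?] /andP[? ?] /andP[? ?].
have : 8 * t ^+ 2 <= e * `|t|.
  by rewrite -(real_normK (num_real t)) expr2 mulrA ler_wpM2r//; lra.
by move=> ?; apply/andP; split; lra.
Qed.

Lemma continuous_smoothstep_derive : continuous smoothstep_derive.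
Proof.
move=> r; apply/cvgrPdist_lt => e e0; apply/nbhs_ballP; exists (e / 16) => /=.
  by rewrite divr_gt0.
move=> s; rewrite /ball /= => rs; apply: (@le_lt_trans _ _ (16 * `|r - s|)); last by lra.
have pB x y : `|pos x - pos y| <= `|x - y|.
  rewrite ler_norml; apply/andP; have := ler_norm (x - y); have := ler_norm (y - x).
  rewrite distrC; move: `|_| => d ? ?.
  by case: (posP x) (posP y) => -[? ->] [] [? ->]; split; lra.
have := pB r s; have := pB (r - 2^-1) (s - 2^-1); have := pB (r - 1) (s - 1).
rewrite (_ : r - 1 - (s - 1) = r - s); last by ring.
rewrite (_ : r - 2^-1 - (s - 2^-1) = r - s); last by ring.
rewrite /smoothstep_derive !ler_norml => /andP[? ?] /andP[? ?] /andP[? ?].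
by apply/andP; split; lra.
Qed.

End Smoothstep.

(** * Cutoffs and dyadic layers at one end of the interval *)

Section Cutoff.
Context {R : realType} (rev : bool) (a : R).
Hypothesis a0 : 0 < a.
Implicit Types (t : R) (m n N : nat).

(** The end in question, where the value will be prescribed, is [a] if [rev] holds and 0
    otherwise. *)
Definition end_dist t : R := if rev then a - t else t.

(** The affine argument is 1 at distance a / 2^(m+1) from the end and 0 at distance a / 2^m, so the
    cutoff varies on [layer m] only. *)
Definition cutoff m t : R := smoothstep (2 - 2 ^+ m.+1 / a * end_dist t).

Definition cutoff_derive m t : R :=
  smoothstep_derive (2 - 2 ^+ m.+1 / a * end_dist t) * (2 ^+ m.+1 / a * (-1) ^+ ~~ rev).

Lemma is_derive_cutoff m t : is_derive t (1 : R) (cutoff m) (cutoff_derive m t).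
Proof.
have inner : is_derive t (1 : R) (fun t => 2 - 2 ^+ m.+1 / a * end_dist t)
    (2 ^+ m.+1 / a * (-1) ^+ ~~ rev).
  apply: is_derive_little_o => e e0; exists 1 => // s _.
  rewrite (_ : _ - _ = 0); first by rewrite normr0 mulr_ge0// ltW.
  by rewrite /end_dist; case: rev => /=; ring.
exact: (@is_derive1_comp _ smoothstep _ t _ _ (is_derive_smoothstep _) inner).
Qed.

Lemma continuous_cutoff m : continuous (cutoff m).
Proof. by move=> t; exact: is_derive_continuous (is_derive_cutoff m t). Qed.

Lemma continuous_cutoff_derive m : continuous (cutoff_derive m).
Proof.
move=> t; apply: cvgMl; apply: (@continuous_comp _ _ _ (fun t => 2 - 2 ^+ m.+1 / a * end_dist t)).
  apply: cvgB; first exact: cvg_cst.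
  apply: cvgMr; rewrite /end_dist; case: rev; last exact: cvg_id.
  by apply: cvgB; [exact: cvg_cst|exact: cvg_id].
exact: continuous_smoothstep_derive.
Qed.

Lemma normr_cutoff m t : `|cutoff m t| <= 1.
Proof. exact: normr_smoothstep. Qed.

Lemma normr_cutoff_derive m t : `|cutoff_derive m t| <= 2 ^+ m.+2 / a.
Proof.
rewrite normrM normrM normrX normrN1 expr1n mulr1 [`|_ / a|]ger0_norm; last first.
  by rewrite divr_ge0 ?exprn_ge0// ltW.
rewrite [2 ^+ m.+2]exprS -(mulrA 2) ler_wpM2r ?normr_smoothstep_derive//.
by rewrite divr_ge0 ?exprn_ge0// ltW.
Qed.

Lemma cutoff_far m t : a / 2 ^+ m <= end_dist t -> cutoff m t = 0 /\ cutoff_derive m t = 0.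
Proof.
rewrite ler_pdivrMr ?exprn_gt0// => h.
have [|h1 h2] := @smoothstep_le0 R (2 - 2 ^+ m.+1 / a * end_dist t).
  by rewrite subr_le0 mulrAC ler_pdivlMr// exprS -mulrA ler_pM2l// mulrC.
by rewrite /cutoff /cutoff_derive h1 h2 mul0r.
Qed.

Lemma cutoff_close m t : end_dist t <= a / 2 ^+ m.+1 -> cutoff m t = 1 /\ cutoff_derive m t = 0.
Proof.
rewrite ler_pdivlMr ?exprn_gt0// => h.
have [|h1 h2] := @smoothstep_ge1 R (2 - 2 ^+ m.+1 / a * end_dist t).
  by rewrite lerBrDr -lerBrDl mulrAC ler_pdivrMr// mulrC; lra.
by rewrite /cutoff /cutoff_derive h1 h2 mul0r.
Qed.

Definition layer n : set R := [set t | a / 2 ^+ n.+1 < end_dist t <= a / 2 ^+ n].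

Lemma layerE n : layer n = if rev then `[a - a / 2 ^+ n, a - a / 2 ^+ n.+1[%classic
  else `]a / 2 ^+ n.+1, a / 2 ^+ n]%classic.
Proof.
rewrite /layer /end_dist; case: rev; rewrite eqEsubset; split=> t /=;
  by rewrite in_itv /= => /andP[? ?]; apply/andP; split; lra.
Qed.

Lemma measurable_layer n : measurable (layer n : set (measurableTypeR R)).
Proof. by rewrite layerE; case: rev; exact: measurable_itv. Qed.

Lemma lebesgue_measure_layer n : (lebesgue_measure (layer n) <= (a / 2 ^+ n)%:E)%E.
Proof.
have h : a / 2 ^+ n = 2 * (a / 2 ^+ n.+1) by rewrite exprS; field; rewrite expf_neq0.
have h0 : 0 < a / 2 ^+ n.+1 by rewrite divr_gt0// exprn_gt0.
rewrite layerE; case: rev; rewrite lebesgue_measure_itv /= lte_fin -EFinB ifT ?lee_fin; lra.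
Qed.

Lemma layer_exists t : 0 < end_dist t <= a -> exists n, layer n t.
Proof.
move=> /andP[t0 ta]; have [N NP] := exists_lt_exp2 (a / end_dist t).
have {}NP : a / 2 ^+ N < end_dist t.
  by move: NP; rewrite ltr_pdivrMr// ltr_pdivrMr ?exprn_gt0// mulrC.
elim: N NP => [|N ih] NP; first by move: NP; rewrite divr1 ltNge ta.
have [h|h] := leP (end_dist t) (a / 2 ^+ N); last exact: ih.
by exists N; apply/andP.
Qed.

Lemma end_dist_time_interval t : time_interval a t -> 0 < end_dist t < a.
Proof. by rewrite /time_interval /end_dist /= in_itv /= => /andP[? ?]; case: rev; apply/andP; split; lra. Qed.

(** The function is dominated by the sum of [c n] times the indicator of the n-th layer, which is
    measurable and has integral at most a times the sum of 2^-n c_n. *)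
Lemma integral_layers_lty (h c : _ -> R) (K : R) :
  (forall t, 0 <= h t) -> (forall n : nat, 0 <= c n) ->
  (forall n t, layer n t -> h t <= c n) -> (forall N, \sum_(n < N) 2 ^- n * c n <= K) ->
  (\int[lebesgue_measure]_(t in time_interval a) (h t)%:E < +oo)%E.
Proof.
move=> h0 c0 hc cK.
pose g n t : \bar R := (c n * \1_(layer n) t)%:E.
have g0 n t : (0 <= g n t)%E by rewrite lee_fin mulr_ge0// indicE.
apply: (@le_lt_trans _ _ (\int[lebesgue_measure]_(t in time_interval a) \sum_(n <oo) g n t)%E).
  apply: ge0_integral_le => t /end_dist_time_interval /andP[t0 ta].
  rewrite lee_fin h0 /=; have [|n tn] := @layer_exists t; first by rewrite t0 ltW.
  apply: (@le_trans _ _ (\sum_(0 <= i < n.+1) g i t)%E); last exact: nneseries_lim_ge.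
  apply: (@le_trans _ _ (g n t)).
    by rewrite lee_fin indicE mem_set// mulr1; exact: hc.
  by rewrite big_nat_recr//= leeDr// sume_ge0.
have mI : measurable (time_interval a : set (measurableTypeR R)) by exact: measurable_itv.
rewrite integral_nneseries//; last first.
  move=> n; apply/measurable_EFinP; apply: measurable_funM; first exact: measurable_cst.
  by apply: measurable_funTS; exact: measurable_indic (measurable_layer n).
apply: (@le_lt_trans _ _ (a * K)%:E); last exact: ltry.
have gE n : (\int[lebesgue_measure]_(t in time_interval a) g n t <= (a * (2 ^- n * c n))%:E)%E.
  rewrite /g; under eq_integral do rewrite EFinM.
  rewrite ge0_integralZl_EFin//; last first.
    by apply/measurable_EFinP; apply: measurable_funTS; exact: measurable_indic (measurable_layer n).
  rewrite integral_indic//; last exact: measurable_layer.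
  rewrite mulrA EFinM muleC lee_wpmul2r ?lee_fin//.
  apply: le_trans (lebesgue_measure_layer n).
  by apply: measureIl => //; exact: measurable_layer.
apply: lime_le; first by apply: is_cvg_nneseries => n _ _; apply: integral_ge0 => t _; exact: g0.
apply: nearW => N; rewrite big_mkord.
apply: (@le_trans _ _ (\sum_(n < N) (a * (2 ^- n * c n))%:E)%E); first exact: lee_sum.
by rewrite sumEFin lee_fin -mulr_sumr ler_pM2l.
Qed.

End Cutoff.

(** * Sums with infinitely many terms at the end point and finitely many at each interior point *)

Section LayerSum.
Context {R : realType} (X : completeNormedModType R[i]) (rev : bool) (a : R).
Hypothesis a0 : 0 < a.
Local Notation dist := (end_dist rev a).
Implicit Types (phi : nat -> R -> R) (d : nat -> X) (t : R) (Y : normed_subspace X).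

Definition layer_sum phi d t : X := lim (\sum_(m < N) (phi m t)%:C%C *: d m @[N --> \oo]).

Definition vanishes_far phi := forall m t, a / 2 ^+ m <= dist t -> phi m t = 0.

Lemma ler_layer m n : (m <= n)%N -> a / 2 ^+ n <= a / 2 ^+ m.
Proof.
by move=> mn; rewrite ler_pM2l// lef_pV2 ?posrE ?exprn_gt0// ler_weXn2l// ler1n.
Qed.

Lemma sum_vanishes_far phi d N k t : vanishes_far phi -> a / 2 ^+ N <= dist t -> (N <= k)%N ->
  \sum_(m < k) (phi m t)%:C%C *: d m = \sum_(m < N) (phi m t)%:C%C *: d m.
Proof.
move=> far Nt Nk; rewrite -!(big_mkord xpredT (fun m => (phi m t)%:C%C *: d m)).
rewrite (@big_cat_nat _ _ _ N)//= [X in _ + X]big_nat_cond [X in _ + X]big1 ?addr0// => m.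
rewrite andbT => /andP[Nm _]; rewrite far ?scale0r//.
exact: le_trans (ler_layer Nm) Nt.
Qed.

Lemma lim_normedE (u : nat -> X) (l : X) : u n @[n --> \oo] --> l -> lim (u n @[n --> \oo]) = l.
Proof. by move=> ul; apply: cvg_lim => //; exact: norm_hausdorff. Qed.

Lemma layer_sumE phi d N t : vanishes_far phi -> a / 2 ^+ N <= dist t ->
  layer_sum phi d t = \sum_(m < N) (phi m t)%:C%C *: d m.
Proof.
move=> far Nt; apply: lim_normedE; apply: cvg_near_cst.
by exists N => // k /= Nk; rewrite (sum_vanishes_far d far Nt Nk).
Qed.

(** What the norms of [X] and of the graph space share, so that measurability and square
    integrability are proved once for both. *)
Record compatible_norm Y : Prop := CompatibleNorm {
  compatible0 : Y 0;
  compatibleZD : forall c x y, Y x -> Y y -> Y (c *: x + y);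
  snorm_ge0 : forall x, 0 <= snorm Y x;
  snorm0 : snorm Y 0 = 0;
  snormZD : forall (r : R) x y, Y x -> Y y ->
    snorm Y (r%:C%C *: x + y) <= `|r| * snorm Y x + snorm Y y }.

Lemma compatible_whole_space : compatible_norm (whole_space X).
Proof.
split=> //= [x||r x y _ _]; [exact: nrm_ge0|exact: nrm0|].
by rewrite (le_trans (nrmD _ _))// nrmZr.
Qed.

Lemma compatible_graph_space (A : operator X) : linear_operator A ->
  compatible_norm (graph_space A).
Proof.
move=> A_lin; split=> /= [|c x y|x||r x y dx dy].
- exact: dom0.
- exact: domZD.
- by rewrite addr_ge0 ?nrm_ge0.
- by rewrite (app0 A_lin) nrm0 addr0.
rewrite (appZD A_lin)// mulrDr addrACA lerD// (le_trans (nrmD _ _))// nrmZr//.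
Qed.

Lemma snorm_sum Y N (c : nat -> R) d : compatible_norm Y -> (forall m, Y (d m)) ->
  Y (\sum_(m < N) (c m)%:C%C *: d m) /\
  snorm Y (\sum_(m < N) (c m)%:C%C *: d m) <= \sum_(m < N) `|c m| * snorm Y (d m).
Proof.
move=> cY dY; elim: N => [|N [ih1 ih2]].
  by rewrite !big_ord0 snorm0//; split; [exact: compatible0|].
rewrite !big_ord_recr /= addrC [leRHS]addrC; split; first exact: compatibleZD.
by rewrite (le_trans (snormZD cY _ _ _))// lerD2l.
Qed.

(** Only the scalar coefficients are rounded. At a given interior time finitely many terms survive,
    so the error is a constant depending on the time, divided by k + 1. *)
Lemma strongly_measurable_layer_sum Y phi (M : nat -> R) d : compatible_norm Y ->
  (forall m, measurable_fun setT (phi m : measurableTypeR R -> R)) ->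
  (forall m t, `|phi m t| <= M m) -> vanishes_far phi -> (forall m, Y (d m)) ->
  strongly_measurable Y (time_interval a) (layer_sum phi d).
Proof.
move=> cY mphi phiM far dY.
exists (fun k t => \sum_(m < k) (dyadic_floor k (phi m t))%:C%C *: d m); split.
  move=> k; split; last by move=> t; have [] := snorm_sum k (fun m => dyadic_floor k (phi m t)) cY dY.
  apply: (@finite_fibred_sum _ _ k (fun m t => (dyadic_floor k (phi m t))%:C%C *: d m)) => m.
  exact: (finite_fibred_comp (fun r : R => r%:C%C *: d m)
    (finite_fibred_dyadic_floor k (mphi m) (phiM m))).
apply: aeW => t /(@end_dist_time_interval _ rev)/andP[t0 ta].
have [n /andP[/ltW nt _]] : exists n, layer rev a n t by apply: layer_exists; rewrite // t0 ltW.
pose C := \sum_(m < n.+1) snorm Y (d m).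
apply: (@squeeze_cvgr _ _ _ _ (fun=> 0) (fun k => C / k.+1%:R)).
- exists n.+1 => // k /= nk; rewrite snorm_ge0//=.
  rewrite (layer_sumE d far nt).
  rewrite (@sum_vanishes_far (fun m t => dyadic_floor k (phi m t)) d n.+1 k)//; last first.
    by move=> m s ms; rewrite far// dyadic_floor0.
  rewrite -sumrB; under eq_bigr do rewrite -scalerBl -rmorphB.
  have [_ h] := snorm_sum n.+1 (fun m => dyadic_floor k (phi m t) - phi m t) cY dY.
  rewrite (le_trans h)// mulr_suml ler_sum// => m _.
  by rewrite mulrC ler_wpM2l ?snorm_ge0// dist_dyadic_floor.
- exact: cvg_cst.
- exact: cvg_divn.
Qed.

Lemma strongly_measurable_sub (f g : R -> X) D :
  strongly_measurable (whole_space X) D f -> strongly_measurable (whole_space X) D g ->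
  strongly_measurable (whole_space X) D (fun t => f t - g t).
Proof.
move=> [s [ss sf]] [r [rs rg]]; exists (fun n t => s n t - r n t); split=> [n|].
  split=> //; have [h1 _] := ss n; have [h2 _] := rs n.
  exact: (finite_fibred_comp (fun p => p.1 - p.2) (finite_fibred_pair h1 h2)).
apply: (@filterS2 _ _ (ae_filter_ringOfSetsType _) _ _ _ _ sf rg) => t {}sf {}rg Dt.
apply: (@squeeze_cvgr _ _ _ _ (fun=> 0) (fun n => nrm (s n t - f t) + nrm (r n t - g t))).
- apply: nearW => n; rewrite nrm_ge0 /= (_ : _ - _ = (s n t - f t) - (r n t - g t)) ?nrmB//.
  by rewrite !opprB -!addrA; congr (_ + _); rewrite addrCA [RHS]addrCA [- r n t + _]addrC.
- exact: cvg_cst.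
- by rewrite -[0](addr0 0); apply: cvgD; [exact: sf|exact: rg].
Qed.

Lemma L2_layers Y (w : R -> X) (c : nat -> R) (K : R) : compatible_norm Y ->
  (forall t, time_interval a t -> Y (w t)) ->
  strongly_measurable Y (time_interval a) w -> (forall n, 0 <= c n) ->
  (forall n t, layer rev a n t -> snorm Y (w t) ^+ 2 <= c n) ->
  (forall N, \sum_(n < N) 2 ^- n * c n <= K) -> L2 Y a w.
Proof.
move=> cY wY mw c0 wc cK; split=> //; first exact: aeW.
by apply: (integral_layers_lty a0 _ c0 wc cK) => t; exact: sqr_ge0.
Qed.

End LayerSum.

Section WeakDerivative.
Context {R : realType} (X : completeNormedModType R[i]) (ip : {dot X for Num.conj}).
Hypothesis ipE : forall x : X, `|x| ^+ 2 = ip x x.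
Local Notation mu := (@lebesgue_measure R).

Lemma bounded_of_support (g : R -> R) (c d : R) : continuous g ->
  (forall t, t \notin `[c, d] -> g t = 0) -> exists M, forall t, `|g t| <= M.
Proof.
move=> cg g0; have [cd|dc] := leP c d; last first.
  exists 0 => t; rewrite g0 ?normr0// in_itv /=; apply/negP => /andP[ct td].
  by have := le_trans ct td; rewrite leNgt dc.
have cn : {within `[c, d], continuous (fun t => `|g t|)}.
  by apply: continuous_subspaceT => t; apply: (@continuous_comp _ _ _ g Num.norm); [exact: cg|exact: norm_continuous].
have [s sI sP] := EVT_max cd cn; exists `|g s| => t.
by have [/sP//|/g0->] := boolP (t \in `[c, d]); rewrite normr0.
Qed.

Lemma Rintegral_oo_cc (g : R -> R) (a : R) : continuous g ->
  (\int[mu]_(t in time_interval a) g t)%R = (\int[mu]_(t in `[0%R, a]) g t)%R.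
Proof.
move=> cg; have ig : mu.-integrable `[0, a] (EFin \o g).
  apply: continuous_compact_integrable; first exact: segment_compact.
  exact: continuous_subspaceT.
rewrite /time_interval Rintegral_itv_obnd_cbnd.
  apply: Rintegral_itv_bndo_bndc.
  by apply: integrableS ig => //; apply: subset_itv_co_cc.
by apply: integrableS ig => //; apply: subset_itv_oo_cc.
Qed.

Lemma derive_support (eta : R -> R) (c d : R) :
  (forall t, t \notin `[c, d] -> eta t = 0) ->
  forall t, t \notin `[c, d] -> (eta^`())%classic t = 0.
Proof.
move=> eta0 t tcd; rewrite derive1E (@near_eq_derive _ _ _ eta (cst 0)) ?derive_cst//.
have op : open (~` `[c, d]%classic) by apply: closed_openC; exact: itv_closed.
have : nbhs t (~` `[c, d]%classic) by apply: open_nbhs_nbhs; split=> //=; exact/negP.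
by apply: filterS => s /= /negP/eta0.
Qed.

Lemma Rintegral_by_parts_support (eta deta phi dphi : R -> R) (a : R) : 0 < a ->
  (forall t, is_derive t (1 : R) eta (deta t)) -> (forall t, is_derive t (1 : R) phi (dphi t)) ->
  continuous deta -> continuous dphi -> eta 0 = 0 -> eta a = 0 ->
  (\int[mu]_(t in time_interval a) (deta t * phi t))%R =
  - (\int[mu]_(t in time_interval a) (eta t * dphi t))%R.
Proof.
move=> a0 etaD phiD cdeta cdphi eta0 etaa.
have ceta : continuous eta by move=> t; exact: is_derive_continuous (etaD t).
have cphi : continuous phi by move=> t; exact: is_derive_continuous (phiD t).
have cM (f g : R -> R) : continuous f -> continuous g -> continuous (fun t => f t * g t).
  by move=> cf cg t; apply: cvgM; [exact: cf|exact: cg].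
have LR (f df : R -> R) : (forall t, is_derive t (1 : R) f (df t)) ->
    derivable_oo_LRcontinuous f 0 a /\ {in `]0, a[, (f^`())%classic =1 df}.
  move=> fdf; have cf t : {for t, continuous f} := is_derive_continuous (fdf t).
  split; last by move=> t _; rewrite derive1E; case: (fdf t).
  by split=> [t _||]; [case: (fdf t)|exact: cvg_at_right_filter (cf 0)|exact: cvg_at_left_filter (cf a)].
have [e1 e2] := LR _ _ etaD; have [p1 p2] := LR _ _ phiD.
rewrite !Rintegral_oo_cc; [|exact: cM..].
rewrite [X in - X](Rintegration_by_parts a0 _ e1 e2 _ p1 p2); [|exact: continuous_subspaceT..].
by rewrite eta0 etaa !mul0r subrr sub0r opprK.
Qed.

(** A test function vanishes near both ends. On its support the sum has a fixed finite number [N] of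
    terms, and integration by parts is done term by term. *)
Lemma weak_derivative_layer_sum (rev : bool) (a : R) (phi dphi : nat -> R -> R) (d : nat -> X) :
  0 < a -> (forall m t, is_derive t (1 : R) (phi m) (dphi m t)) ->
  (forall m, continuous (dphi m)) -> vanishes_far rev a phi -> vanishes_far rev a dphi ->
  weak_derivative a (layer_sum phi d) (layer_sum dphi d).
Proof.
move=> a0 phiD cdphi far dfar eta [etaD [c [b [c0 ba eta0]]]].
have cphi m : continuous (phi m) by move=> t; exact: is_derive_continuous (phiD m t).
have etaD0 t : is_derive t (1 : R) eta ((eta^`())%classic t).
  exact: derivable_is_derive (etaD 0 t) erefl.
have ceta : continuous eta by move=> t; exact: is_derive_continuous (etaD0 t).
have cdeta : continuous (eta^`())%classic.
  by move=> t; apply/differentiable_continuous/derivable1_diffP; exact: (etaD 1 t).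
have cM (f g : R -> R) : continuous f -> continuous g -> continuous (fun t => f t * g t).
  by move=> cf cg t; apply: cvgM; [exact: cf|exact: cg].
have mu_a : (mu (time_interval a) < +oo)%E.
  by rewrite lebesgue_measure_itv /= lte_fin a0 -EFinB ltry.
have m_a : measurable (time_interval a : set (measurableTypeR R)) by exact: measurable_itv.
(* The distance from the support [c, b] to the nearer end, which serves both values of [rev]. *)
have r0 : 0 < Num.min c (a - b) by rewrite lt_min c0 subr_gt0.
have [N NP] := exists_lt_exp2 (a / Num.min c (a - b)).
have {}NP : a / 2 ^+ N <= Num.min c (a - b).
  by move: NP; rewrite ltr_pdivrMr// ler_pdivrMr ?exprn_gt0// mulrC => /ltW.
have layerE (h : R -> R) (psi : nat -> R -> R) : vanishes_far rev a psi ->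
    (forall t, t \notin `[c, b] -> h t = 0) ->
    (fun t => (h t)%:C%C *: layer_sum psi d t) =
    (fun t => \sum_(m < N) (h t * psi m t)%:C%C *: d m).
  move=> pfar h0; apply/funext => t; have [|tcb] := boolP (t \in `[c, b]); last first.
    rewrite h0// scale0r big1// => m _; by rewrite mul0r scale0r.
  rewrite in_itv /= => /andP[ct tb]; have Nt : a / 2 ^+ N <= end_dist rev a t.
    by apply: le_trans NP _; rewrite /end_dist ge_min; case: (rev); apply/orP; [right|left]; lra.
  rewrite (layer_sumE a0 d pfar Nt).
  by rewrite scaler_sumr; apply: eq_bigr => m _; rewrite scalerA -rmorphM.
have bochner (h : R -> R) (psi : nat -> R -> R) : continuous h -> (forall m, continuous (psi m)) ->
    (forall t, t \notin `[c, b] -> h t = 0) ->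
    bochner_integral (time_interval a) (fun t => \sum_(m < N) (h t * psi m t)%:C%C *: d m)
      (\sum_(m < N) (\int[mu]_(t in time_interval a) (h t * psi m t))%R%:C%C *: d m).
  move=> ch cpsi h0.
  have /choice[M MP] : forall m, exists M, forall t, `|h t * psi m t| <= M.
    move=> m; apply: (@bounded_of_support _ c b); first exact: cM.
    by move=> t /h0 ->; rewrite mul0r.
  apply: (bochner_integral_sum ipE m_a mu_a N d _ MP) => m.
  by apply: continuous_measurable_fun; exact: cM.
exists (\sum_(m < N) (\int[mu]_(t in time_interval a) ((eta^`())%classic t * phi m t))%R%:C%C *: d m).
rewrite (layerE _ _ far (derive_support eta0)) (layerE _ _ dfar eta0); split.
  exact: bochner cdeta cphi (derive_support eta0).
have eta_out t : (t < c) || (b < t) -> eta t = 0.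
  by move=> h; apply: eta0; rewrite in_itv /= negb_and -!ltNge.
rewrite (_ : - _ = \sum_(m < N) (\int[mu]_(t in time_interval a) (eta t * dphi m t))%R%:C%C *: d m).
  exact: bochner ceta cdphi eta0.
rewrite -sumrN; apply: eq_bigr => m _.
rewrite (Rintegral_by_parts_support a0 etaD0 (phiD m) cdeta (cdphi m)).
- by rewrite rmorphN scaleNr opprK.
- by apply: eta_out; rewrite c0.
- by apply: eta_out; rewrite ba orbT.
Qed.

End WeakDerivative.

(** (y + b)^2 <= 3/2 y^2 + 3 b^2, and the weight halves at each step: the sum S satisfies S <= 3/4 S
    + 3/2 K, hence S <= 6 K. Induction on [N] replaces absorption. *)
Lemma discrete_hardy (R : realType) (y b : nat -> R) (K : R) :
  (forall n, 0 <= y n) -> (forall n, 0 <= b n) -> y 0%N = 0 -> (forall n, y n.+1 <= y n + b n) ->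
  (forall N, \sum_(n < N) 2 ^- n * b n ^+ 2 <= K) ->
  forall N, \sum_(n < N) 2 ^- n * y n ^+ 2 <= 6 * K.
Proof.
move=> y0 b0 y00 yS bK; elim=> [|N ih].
  by rewrite big_ord0; have := bK 0; rewrite big_ord0; lra.
rewrite big_ord_recl y00 expr0n mulr0 add0r.
have step n : 2 ^- n.+1 * y n.+1 ^+ 2 <= 3 / 4 * (2 ^- n * y n ^+ 2) + 3 / 2 * (2 ^- n * b n ^+ 2).
  have h : y n.+1 ^+ 2 <= (y n + b n) ^+ 2 by rewrite lerXn2r ?nnegrE ?addr_ge0.
  have h2 := sqr_ge0 (y n - 2 * b n).
  have -> : 2 ^- n.+1 = 2 ^- n / 2 :> R by rewrite exprS invfM mulrC.
  have p : 0 <= 2 ^- n :> R by rewrite invr_ge0 exprn_ge0.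
  have : 2 ^- n * y n.+1 ^+ 2 <= 2 ^- n * (3 / 2 * y n ^+ 2 + 3 * b n ^+ 2).
    by rewrite ler_wpM2l//; lra.
  by move: (2 ^- n) => q; lra.
rewrite (@le_trans _ _ (\sum_(n < N) (3 / 4 * (2 ^- n * y n ^+ 2) + 3 / 2 * (2 ^- n * b n ^+ 2))))//.
  by apply: ler_sum => n _; exact: step.
by rewrite big_split/= -!mulr_sumr; have := bK N; lra.
Qed.

Lemma sum_half_powers_le (R : realType) N : \sum_(n < N) 2 ^- n <= 2 :> R.
Proof.
suff -> : \sum_(n < N) 2 ^- n = 2 - 2 * 2 ^- N :> R.
  by rewrite gerBl mulr_ge0// invr_ge0 exprn_ge0.
elim: N => [|N ih]; first by rewrite big_ord0 expr0; lra.
by rewrite big_ord_recr /= ih exprS invfM; lra.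
Qed.

Section CutoffSum.
Context {R : realType} (X : completeNormedModType R[i]) (rev : bool) (a : R).
Hypothesis a0 : 0 < a.
Local Notation dist := (end_dist rev a).
Implicit Types (d : nat -> X) (x : X).

Definition cutoff_sum d := layer_sum (cutoff rev a) d.
Definition cutoff_derive_sum d := layer_sum (cutoff_derive rev a) d.

Lemma cutoff_vanishes_far : vanishes_far rev a (cutoff rev a).
Proof. by move=> m t mt; have [] := cutoff_far a0 mt. Qed.

Lemma cutoff_derive_vanishes_far : vanishes_far rev a (cutoff_derive rev a).
Proof. by move=> m t mt; have [] := cutoff_far a0 mt. Qed.

Lemma cutoff_sum_layer d n t : layer rev a n t ->
  cutoff_sum d t = \sum_(m < n) d m + (cutoff rev a n t)%:C%C *: d n /\
  cutoff_derive_sum d t = (cutoff_derive rev a n t)%:C%C *: d n.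
Proof.
move=> /andP[/ltW nt tn]; rewrite /cutoff_sum /cutoff_derive_sum.
rewrite (layer_sumE a0 d cutoff_vanishes_far nt) (layer_sumE a0 d cutoff_derive_vanishes_far nt).
have close (m : 'I_n) : cutoff rev a m t = 1 /\ cutoff_derive rev a m t = 0.
  by apply: cutoff_close => //; apply: le_trans tn _; exact: ler_layer.
rewrite !big_ord_recr /=; split; first congr (_ + _).
  by apply: eq_bigr => m _; have [-> _] := close m; rewrite scale1r.
by rewrite big1 ?add0r// => m _; have [_ ->] := close m; rewrite scale0r.
Qed.

Lemma cutoff_sum_end d x t : \sum_(m < n) d m @[n --> \oo] --> x -> dist t <= 0 ->
  cutoff_sum d t = x.
Proof.
move=> dx t0; apply: lim_normedE; rewrite (_ : (fun N => _) = (fun n => \sum_(m < n) d m))//.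
apply/funext => N; apply: eq_bigr => m _.
have [|-> _] := @cutoff_close _ rev _ a0 m t; last by rewrite scale1r.
by rewrite (le_trans t0)// ltW// divr_gt0// exprn_gt0.
Qed.

(** Away from the end the sum is locally finite. Near it, the value on layer [n] is the n-th partial
    sum plus a fraction of the next term, hence close to [x] for large [n]. *)
Lemma continuous_cutoff_sum d x : \sum_(m < n) d m @[n --> \oo] --> x ->
  continuous (cutoff_sum d).
Proof.
move=> dx t; have dist_lip s : `|dist s - dist t| = `|t - s|.
  rewrite /end_dist; case: rev; last by rewrite distrC.
  by congr (`| _ |); ring.
have [t0|t0] := leP (dist t) 0; last first.
  have [N NP] := exists_lt_exp2 (a / dist t).
  have {}NP : a / 2 ^+ N < dist t.
    by move: NP; rewrite ltr_pdivrMr// ltr_pdivrMr ?exprn_gt0// mulrC.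
  rewrite /continuous_at {2}/cutoff_sum (layer_sumE a0 d cutoff_vanishes_far (ltW NP)).
  apply: (@cvg_trans _ ((fun s => \sum_(m < N) (cutoff rev a m s)%:C%C *: d m) @ t)).
    apply: near_eq_cvg; apply/nbhs_ballP; exists (dist t - a / 2 ^+ N) => /=; first by rewrite subr_gt0.
    move=> s; rewrite /ball /= -dist_lip ltr_norml => /andP[h _].
    by rewrite /cutoff_sum (layer_sumE a0 d cutoff_vanishes_far (N := N))//; lra.
  suff term m : (cutoff rev a m s)%:C%C *: d m @[s --> t] --> (cutoff rev a m t)%:C%C *: d m.
    elim: N {NP} => [|N ih].
      rewrite big_ord0; under eq_fun do rewrite big_ord0.
      exact: (@cvg_cst X 0 R (nbhs t) _).
    under eq_fun do rewrite big_ord_recr.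
    rewrite big_ord_recr /=.
    exact: (@cvgD _ X R (nbhs t) _ _ _ _ _ ih (term N)).
  have cm : (fun s => cutoff rev a m s) @ t --> cutoff rev a m t := @continuous_cutoff _ rev a m t.
  apply/cvg_nrmP => e e0; have p : 0 < nrm (d m) + 1 by have := nrm_ge0 (d m); lra.
  have /cvgrPdist_lt/(_ _ (divr_gt0 e0 p)) := cm.
  apply: filterS => s; rewrite ltr_pdivlMr// => h.
  rewrite -scalerBl -rmorphB nrmZr; apply: le_lt_trans h.
  by rewrite ler_wpM2l//; lra.
rewrite /continuous_at (cutoff_sum_end dx t0); apply/cvg_nrmP => e e0.
(* Total error: e / 4 for the partial sum and twice e / 4 for [d n], a difference of two partial
   sums. *)
have /cvg_nrmP/(_ (e / 4)) := dx; rewrite divr_gt0// => /(_ isT)[N _ NP].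
apply/nbhs_ballP; exists (a / 2 ^+ N) => /=; first by rewrite divr_gt0// exprn_gt0.
move=> s; rewrite /ball /= -dist_lip ltr_norml => /andP[_ sN].
have [s0|s0] := leP (dist s) 0; first by rewrite (cutoff_sum_end dx s0) subrr nrm0.
have sN' : dist s < a / 2 ^+ N by lra.
have [n sn] : exists n, layer rev a n s.
  apply: layer_exists => //; rewrite s0 (le_trans (ltW sN'))// ler_pdivrMr ?exprn_gt0//.
  by rewrite ler_peMr ?(ltW a0)// exprn_ege1// ler1n.
have Nn : (N <= n)%N.
  rewrite leqNgt; apply/negP => nN; have /andP[h _] := sn.
  by have := ler_layer a0 nN; rewrite leNgt (lt_trans h sN').
have [-> _] := cutoff_sum_layer d sn.
have h1 := NP n Nn; have := NP n.+1 (leqW Nn); rewrite /= big_ord_recr /= => h2.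
have h3 : nrm (d n) <= nrm (x - \sum_(m < n) d m) + nrm (x - (\sum_(m < n) d m + d n)).
  apply: le_trans (nrmB _ _); set U := \sum_(m < n) d m.
  by rewrite opprB addrC addrA subrK [U + _]addrC addrK.
have h4 : nrm ((cutoff rev a n s)%:C%C *: d n) <= nrm (d n).
  by rewrite nrmZr ler_piMl ?nrm_ge0// normr_cutoff.
rewrite opprD addrA (le_lt_trans (nrmB _ _))//.
move: h1 => /= h1; lra.
Qed.

Lemma sum_bounded d x : \sum_(m < n) d m @[n --> \oo] --> x ->
  exists K, forall n, nrm (\sum_(m < n) d m) <= K.
Proof.
move=> /cvg_nrm dx; have [K [Kr KP]] : bounded_fun (fun n => nrm (\sum_(m < n) d m)).
  by apply: cvg_seq_bounded; apply/cvg_ex; exists (nrm x).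
exists (K + 1) => n; apply: le_trans (ler_norm _) _; apply: KP => //.
by rewrite ltrDl.
Qed.

End CutoffSum.

(** * Elements of the solution space with prescribed end values *)

Section Trace.
Context {R : realType} (X : completeNormedModType R[i]) (ip : {dot X for Num.conj}).
Hypothesis ipE : forall x : X, `|x| ^+ 2 = ip x x.
Variable A : operator X.
Hypothesis A_lin : linear_operator A.
Hypothesis A_closed : closed_operator A.
Hypothesis A_dense : dense (dom A).

Lemma half_space_trace (rev : bool) (a : R) (x : X) : 0 < a ->
  interpolation (2^-1) (graph_space A) x ->
  exists u f, [/\ L2 (whole_space X) a f, solution_space A a u,
    evolution_equation A a f u,
    u (if rev then a else 0) = x & u (if rev then 0 else a) = 0].
Proof.
move=> a0 /(half_space_approx ipE A_lin A_closed A_dense)[e [K [de eK AeK ex]]].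
have [K0 K0P] := sum_bounded ex.
pose u := cutoff_sum rev a e; pose v := cutoff_derive_sum rev a e.
(* Equal to A u inside the interval, where the sum is finite; the series of the A e_m is not claimed
   to converge at the end. *)
pose w := cutoff_sum rev a (fun m => A (e m)).
have m1 m : measurable_fun setT (cutoff rev a m : measurableTypeR R -> R).
  exact: continuous_measurable_fun (@continuous_cutoff _ rev a m).
have m2 m : measurable_fun setT (cutoff_derive rev a m : measurableTypeR R -> R).
  exact: continuous_measurable_fun (@continuous_cutoff_derive _ rev a m).
have smu Y (cY : compatible_norm Y) d (dY : forall m, Y (d m)) :
    strongly_measurable Y (time_interval a) (cutoff_sum rev a d).
  exact: (strongly_measurable_layer_sum a0 cY m1 (fun m t => normr_cutoff rev a m t)
    (cutoff_vanishes_far a0) dY).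
have smv : strongly_measurable (whole_space X) (time_interval a) v.
  exact: (strongly_measurable_layer_sum a0 (compatible_whole_space X) m2
    (fun m t => normr_cutoff_derive rev a0 m t) (cutoff_derive_vanishes_far a0) (fun=> I)).
have nrm_le (d : nat -> X) n t : layer rev a n t ->
    nrm (cutoff_sum rev a d t) <= nrm (\sum_(m < n) d m) + nrm (d n).
  move=> tn; have [-> _] := cutoff_sum_layer a0 d tn.
  rewrite (le_trans (nrmD _ _))// lerD2l nrmZr ler_piMl ?nrm_ge0//.
  exact: normr_cutoff.
have e_le n : nrm (e n) <= 2 * K0.
  have := K0P n; have := K0P n.+1; rewrite big_ord_recr /= => h1 h2.
  have := nrmB (\sum_(m < n) e m + e n) (\sum_(m < n) e m).
  by rewrite [_ + e n]addrC addrK [e n + _]addrC; lra.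
have u_le n t : layer rev a n t -> nrm (u t) ^+ 2 <= (3 * K0) ^+ 2.
  move=> tn; have h := nrm_le e n t tn; have h1 := K0P n; have h2 := e_le n.
  have h0 : 0 <= nrm (u t) := nrm_ge0 (u t).
  by rewrite lerXn2r ?nnegrE//; rewrite -/u in h; lra.
have dom_layer n t : layer rev a n t -> dom A (u t) /\ A (u t) = w t.
  move=> tn; rewrite /u /w; have [-> _] := cutoff_sum_layer a0 e tn.
  have [-> _] := cutoff_sum_layer a0 (fun m => A (e m)) tn.
  have ds : dom A (\sum_(m < n) e m) by apply: (dom_sum A_lin) => m; exact: de.
  have dz c : dom A (c *: e n) by apply: (domZ A_lin); exact: de.
  split; first exact: (domD A_lin).
  rewrite (appD A_lin)// (appZ A_lin)// (app_sum A_lin)// => m; exact: de.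
have dom_u t : time_interval a t -> dom A (u t) /\ A (u t) = w t.
  move=> /(@end_dist_time_interval _ rev)/andP[t0 ta].
  have [|n tn] := @layer_exists _ rev a t; first by rewrite t0 ltW.
  exact: dom_layer tn.
pose y n := nrm (\sum_(m < n) A (e m)); pose b n := nrm (A (e n)).
have Hy : forall N, \sum_(n < N) 2 ^- n * y n ^+ 2 <= 6 * K.
  apply: (@discrete_hardy _ y b) => //.
  - by move=> n; exact: nrm_ge0.
  - by move=> n; exact: nrm_ge0.
  - by rewrite /y big_ord0 nrm0.
  - by move=> n; rewrite /y big_ord_recr; exact: nrmD.
(* From |w| <= y_n + b_n on layer [n]; Hardy for [y] and the bound for [b] give 2 * 6 + 2 = 14
   below. *)
pose cw n := 2 * y n ^+ 2 + 2 * b n ^+ 2.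
have cw0 n : 0 <= cw n by rewrite addr_ge0// mulr_ge0// sqr_ge0.
have w_le n t : layer rev a n t -> nrm (w t) ^+ 2 <= cw n.
  move=> tn; have h : nrm (w t) <= y n + b n := nrm_le _ n t tn.
  have h2 : nrm (w t) ^+ 2 <= (y n + b n) ^+ 2 by rewrite lerXn2r ?nnegrE ?addr_ge0 ?nrm_ge0.
  by have := sqr_ge0 (y n - b n); rewrite /cw; lra.
have cwK N : \sum_(n < N) 2 ^- n * cw n <= 14 * K.
  rewrite (eq_bigr (fun n : 'I_N => 2 * (2 ^- n * y n ^+ 2) + 2 * (2 ^- n * b n ^+ 2))).
    by rewrite big_split/= -!mulr_sumr; have := Hy N; have := AeK N; rewrite -/b; lra.
  by move=> n _; rewrite /cw; ring.
(* Slope of the n-th cutoff times |e_n|, squared; multiplied by 2^-n this is 16 / a^2 times 2^n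
   |e_n|^2. *)
pose cv n := (2 ^+ n.+2 / a) ^+ 2 * nrm (e n) ^+ 2.
have cv0 n : 0 <= cv n by rewrite mulr_ge0// sqr_ge0.
have v_le n t : layer rev a n t -> nrm (v t) ^+ 2 <= cv n.
  move=> tn; rewrite /v; have [_ ->] := cutoff_sum_layer a0 e tn.
  have p : 0 <= 2 ^+ n.+2 / a by rewrite divr_ge0 ?exprn_ge0// ltW.
  rewrite nrmZr /cv -exprMn lerXn2r ?nnegrE//; try by apply: mulr_ge0; rewrite ?nrm_ge0.
  by rewrite ler_wpM2r ?nrm_ge0// normr_cutoff_derive.
have cvK N : \sum_(n < N) 2 ^- n * cv n <= 16 / a ^+ 2 * K.
  rewrite (eq_bigr (fun n : 'I_N => 16 / a ^+ 2 * (2 ^+ n * nrm (e n) ^+ 2))).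
    have p : 0 <= 16 / a ^+ 2 by rewrite divr_ge0// sqr_ge0.
    by rewrite -mulr_sumr; apply: (ler_wpM2l p); exact: eK.
  by move=> n _; rewrite /cv !exprS; field; rewrite ?expf_neq0// gt_eqF.
pose f t := v t - w t.
have L2v : L2 (whole_space X) a v.
  exact: (L2_layers a0 (compatible_whole_space X) (fun t _ => I) smv cv0 v_le cvK).
have uv : weak_derivative a u v.
  exact: (weak_derivative_layer_sum ipE e a0 (is_derive_cutoff rev a)
    (@continuous_cutoff_derive _ rev a) (cutoff_vanishes_far a0) (cutoff_derive_vanishes_far a0)).
have cuK N : \sum_(n < N) 2 ^- n * (3 * K0) ^+ 2 <= 2 * (3 * K0) ^+ 2.
  by rewrite -mulr_suml ler_wpM2r ?sqr_ge0// sum_half_powers_le.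
exists u, f; split.
- apply: (L2_layers a0 (compatible_whole_space X) (c := fun n => 2 * cv n + 2 * cw n)
    (K := 2 * (16 / a ^+ 2 * K) + 2 * (14 * K)) (rev := rev)) => //.
  + apply: strongly_measurable_sub smv _.
    exact: smu (compatible_whole_space X) _ (fun=> I).
  + by move=> n; rewrite addr_ge0// mulr_ge0.
  + move=> n t tn /=; have := v_le n t tn; have := w_le n t tn.
    have h : nrm (f t) ^+ 2 <= (nrm (v t) + nrm (w t)) ^+ 2.
      by rewrite lerXn2r ?nnegrE ?addr_ge0 ?nrm_ge0// nrmB.
    by have := sqr_ge0 (nrm (v t) - nrm (w t)); lra.
  + move=> N; rewrite (eq_bigr (fun n : 'I_N => 2 * (2 ^- n * cv n) + 2 * (2 ^- n * cw n))).
      by rewrite big_split/= -!mulr_sumr; have := cvK N; have := cwK N; lra.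
    by move=> n _; ring.
- split; first split.
  + exact: continuous_subspaceT (continuous_cutoff_sum a0 ex).
  + apply: (L2_layers a0 (compatible_whole_space X) (fun t _ => I) _ _ u_le cuK).
      exact: smu (compatible_whole_space X) _ (fun=> I).
    by move=> n; exact: sqr_ge0.
  + by exists v.
  apply: (L2_layers a0 (compatible_graph_space A_lin) (c := fun n => 2 * (3 * K0) ^+ 2 + 2 * cw n)
    (K := 2 * (2 * (3 * K0) ^+ 2) + 2 * (14 * K)) (rev := rev)).
  + by move=> t /dom_u[].
  + exact: smu (compatible_graph_space A_lin) _ de.
  + by move=> n; rewrite addr_ge0// mulr_ge0// sqr_ge0.
  + move=> n t tn /=; have [_ ->] := dom_layer n t tn.
    have := u_le n t tn; have := w_le n t tn.
    by have := sqr_ge0 (nrm (u t) - nrm (w t)); lra.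
  + move=> N; rewrite (eq_bigr (fun n : 'I_N => 2 * (2 ^- n * (3 * K0) ^+ 2) + 2 * (2 ^- n * cw n))).
      by rewrite big_split/= -!mulr_sumr; have := cuK N; have := cwK N; lra.
    by move=> n _; ring.
- by exists v; split => //; apply: aeW => t /dom_u[_ ->].
- apply: (cutoff_sum_end a0 ex); rewrite /end_dist; case: (rev) => //.
  by rewrite subrr.
- have h0 : a / 2 ^+ 0 <= end_dist rev a (if rev then 0 else a).
    by rewrite expr0 divr1 /end_dist; case: (rev); rewrite ?subr0.
  by rewrite /u /cutoff_sum (layer_sumE a0 e (cutoff_vanishes_far a0) h0) big_ord0.
Qed.

End Trace.

(** * Triangularity of the boundary operator *)

(** [f] and its cyclic shift have the same sum, so the termwise inequalities are all equalities. *)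
Lemma cyclic_mono_const (m : nat) (f : 'I_m -> nat) :
  (forall k, f k <= f (ordS k))%N -> forall k k', f k = f k'.
Proof.
move=> fS; have fSE k : f k = f (ordS k).
  have h : (\sum_k f k <= \sum_k f (ordS k) ?= iff [forall k, f k == f (ordS k)])%N.
    by apply: leqif_sum => i _; split; first exact: fS.
  have e : (\sum_k f k = \sum_k f (ordS k))%N by rewrite (reindex_inj (@ordS_inj m)).
  by have [_] := h; rewrite -e eqxx => /esym/forallP/(_ k)/eqP.
suff E n (n_m : (n < m)%N) (m0 : (0 < m)%N) : f (Ordinal n_m) = f (Ordinal m0).
  move=> [k km] [k' km']; have m0 : (0 < m)%N := leq_ltn_trans (leq0n k) km.
  by rewrite (E k km m0) (E k' km' m0).
elim: n n_m => [|n ih] n_m; first by congr f; apply: val_inj.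
rewrite -(ih (ltnW n_m)) [RHS]fSE; congr f; apply: val_inj => /=.
by rewrite modn_small.
Qed.

Section OppositeOperator.
Context {R : realType} (X : completeNormedModType R[i]) (A : operator X).

Lemma linear_operator_opp : linear_operator (opp_operator A) -> linear_operator A.
Proof.
move=> [d0 h]; split=> // c x y dx dy; have [/= d1 e] := h c x y dx dy; split=> //.
by apply: oppr_inj; rewrite e opprD scalerN.
Qed.

Lemma closed_operator_opp : closed_operator (opp_operator A) -> closed_operator A.
Proof.
move=> cA; rewrite /closed_operator.
rewrite (_ : mkset _ = (fun p : X * X => (p.1, - p.2)) @^-1`
    [set p | dom (opp_operator A) p.1 /\ p.2 = opp_operator A p.1]).
  have /continuous_closedP : continuous (fun p : X * X => (p.1, - p.2)).
    by move=> p; apply: cvg_pair; [exact: cvg_fst|apply: cvgN; exact: cvg_snd].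
  by apply.
by apply/seteqP; split=> p /= [dp e]; split=> //; [rewrite e|apply: oppr_inj].
Qed.

Lemma interpolation0 theta : linear_operator A -> interpolation theta (graph_space A) 0.
Proof.
move=> A_lin; exists (cst 0) => //; split.
- by move=> z; exact: cvg_cst.
- by exists 0 => z _; rewrite /= nrm0.
- by move=> z _; exact: derivable_cst.
- by move=> t; exact: (dom0 A_lin).
split; last by exists 0 => t /=; rewrite (app0 A_lin) nrm0 addr0.
by move=> t /=; rewrite subrr (app0 A_lin) nrm0 addr0; exact: cvg_cst.
Qed.

Lemma interpolationN theta x : linear_operator A ->
  interpolation theta (graph_space A) x -> interpolation theta (graph_space A) (- x).
Proof.
move=> A_lin [F [F1 [M F2] F3 F4 [F5 [M' F6]]] Fx].
have sN y : dom A y -> snorm (graph_space A) (- y) = snorm (graph_space A) y.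
  by move=> dy; rewrite /= nrmN -[- y]scaleN1r (appZ A_lin)// scaleN1r nrmN.
exists (fun z => - F z); last by rewrite Fx.
split.
- by move=> z; apply: cvgN; exact: F1.
- by exists M => z zs; rewrite nrmN F2.
- by move=> z zI; apply: derivableN; exact: F3.
- by move=> t /=; rewrite -scaleN1r; apply: (domZ A_lin); exact: F4.
split=> [t|]; last by exists M' => t; rewrite sN//; exact: F4.
rewrite (_ : (fun s => _) = fun s : R =>
  snorm (graph_space A) (F (1 +i* s)%C - F (1 +i* t)%C)); first exact: F5.
by apply/funext => s; rewrite -opprD sN//; apply: (domB A_lin); exact: F4.
Qed.

End OppositeOperator.

Section Triangularity.
Context {R : realType} (G : metric_graph R) (X : edge G -> completeNormedModType R[i]).
Context (A : forall j : edge G, operator (X j)).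
Context (B : (forall j : edge G, X j) -> (forall j : edge G, X j)).
Hypothesis A_lin : forall j, linear_operator (A j).
Hypothesis hB : bounded_on_KA A B.
Local Notation len := (@edge_length R G).
Hypothesis half_space_trace : forall (rev : bool) j x, half_space A j x ->
  exists uf : (R -> X j) * (R -> X j), [/\ L2 (whole_space (X j)) (len j) uf.2,
    solution_space (A j) (len j) uf.1, evolution_equation (A j) (len j) uf.2 uf.1,
    uf.1 (if rev then len j else 0) = x & uf.1 (if rev then 0 else len j) = 0].

(** A single choice for all edges and values: solutions built from the same value on an edge are
    then the same function there. *)
Lemma trace_choice (rev : bool) : exists U : forall j, X j -> (R -> X j) * (R -> X j),
  forall j x, half_space A j x -> [/\ L2 (whole_space (X j)) (len j) (U j x).2,
    solution_space (A j) (len j) (U j x).1, evolution_equation (A j) (len j) (U j x).2 (U j x).1,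
    (U j x).1 (if rev then len j else 0) = x & (U j x).1 (if rev then 0 else len j) = 0].
Proof.
exists (fun j x => if pselect (half_space A j x) is left h
  then sval (cid (half_space_trace rev h)) else (cst 0, cst 0)) => j x xj.
by case: pselect => // h; exact: svalP (cid (half_space_trace rev h)).
Qed.

Lemma KA_dfwith j x : half_space A j x -> KA A (@dfwith _ X (fun=> 0) j x).
Proof. by move=> xj i; case: dfwithP => // k _; exact: interpolation0. Qed.

Lemma bounded_on_KA0 i : B (fun=> 0) i = 0.
Proof.
have [_ Blin _] := hB; have K0 : KA A (fun=> 0) by move=> k; exact: interpolation0.
have E (c : R[i]) : (fun k => c *: (0 : X k) + 0) = (fun=> 0).
  by apply: functional_extensionality_dep => k; rewrite scaler0 addr0.
by have := Blin (- 1) _ _ K0 K0 i; rewrite E scaleN1r addNr.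
Qed.

Lemma block0 i j : block B i (0 : X j) = 0.
Proof.
rewrite /block; have -> : @dfwith _ X (fun=> 0) j 0 = fun=> 0.
  by apply: functional_extensionality_dep => k; case: dfwithP.
exact: bounded_on_KA0.
Qed.

Lemma iteratively_solvable_triangular rank phi : iteratively_solvable_by A B rank phi ->
  forall j k, (rank k < rank j)%N -> block_eq0 A B j k.
Proof.
move=> [_ phi_lin sol]; have [U UP] := trace_choice false; have [V VP] := trace_choice true.
(* Downward induction on the position of [j]: [n] bounds the number of positions from [j] to the
   end. *)
suff main n j : (#|edge G| <= rank j + n)%N -> forall k, (rank k < rank j)%N -> block_eq0 A B j k.
  by move=> j; apply: (main #|edge G|); rewrite leq_addl.
elim: n j => [|n ih] j; first by rewrite addn0 leqNgt ltn_ord.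
move=> jn k kj x xk; have H0 i : half_space A i 0 by exact: interpolation0.
(* All initial values are 0 and the only nonzero final value is [x], on [k]; [g] below is the
   boundary datum that this forces. The competitor [psi'] carries [g] in its initial values
   instead. *)
pose psi := @dfwith _ (fun i => R -> X i) (fun i => (U i 0).1) k (V k x).1.
pose f := @dfwith _ (fun i => R -> X i) (fun i => (U i 0).2) k (V k x).2.
pose g i := - B (@dfwith _ X (fun=> 0) k x) i.
have gK : KA A g.
  by have [BK _ _] := hB; move=> i; apply: interpolationN => //; exact: BK (KA_dfwith xk) i.
have psiP i : [/\ L2 (whole_space (X i)) (len i) (f i), solution_space (A i) (len i) (psi i),
    evolution_equation (A i) (len i) (f i) (psi i), psi i 0 = 0
    & psi i (len i) = @dfwith _ X (fun=> 0) k x i].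
  rewrite /psi /f; have [<-|ki] := eqVneq k i; first by rewrite !dfwithin; have [] := VP k x xk.
  by rewrite !dfwithout//; have [] := UP i 0 (H0 i).
have psi_end : (fun i => psi i (len i)) = @dfwith _ X (fun=> 0) k x.
  by apply: functional_extensionality_dep => i; have [] := psiP i.
pose psi' i := (U i (g i)).1; pose f' i := (U i (g i)).2.
have psi'P i : [/\ L2 (whole_space (X i)) (len i) (f' i), solution_space (A i) (len i) (psi' i),
    evolution_equation (A i) (len i) (f' i) (psi' i), psi' i 0 = g i & psi' i (len i) = 0].
  exact: UP (gK i).
have psi'_end : (fun i => psi' i (len i)) = fun=> 0.
  by apply: functional_extensionality_dep => i; have [] := psi'P i.
have sol1 : is_solution A B f g psi.
  split=> [i|i||i]; try by have [] := psiP i.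
    by rewrite psi_end; exact: KA_dfwith.
  by rewrite psi_end; have [_ _ _ -> _] := psiP i; rewrite sub0r.
have sol2 : is_solution A B f' g psi'.
  split=> [i|i||i]; try by have [] := psi'P i.
    by rewrite psi'_end => i; exact: H0.
  by rewrite psi'_end; have [_ _ _ -> _] := psi'P i; rewrite bounded_on_KA0 subr0.
(* The data [f] and [f'] differ, but the right-hand side of the boundary equation of [j] depends
   only on [g] and on the later components. *)
have [_ e1] := sol f g (fun i => let: And5 h _ _ _ _ := psiP i in h) gK psi sol1 j.
have [_ e2] := sol f' g (fun i => let: And5 h _ _ _ _ := psi'P i in h) gK psi' sol2 j.
have k_j i : (rank j <= rank i)%N -> k != i.
  by move=> ji; apply: contraTneq kj => ->; rewrite -leqNgt.
(* On a later edge the induction hypothesis gives g_i = - B_ik x = 0, so both solutions are [U i 0]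
   there, which need not be the zero function. *)
have psi_psi' i : (rank j < rank i)%N -> psi i = psi' i.
  move=> ji; rewrite /psi /psi' dfwithout ?(k_j _ (ltnW ji))//; suff -> : g i = 0 by [].
  have in_ : (#|edge G| <= rank i + n)%N by apply: leq_trans jn _; rewrite addnS -addSn leq_add2r.
  by have := ih i in_ k (ltn_trans kj ji) x xk; rewrite /g /block => ->; rewrite oppr0.
have rhsE : (if ((rank j).+1 < #|edge G|)%N then phi j psi g else g j) =
    (if ((rank j).+1 < #|edge G|)%N then phi j psi' g else g j).
  case: ifP => // jlast; have [ext _] := phi_lin j jlast; apply: ext => //.
  - by move=> i _; have [] := psiP i.
  - by move=> i _; have [] := psi'P i.
  - by move=> i ji t _; rewrite psi_psi'.
(* Both solutions end at 0 on [j], so the diagonal block drops out and the initial values 0 and g_j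
   = - B_jk x must agree. *)
move: e1; rewrite rhsE -e2; have [_ _ _ -> ->] := psiP j; have [_ _ _ -> ->] := psi'P j.
rewrite dfwithout ?k_j// block0 !subr0 => /esym/eqP; rewrite oppr_eq0 => /eqP.
exact.
Qed.

End Triangularity.

Theorem corollary7p4 (R : realType) (G : metric_graph R)
    (X : edge G -> completeNormedModType R[i])
    (A : forall j : edge G, operator (X j))
    (B : (forall j : edge G, X j) -> (forall j : edge G, X j))
    (m : nat) (l : 'I_m -> edge G)
    (hX : forall j, hilbert (X j))
    (hA : forall j, exists2 omega : R,
       omega < pi / 2 & sectorial omega (opp_operator (A j)))
    (hB : bounded_on_KA A B)
    (hloop : directed_loop l)
    (hrefl : reflected_loop A B l) :
  ~ iteratively_solvable_initial A B /\
  ((exists k k' : 'I_m, l k <> l k') -> ~ iteratively_solvable_cauchy A B).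
Proof.
have A_lin j : linear_operator (A j).
  by have [omega _ [_ [h _ _] _ _]] := hA j; exact: linear_operator_opp.
have tr (rev : bool) j x : half_space A j x ->
    exists uf : (R -> X j) * (R -> X j), [/\ L2 (whole_space (X j)) (edge_length j) uf.2,
    solution_space (A j) (edge_length j) uf.1,
    evolution_equation (A j) (edge_length j) uf.2 uf.1,
    uf.1 (if rev then edge_length j else 0) = x & uf.1 (if rev then 0 else edge_length j) = 0].
  move=> xj; have [ip ipE] := hX j; have [omega _ [_ [_ cA dA] _ _]] := hA j.
  have [u [f uf]] := half_space_trace ipE (A_lin j) (closed_operator_opp cA) dA rev
    (edge_length_gt0 j) xj.
  by exists (u, f).
have loop_const : iteratively_solvable_cauchy A B -> forall k k', l k = l k'.
  move=> [rank [phi sol]]; have tri := iteratively_solvable_triangular A_lin hB tr sol.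
  have [[rank' rankK _] _ _] := sol.
  (* A drop of the position from [l k] to [l (ordS k)] would make the block from the latter to the
     former vanish, against reflection. *)
  have h : forall k k', rank (l k) = rank (l k') :> nat.
    apply: cyclic_mono_const => k; rewrite leqNgt; apply/negP => /tri; exact: hrefl.
  by move=> k k'; apply: (can_inj rankK); apply: val_inj; exact: h.
split=> [[/loop_const lE diag]|[k [k' kk']] /loop_const/(_ k k')//].
have [m0 _] := hloop; pose k := Ordinal m0.
(* On a constant loop reflection says that a diagonal block is nonzero, which initial value problems
   exclude. *)
by apply: (hrefl k); rewrite -(lE k (ordS k)); exact: diag.
Qed.
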